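(* Let $(\Omega, D)$ be a tight spectral pair of bounded open sets in $\mathbb{R}^d$ and let $\Lambda \subseteq \mathbb{R}^d$ be a discrete set. Then $\Lambda$ is a spectrum of $\Omega$ if and only if $D + \Lambda$ is a tiling of $\mathbb{R}^d$.
   Context: Fourier transform: $\widehat{f}(\xi) = \int_{\mathbb{R}^d} f(x) e^{-2\pi i \langle \xi, x\rangle}\,dx$. $\mathbf{1}_E$ is the indicator function of $E$; $|E|$ is Lebesgue measure; $Z(h) = \{x \in \mathbb{R}^d : h(x) = 0\}$ for continuous $h:\mathbb{R}^d \to \mathbb{C}$; $A - A = \{a - a' : a, a' \in A\}$. Orthogonal packing region: for a measurable set $\Omega\subset\mathbb{R}^d$ of measure $1$, an open set $D \subseteq \mathbb{R}^d$ is an orthogonal packing region for $\Omega$ if $(D - D) \cap Z(\widehat{\mathbf{1}_\Omega}) = \emptyset$. It is tight if moreover $|D| = 1$. A pair $(\Omega, D)$ of bounded open sets in $\mathbb{R}^d$ is a tight spectral pair if each is a tight orthogonal packing region for the other (so $|\Omega| = |D| = 1$, $(D-D)\cap Z(\widehat{\mathbf{1}_\Omega}) = \emptyset$ and $(\Omega-\Omega)\cap Z(\widehat{\mathbf{1}_D}) = \emptyset$). Spectrum: with $e_\lambda(x) = e^{2\pi i \langle \lambda, x\rangle}$, the set $\Lambda$ is a spectrum of $\Omega$ (where $|\Omega|=1$) if $E_\Lambda = \{e_\lambda : \lambda \in \Lambda\}$ is an orthonormal basis of $L^2(\Omega)$. Tiling: for a measurable set $E$, ''$E + \Lambda$ is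 a tiling'' means $\sum_{\lambda \in \Lambda} \mathbf{1}_E(x - \lambda) = 1$ for a.e. $x \in \mathbb{R}^d$. *)

(* Defs.v *)
From HB Require Import structures.
From mathcomp Require Import all_boot all_order all_algebra.
From mathcomp Require Import all_classical all_reals all_analysis.
From mathcomp Require Import complex.

Set Implicit Arguments.
Unset Strict Implicit.
Unset Printing Implicit Defensive.

Import Order.TTheory GRing.Theory Num.Theory.
Import numFieldNormedType.Exports.

Local Open Scope classical_set_scope.
Local Open Scope ring_scope.

(* R^d is ['rV[R]_d] with its product topology; its norm is the sup norm.
   As for [n.-tuple T], its sigma-algebra is generated by the
   coordinates; by [open_measurable_rV] this is the Borel sigma-algebra. *)

Section measurable_rV.
Variables (R : realType) (d : nat).

Let coord (i : 'I_d) (x : 'rV[R]_d) : R := x ord0 i.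

Let rV_set0 : g_sigma_preimage coord set0.
Proof. exact: sigma_algebra0. Qed.

Let rV_setC A : g_sigma_preimage coord A -> g_sigma_preimage coord (~` A).
Proof. exact: sigma_algebraC. Qed.

Let rV_bigcup (F : (set 'rV[R]_d)^nat) :
  (forall i, g_sigma_preimage coord (F i)) ->
  g_sigma_preimage coord (\bigcup_i (F i)).
Proof. exact: sigma_algebra_bigcup. Qed.

HB.instance Definition _ :=
  @isMeasurable.Build default_measure_display 'rV[R]_d
    (g_sigma_preimage coord) rV_set0 rV_setC rV_bigcup.

Lemma measurable_coord (i : 'I_d) :
  measurable_fun [set: 'rV[R]_d] (fun x => x ord0 i).
Proof.
move=> _ Y mY; rewrite setTI; apply: sub_sigma_algebra => /=.
rewrite -bigcup_seq/=; exists i => /=; first by rewrite mem_index_enum.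
by exists Y => //; rewrite setTI.
Qed.

Lemma measurable_fun_coordP d' (T : measurableType d') (f : T -> 'rV[R]_d) :
  (forall i, measurable_fun [set: T] (fun t => f t ord0 i)) ->
  measurable_fun [set: T] f.
Proof.
move=> mf _ A mA; rewrite setTI.
suff sub : g_sigma_preimage coord `<=` [set B | measurable (f @^-1` B)].
  exact: sub.
apply: smallest_sub.
  split=> /=; first by rewrite preimage_set0.
    by move=> B mB; rewrite setTD preimage_setC; exact: measurableC.
  by move=> F mF; rewrite preimage_bigcup; exact: bigcupT_measurable.
rewrite -bigcup_seq; apply: bigcup_sub => i _ B [Y mY <-].
by rewrite setTI; have := mf i measurableT Y mY; rewrite setTI.
Qed.

End measurable_rV.

Lemma open_measurable_rV (R : realType) (d : nat) (A : set 'rV[R]_d) :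
  open A -> measurable A.
Proof.
move=> oA.
have mball (x : 'rV[R]_d) (e : R) : measurable (ball x e).
  have [e0|e0] := ltP 0 e; last first.
    rewrite (_ : ball x e = set0); first exact: measurable0.
    by apply/seteqP; split=> y //= -[]; rewrite ltNge e0.
  rewrite (_ : ball x e =
    \bigcap_(i in [set: 'I_d]) ((fun y : 'rV[R]_d => y ord0 i) @^-1`
      ball (x ord0 i) e)).
    apply: fin_bigcap_measurable => // i _.
    have := @measurable_coord R d i measurableT (ball (x ord0 i) e).
    by rewrite setTI; apply; rewrite ball_itv; exact: measurable_itv.
  apply/seteqP; split=> y; first by move=> [_ xy] i _; exact: xy.
  by move=> xy; split=> // i j; rewrite (ord1 i); exact: xy.
pose B (q : 'rV[rat]_d * rat) : set 'rV[R]_d :=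
  ball (map_mx (@ratr R) q.1) (ratr q.2).
rewrite (_ : A = \bigcup_q (if `[< B q `<=` A >] then B q else set0)).
  apply: countable_bigcupT_measurable; first exact: countableP.
  by move=> q; case: ifP => // _; exact: mball.
apply/seteqP; split=> [x Ax|x [q _]]; last first.
  by case: ifPn => // /asboolP + Bx; exact.
have /nbhs_ballP[e /= e0 xeA] : nbhs x A by exact: open_nbhs_nbhs.
have [r] : exists r : rat, ratr r \in `]0, e / 2[ by apply: rat_in_itvoo; exact: divr_gt0.
rewrite in_itv/= => /andP[r0 re].
have qex i : exists q : rat, ball (x ord0 i) (ratr r) (ratr q).
  have : x ord0 i - ratr r < x ord0 i + ratr r by rewrite ltrD2l gtrN.
  move=> /rat_in_itvoo[q qx]; exists q.
  by rewrite ball_itv.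
pose q : 'rV[rat]_d := \row_i sval (cid (qex i)).
have xq i : ball (x ord0 i) (ratr r) (ratr (q ord0 i)).
  by rewrite mxE; case: (cid (qex i)).
exists (q, r) => //; case: ifPn => [_|/asboolP[]].
  by split=> //= i j; rewrite mxE (ord1 i); exact/ball_sym/xq.
move=> y [_ qy]; apply: xeA; split=> // i j; rewrite (ord1 i).
have re' := ltW re; have := qy ord0 j; rewrite mxE => /(le_ball re') qy2.
have xq2 := le_ball re' (xq j).
by have := ball_triangle xq2 qy2; rewrite -splitr.
Qed.

Section lebesgue_measure_rV.
Variable R : realType.
Local Open Scope ereal_scope.

Definition cons_rV (d : nat) (p : measurableTypeR R * 'rV[R]_d) : 'rV[R]_d.+1 :=
  row_mx (const_mx p.1 : 'rV_1) p.2.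

Lemma cons_rV0 d (p : measurableTypeR R * 'rV[R]_d) : cons_rV p ord0 ord0 = p.1.
Proof.
rewrite (_ : ord0 = lshift d (ord0 : 'I_1) :> 'I_(1 + d)); last exact/val_inj.
by apply: etrans (row_mxEl _ _ _ _) _; rewrite mxE.
Qed.

Lemma cons_rVS d (p : measurableTypeR R * 'rV[R]_d) i :
  cons_rV p ord0 (lift ord0 i) = p.2 ord0 i.
Proof.
rewrite (_ : lift ord0 i = rshift 1 i :> 'I_(1 + d)); last exact/val_inj.
exact: row_mxEr.
Qed.

Lemma measurable_cons_rV d : measurable_fun setT (@cons_rV d).
Proof.
apply: measurable_fun_coordP => i; case: (unliftP ord0 i) => [j|] ->.
  apply: (eq_measurable_fun ((fun x : 'rV[R]_d => x ord0 j) \o snd)) => [p _|].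
    by rewrite cons_rVS.
  by apply: measurableT_comp; [exact: measurable_coord|exact: measurable_snd].
apply: (eq_measurable_fun fst) => [p _|]; last exact: measurable_fst.
by rewrite cons_rV0.
Qed.

Definition uncons_rV (d : nat) (x : 'rV[R]_d.+1) : measurableTypeR R * 'rV[R]_d :=
  (x ord0 ord0, \row_i x ord0 (lift ord0 i)).

Lemma cons_rVK d : cancel (@cons_rV d) (@uncons_rV d).
Proof.
move=> [t x]; rewrite /uncons_rV cons_rV0; congr pair.
by apply/rowP => i; rewrite mxE cons_rVS.
Qed.

Lemma measurable_uncons_rV d : measurable_fun setT (@uncons_rV d).
Proof.
apply: measurable_fun_pair; first exact: measurable_coord.
apply: measurable_fun_coordP => i.
apply: (eq_measurable_fun (fun x : 'rV[R]_d.+1 => x ord0 (lift ord0 i))).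
  by move=> x _; rewrite mxE.
exact: measurable_coord.
Qed.

Section prod.
Context (d : nat) (mu : {sigma_finite_measure set 'rV[R]_d -> \bar R}).

Let nu : set 'rV[R]_d.+1 -> \bar R :=
  pushforward (lebesgue_measure \x mu) (@cons_rV d).

Let mpre A : measurable A -> measurable (@cons_rV d @^-1` A).
Proof. by rewrite -[X in _ -> measurable X]setTI; exact: measurable_cons_rV. Qed.

Let nu0 : nu set0 = 0.
Proof. by rewrite /nu /pushforward preimage_set0 measure0. Qed.

Let nu_ge0 A : 0 <= nu A.
Proof. by rewrite /nu /pushforward; exact: measure_ge0. Qed.

Let nu_sigma_additive : semi_sigma_additive nu.
Proof.
move=> F mF tF mUF; rewrite /nu /pushforward preimage_bigcup.
apply: measure_semi_sigma_additive.
- by move=> n; exact: mpre.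
- apply/trivIsetP => /= i j _ _ ij; rewrite -preimage_setI.
  by move/trivIsetP : tF => /(_ _ _ _ _ ij) ->//; rewrite preimage_set0.
- by rewrite -preimage_bigcup; exact: mpre.
Qed.

HB.instance Definition _ := isMeasure.Build _ _ _ nu nu0 nu_ge0 nu_sigma_additive.

Let nu_sigma_finite : sigma_finite setT nu.
Proof.
have [F FT mF] : sigma_finite setT (lebesgue_measure \x mu).
  have /sigma_finiteP[G [TG ndG Goo]] := sigma_finiteT (@lebesgue_measure R).
  have /sigma_finiteP[H [TH ndH Hoo]] := sigma_finiteT mu.
  exists (fun k => G k `*` H k) => [|k].
    rewrite -setXTT TG TH; apply/seteqP; split=> -[x y] /=; last first.
      by move=> [n _ []/= ? ?]; split; exists n.
    move=> [[m _ Gx] [n _ Hy]]; exists (maxn m n) => //; split.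
      by move: x Gx; exact/subsetPset/ndG/leq_maxl.
    by move: y Hy; exact/subsetPset/ndH/leq_maxr.
  have [mG Gk] := Goo k; have [mH Hk] := Hoo k.
  split; first exact: measurableX.
  by rewrite product_measure1E// lte_mul_pinfty// ge0_fin_numE.
exists (fun k => @uncons_rV d @^-1` F k); first by rewrite -preimage_bigcup -FT.
move=> k; have [mFk Fk] := mF k; split.
  by rewrite -[X in measurable X]setTI; exact: measurable_uncons_rV.
rewrite /nu /pushforward -comp_preimage.
by rewrite (_ : _ \o _ = id) ?preimage_id//; apply/funext => p; exact: cons_rVK.
Qed.

HB.instance Definition _ := Measure_isSigmaFinite.Build _ _ _ nu nu_sigma_finite.

Lemma sigma_finite_cons_rV :
  exists nu : {sigma_finite_measure set 'rV[R]_d.+1 -> \bar R},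
    nu = pushforward (lebesgue_measure \x mu) (@cons_rV d)
      :> (set 'rV[R]_d.+1 -> \bar R).
Proof. by exists nu. Qed.

End prod.

(* The product of [d] copies of the Lebesgue measure of R, restricted to the
   Borel sets; see [lebesgue_rV_box].  For [d = 0] it is the unit mass on the
   only point of R^0. *)
Fixpoint lebesgue_rV (d : nat) : set 'rV[R]_d -> \bar R :=
  match d with
  | 0%N => \d_(0%R : 'rV[R]_0)
  | n.+1 => pushforward (lebesgue_measure \x @lebesgue_rV n) (@cons_rV n)
  end.

Let lebesgue_rV_ex d :
  exists mu : {sigma_finite_measure set 'rV[R]_d -> \bar R},
    mu = @lebesgue_rV d :> (set 'rV[R]_d -> \bar R).
Proof.
elim: d => [|d [mu muE]] /=; first by exists (\d_(0%R : 'rV[R]_0)).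
by rewrite -muE; exact: sigma_finite_cons_rV.
Qed.

Let lebesgue_rV0 d : @lebesgue_rV d set0 = 0.
Proof. by have [mu <-] := lebesgue_rV_ex d; rewrite measure0. Qed.

Let lebesgue_rV_ge0 d A : 0 <= @lebesgue_rV d A.
Proof. by have [mu <-] := lebesgue_rV_ex d; exact: measure_ge0. Qed.

Let lebesgue_rV_sigma_additive d : semi_sigma_additive (@lebesgue_rV d).
Proof.
by have [mu <-] := lebesgue_rV_ex d; exact: measure_semi_sigma_additive.
Qed.

HB.instance Definition _ d := isMeasure.Build _ _ _ (@lebesgue_rV d)
  (@lebesgue_rV0 d) (@lebesgue_rV_ge0 d) (@lebesgue_rV_sigma_additive d).

Let lebesgue_rV_sigma_finite d : sigma_finite setT (@lebesgue_rV d).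
Proof. by have [mu <-] := lebesgue_rV_ex d; exact: sigma_finiteT. Qed.

HB.instance Definition _ d := Measure_isSigmaFinite.Build _ _ _ (@lebesgue_rV d)
  (@lebesgue_rV_sigma_finite d).

Lemma lebesgue_rV_box d (A : 'I_d -> set R) :
  (forall i, measurable (A i)) ->
  lebesgue_rV [set x : 'rV[R]_d | forall i, A i (x ord0 i)] =
  \prod_(i < d) lebesgue_measure (A i).
Proof.
elim: d A => [|d IHd] A mA.
  by rewrite big_ord0 /= diracE mem_set// => -[].
rewrite big_ord_recl -IHd// -product_measure1E//; last first.
  rewrite (_ : [set _ | _] = \bigcap_(i in [set: 'I_d])
      ((fun y : 'rV[R]_d => y ord0 i) @^-1` A (lift ord0 i))).
    apply: fin_bigcap_measurable => // i _; rewrite -[X in measurable X]setTI.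
    exact: measurable_coord.
  by apply/seteqP; split=> x /= xA i; [move=> _|]; exact: xA.
  exact: (mA ord0).
rewrite /= /pushforward; congr (product_measure1 lebesgue_measure (@lebesgue_rV d) _); apply/seteqP.
split=> p /=.
  by move=> pA; split=> [|i]; [rewrite -cons_rV0|rewrite -cons_rVS]; exact: pA.
by move=> [A0 AS] i; case: (unliftP ord0 i) => [j|] ->;
  rewrite ?cons_rVS ?cons_rV0//; exact: AS.
Qed.

End lebesgue_measure_rV.

Section tight_spectral_pairs.
Variables (R : realType) (d : nat).
Local Notation V := 'rV[R]_d.
Local Notation mu := (@lebesgue_rV R d).
Implicit Types (A Omega D Lambda : set V) (f g : V -> R[i]).

Definition dotp (x y : V) : R := \sum_(i < d) x ord0 i * y ord0 i.

(* e^(i t) *)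
Definition cis (t : R) : R[i] := Complex (cos t) (sin t).

(* e_l(x) = e^(2 pi i <l, x>) *)
Definition cexp (l x : V) : R[i] := cis (2 * pi * dotp l x).

(* The two real integrals are 0 by convention when infinite or undefined; only
   integrable [f] are meant. *)
Definition cintegral A f : R[i] :=
  Complex (\int[mu]_(x in A) complex.Re (f x))
          (\int[mu]_(x in A) complex.Im (f x)).

Definition fourier f (xi : V) : R[i] :=
  cintegral setT (fun x => f x * cis (- (2 * pi * dotp xi x))).

Definition zero_set f : set V := [set x | f x = 0].

Definition diff_set A : set V := [set a - a' | a in A & a' in A].

(* [D] is an orthogonal packing region for the set [Omega] of measure 1. *)
Definition orthogonal_packing_region Omega D : Prop :=
  [/\ measurable Omega, mu Omega = 1%E, open D &
      diff_set D `&` zero_set (fourier \1_Omega) = set0].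

Definition tight_orthogonal_packing_region Omega D : Prop :=
  orthogonal_packing_region Omega D /\ mu D = 1%E.

Definition tight_spectral_pair Omega D : Prop :=
  [/\ open Omega /\ bounded_set Omega,
      open D /\ bounded_set D,
      tight_orthogonal_packing_region Omega D &
      tight_orthogonal_packing_region D Omega].

(* [Lambda] is discrete for the induced topology; it need not be closed. *)
Definition discrete_set Lambda : Prop := Lambda `<=` isolated Lambda.

Definition L2norm Omega f : \bar R :=
  'N[mu]_2%:E[(fun x => (Normc.normc (f x))%:E) \_ Omega].

(* The square integrable functions on [Omega], not quotiented by equality almost
   everywhere; the values outside [Omega] are irrelevant. *)
Definition L2 Omega : set (V -> R[i]) :=
  [set f | [/\ measurable_fun Omega (fun x => complex.Re (f x)),
               measurable_fun Omega (fun x => complex.Im (f x)) &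
               (L2norm Omega f < +oo)%E]].

Definition L2inner Omega f g : R[i] :=
  cintegral Omega (fun x => f x * conjc (g x)).

(* The family [cexp l], [l] in [Lambda], is orthonormal in L^2(Omega) and its
   linear span is dense in L^2(Omega). *)
Definition spectrum Omega Lambda : Prop :=
  (forall l m, Lambda l -> Lambda m ->
     L2inner Omega (cexp l) (cexp m) = (l == m)%:R) /\
  (forall f, L2 Omega f -> forall e : R, 0 < e ->
     exists (s : seq V) (c : V -> R[i]),
       [set` s] `<=` Lambda /\
       (L2norm Omega (fun x => f x - \sum_(l <- s) c l * cexp l x)%R < e%:E)%E).

Definition tiling A Lambda : Prop :=
  {ae mu, forall x, (\esum_(l in Lambda) (\1_A (x - l)%R : R)%:E = 1)%E}.

End tight_spectral_pairs.

(* Main.v *)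
From HB Require Import structures.
From mathcomp Require Import all_boot all_order all_algebra.
From mathcomp Require Import all_classical all_reals all_analysis.
From mathcomp Require Import measurable_realfun complex ring lra.
Require Import Defs.

(* For [f] in L^2 with bounded support, and [M_y f] its modulation by [y], the
   average over [y] in [D] of the sum of [|fourier (M_y f) l|^2] over finitely
   many [l] in [Lambda] is the integral of [|fourier f|^2] against the sum of the
   indicators of the translates [D + l].

   If [Lambda] is a spectrum, orthogonality puts the differences [l - m] in the
   zero set of the transform of [1_Omega], so the translates of [D] are disjoint.
   By Parseval the averages for the modulations [f] of [1_Omega] tend to 1, which
   is also the integral of [|fourier f|^2]; hence every translate of the transform
   of [1_Omega] vanishes almost everywhere off [D + Lambda]. Since this transform
   is 1 at 0, [D + Lambda] has full measure.

   If [D + Lambda] is a tiling, let [B (f, g)] be the defect in Parseval's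
   identity; the average of [B (M_y f, M_y g)] over [y] in [D] is 0. When [f] and
   [g] are concentrated near points [c] and [c'] of [Omega], [M_y f] and [M_y g]
   are close to multiples of [f] and [g], and this average is close to
   [B (f, g)] times the transform of [1_D] at [c - c'], which is bounded away
   from 0. Applying the same estimate to the error terms, again and again, gives
   [B (f, g) = 0]. Cutting into small pieces extends this to all functions
   supported in a compact subset of [Omega], and these are dense. *)

Set Implicit Arguments.
Unset Strict Implicit.
Unset Printing Implicit Defensive.

Import Order.TTheory GRing.Theory Num.Theory.
Import numFieldNormedType.Exports.

Local Open Scope classical_set_scope.
Local Open Scope ring_scope.

(** If Bessel's inequality were known for the exponentials of a tiling set [Lambda], the defect
    [B (M_y f, M_y f)] would have a constant sign, and a mean value 0 over [D] would force it to
    vanish for almost all [y]. But orthogonality is part of what is to be proved, so no sign is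
    available and cancellation between different [y] has to be excluded. This is why small pieces
    enter: near [c] the modulation is almost a constant phase, and averaging the relative phase of
    two pieces gives the transform of the indicator of [D] at [c - c']. It is nonzero because
    [c - c'] lies in [Omega - Omega], and compactness makes the lower bound uniform; this bound then
    dictates how small the pieces must be. The iteration also needs a starting bound on [B] that
    does not depend on the finite part of [Lambda] in use; it is itself obtained by averaging and
    repeated halving, from a trivial bound that grows with the number of frequencies. All transforms
    are taken of functions of bounded support, where they are continuous, and Plancherel's identity
    is derived from explicit integrals for intervals. *)

Section squared_modulus.
Variable R : realType.
Implicit Types (z w : R[i]) (s t : R).

(** Being a polynomial in the real and imaginary parts, it makes most identities a matter of [ring]
    and keeps square roots out of the L^2 estimates. *)
Definition sqn z : R := complex.Re z ^+ 2 + complex.Im z ^+ 2.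

Lemma sqn_ge0 z : 0 <= sqn z.
Proof. by rewrite addr_ge0// sqr_ge0. Qed.

Lemma sqn0 : sqn 0 = 0.
Proof. by rewrite /sqn /= expr0n addr0. Qed.

Lemma sqn_eq0 z : sqn z = 0 -> z = 0.
Proof.
move=> /eqP; rewrite paddr_eq0 ?sqr_ge0// !sqrf_eq0.
by case: z => a b /= /andP[/eqP -> /eqP ->].
Qed.

Lemma sqnM z w : sqn (z * w) = sqn z * sqn w.
Proof. by case: z w => [a b] [c e]; rewrite /sqn /=; ring. Qed.

Lemma sqnJ z : sqn (conjc z) = sqn z.
Proof. by case: z => [a b]; rewrite /sqn /= sqrrN. Qed.

Lemma sqnN z : sqn (- z) = sqn z.
Proof. by case: z => [a b]; rewrite /sqn /= !sqrrN. Qed.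

Lemma sqnR s : sqn (s%:C)%C = s ^+ 2.
Proof. by rewrite /sqn /= expr0n addr0. Qed.

Lemma parallelogram z w : sqn (z + w) + sqn (z - w) = 2 * sqn z + 2 * sqn w.
Proof. by case: z w => [a b] [c e]; rewrite /sqn /=; ring. Qed.

Lemma sqnD_le z w : sqn (z + w) <= 2 * sqn z + 2 * sqn w.
Proof. by rewrite -parallelogram lerDl sqn_ge0. Qed.

Lemma mul_conjc z : z * conjc z = (sqn z)%:C%C.
Proof.
by case: z => [a b]; apply/eqP; rewrite eq_complex /sqn /=;
  apply/andP; split; apply/eqP; ring.
Qed.

Lemma sqn_normc z : sqn z = Normc.normc z ^+ 2.
Proof. by case: z => [a b]; rewrite /= sqr_sqrtr// addr_ge0// sqr_ge0. Qed.

Lemma ReM_le z w : `|complex.Re (z * w)| <= sqn z + sqn w.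
Proof.
case: z w => [a b] [c e]; rewrite /sqn /=.
rewrite ler_norml; apply/andP; split.
  have := sqr_ge0 (a + c); have := sqr_ge0 (b - e).
  have := sqr_ge0 a; have := sqr_ge0 b; have := sqr_ge0 c; have := sqr_ge0 e.
  by lra.
have := sqr_ge0 (a - c); have := sqr_ge0 (b + e).
have := sqr_ge0 a; have := sqr_ge0 b; have := sqr_ge0 c; have := sqr_ge0 e.
by lra.
Qed.

Lemma ImM_le z w : `|complex.Im (z * w)| <= sqn z + sqn w.
Proof.
(* The imaginary part of a number is the real part of its product with [- i], a factor of modulus
   1. *)
have := @ReM_le (z * Complex 0 (-1)) w; rewrite sqnM.
rewrite (_ : sqn (Complex 0 (-1)) = 1) ?mulr1; last by rewrite /sqn /=; ring.
rewrite (_ : complex.Re _ = complex.Im (z * w))//.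
by case: z w => [a b] [c e] /=; ring.
Qed.

Lemma cis0 : cis (0 : R) = 1.
Proof. by rewrite /cis cos0 sin0. Qed.

Lemma cisD s t : cis (s + t) = cis s * cis t.
Proof.
by rewrite /cis cosD sinD; apply/eqP; rewrite eq_complex /=;
  apply/andP; split; apply/eqP; ring.
Qed.

Lemma cisN t : cis (- t) = conjc (cis t).
Proof. by rewrite /cis cosN sinN. Qed.

Lemma sqn_cis t : sqn (cis t) = 1.
Proof. by rewrite /sqn /= cos2Dsin2. Qed.

Lemma cis_conjc t : cis t * conjc (cis t) = 1.
Proof. by rewrite mul_conjc sqn_cis. Qed.

Lemma sqr_sin_le t : sin t ^+ 2 <= t ^+ 2.
Proof.
suff h (u : R) : 0 <= u -> `|sin u| <= u.
  case: (leP 0 t) => t0.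
    by rewrite -real_normK ?num_real// lerXn2r ?nnegrE//; exact: h.
  rewrite -[sin t ^+ 2]sqrrN -sinN -[t ^+ 2]sqrrN -real_normK ?num_real//.
  have Nt0 : 0 <= - t by rewrite oppr_ge0 ltW.
  by rewrite lerXn2r ?nnegrE//; exact: h.
rewrite le_eqVlt => /predU1P[<-|u0]; first by rewrite sin0 normr0.
have [|c _] := @MVT_segment R sin cos _ _ (ltW u0).
  by apply: continuous_subspaceT => x; exact: continuous_sin.
rewrite sin0 !subr0 => ->; rewrite normrM (gtr0_norm u0).
by rewrite ler_piMl ?(ltW u0)// cos_max.
Qed.

(** A chord of the unit circle has squared length [4 * sin ((s - t) / 2) ^+ 2]. *)
Lemma sqn_cisB s t : sqn (cis s - cis t) <= (s - t) ^+ 2.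
Proof.
have -> : sqn (cis s - cis t) = 4 * sin ((s - t) / 2) ^+ 2.
  have e (a b : R) : sqn (cis a - cis b) = 2 - 2 * cos (a - b).
    rewrite cosB /sqn /=; have := cos2Dsin2 a; have := cos2Dsin2 b.
    move: (cos a) (sin a) (cos b) (sin b) => ca sa cb sb hb ha.
    transitivity ((ca ^+ 2 + sa ^+ 2) + (cb ^+ 2 + sb ^+ 2)
      - 2 * (ca * cb + sa * sb)); first by ring.
    by rewrite ha hb; ring.
  rewrite e; set u := (s - t) / 2.
  rewrite (_ : s - t = u *+ 2) ?cos_mulr2n; last by rewrite /u; field.
  by have := cos2Dsin2 u; lra.
have := sqr_sin_le ((s - t) / 2).
by rewrite (_ : (s - t) ^+ 2 = 4 * ((s - t) / 2) ^+ 2); [lra|field].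
Qed.

End squared_modulus.

(** * Square-integrable complex functions *)

Section complex_integral.
Context dd (T : measurableType dd) (R : realType).
Variable mu : {measure set T -> \bar R}.
Implicit Types (f g h : T -> R[i]) (a b : T -> R) (c : R[i]).
Local Notation rintegrable a := (mu.-integrable [set: T] (EFin \o a)).

Definition cmeasurable f :=
  measurable_fun [set: T] (fun x => complex.Re (f x)) /\
  measurable_fun [set: T] (fun x => complex.Im (f x)).

Definition cintegrable f :=
  rintegrable (fun x => complex.Re (f x)) /\
  rintegrable (fun x => complex.Im (f x)).

(** An arbitrary measure is allowed because the same calculus serves R, products and R^d; on R^d it
    is convertible to [cintegral setT]. *)
Definition cint f : R[i] :=
  Complex (\int[mu]_x complex.Re (f x)) (\int[mu]_x complex.Im (f x)).

Definition L2fun f := cmeasurable f /\ rintegrable (fun x => sqn (f x)).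

Definition inner f g := cint (fun x => f x * conjc (g x)).

Definition nrm2 f : R := \int[mu]_x sqn (f x).

Lemma cmeasurable_cst c : cmeasurable (fun=> c).
Proof. by split; exact: measurable_cst. Qed.

Lemma cmeasurableD f g :
  cmeasurable f -> cmeasurable g -> cmeasurable (fun x => f x + g x).
Proof.
move=> [fr fi] [gr gi]; split.
  rewrite (_ : (fun x => _) =
    (fun x => complex.Re (f x)) \+ (fun x => complex.Re (g x))).
    exact: measurable_funD.
  by apply/funext => x /=; case: (f x) (g x) => ? ? [].
rewrite (_ : (fun x => _) =
  (fun x => complex.Im (f x)) \+ (fun x => complex.Im (g x))).
  exact: measurable_funD.
by apply/funext => x /=; case: (f x) (g x) => ? ? [].
Qed.

Lemma cmeasurableJ f : cmeasurable f -> cmeasurable (fun x => conjc (f x)).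
Proof.
move=> [fr fi]; split.
  by apply: eq_measurable_fun fr => x _; case: (f x).
apply: (eq_measurable_fun (\- (fun x => complex.Im (f x)))) => [x _|].
  by rewrite /=; case: (f x).
exact: measurable_funN.
Qed.

Lemma cmeasurableM f g :
  cmeasurable f -> cmeasurable g -> cmeasurable (fun x => f x * g x).
Proof.
move=> [fr fi] [gr gi]; split.
  rewrite (_ : (fun x => _) =
      ((fun x => complex.Re (f x)) \* (fun x => complex.Re (g x))) \-
      ((fun x => complex.Im (f x)) \* (fun x => complex.Im (g x)))).
    by apply: measurable_funB; exact: measurable_funM.
  by apply/funext => x /=; case: (f x) (g x) => ? ? [].
rewrite (_ : (fun x => _) =
    ((fun x => complex.Re (f x)) \* (fun x => complex.Im (g x))) \+
    ((fun x => complex.Im (f x)) \* (fun x => complex.Re (g x)))).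
  by apply: measurable_funD; exact: measurable_funM.
by apply/funext => x /=; case: (f x) (g x) => ? ? [].
Qed.

Lemma cmeasurableZ c f : cmeasurable f -> cmeasurable (fun x => c * f x).
Proof. by apply: cmeasurableM; exact: cmeasurable_cst. Qed.

Lemma cmeasurableB f g :
  cmeasurable f -> cmeasurable g -> cmeasurable (fun x => f x - g x).
Proof.
move=> mf mg; rewrite (_ : (fun _ => _) = fun x => f x + (-1) * g x).
  by apply: cmeasurableD => //; exact: cmeasurableZ.
by apply/funext => x; rewrite mulN1r.
Qed.

Lemma measurable_sqn f : cmeasurable f -> measurable_fun setT (fun x => sqn (f x)).
Proof.
by move=> [fr fi]; apply: measurable_funD; exact: measurable_funX.
Qed.

Lemma le_rintegrable a b : measurable_fun setT a -> rintegrable b ->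
  (forall x, `|a x| <= b x) -> rintegrable a.
Proof.
move=> ma ib ab; apply: (le_integrable _ _ _ ib) => //.
  exact/measurable_EFinP.
move=> x _ /=; rewrite lee_fin (le_trans (ab x))//.
exact: ler_norm.
Qed.

Lemma rintegrableD a b : rintegrable a -> rintegrable b ->
  rintegrable (fun x => a x + b x).
Proof. by move=> ia ib; exact: (integrableD _ ia ib). Qed.

Lemma rintegrableZ (k : R) a : rintegrable a -> rintegrable (fun x => k * a x).
Proof. by move=> ia; exact: (integrableZl _ k ia). Qed.

Lemma cintegrable_measurable f : cintegrable f -> cmeasurable f.
Proof.
by move=> [/integrableP[/measurable_EFinP r _] /integrableP[/measurable_EFinP i _]].
Qed.

Lemma cintegrableD f g :
  cintegrable f -> cintegrable g -> cintegrable (fun x => f x + g x).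
Proof.
move=> [fr fi] [gr gi]; split.
  apply: eq_integrable (rintegrableD fr gr) => // x _ /=.
  by case: (f x) (g x) => ? ? [].
apply: eq_integrable (rintegrableD fi gi) => // x _ /=.
by case: (f x) (g x) => ? ? [].
Qed.

Lemma cintegrableZ c f : cintegrable f -> cintegrable (fun x => c * f x).
Proof.
case: c => u v [fr fi]; split.
  apply: eq_integrable (rintegrableD (rintegrableZ u fr) (rintegrableZ (- v) fi)) => //.
  by move=> x _ /=; case: (f x) => ? ? /=; rewrite mulNr.
apply: eq_integrable (rintegrableD (rintegrableZ u fi) (rintegrableZ v fr)) => //.
by move=> x _ /=; case: (f x).
Qed.

Lemma cintegrable0 : cintegrable (fun=> 0).
Proof. by split; exact: integrable0. Qed.

Lemma cintegrable_sum (I : Type) (s : seq I) (F : I -> T -> R[i]) :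
  (forall i, cintegrable (F i)) -> cintegrable (fun x => \sum_(i <- s) F i x).
Proof.
move=> iF; elim: s => [|i s IH].
  by under eq_fun do rewrite big_nil; exact: cintegrable0.
by under eq_fun do rewrite big_cons; exact: cintegrableD.
Qed.

Lemma cintD f g : cintegrable f -> cintegrable g ->
  cint (fun x => f x + g x) = cint f + cint g.
Proof.
move=> [fr fi] [gr gi]; rewrite /cint; apply/eqP; rewrite eq_complex /=.
rewrite -!RintegralD//; apply/andP; split; apply/eqP; apply: eq_Rintegral => x _.
  by case: (f x) (g x) => ? ? [].
by case: (f x) (g x) => ? ? [].
Qed.

Lemma cintZ c f : cintegrable f -> cint (fun x => c * f x) = c * cint f.
Proof.
case: c => u v [fr fi]; rewrite /cint; apply/eqP; rewrite eq_complex /=.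
rewrite -!RintegralZl//; apply/andP; split; apply/eqP.
  rewrite -RintegralB//; [|exact: rintegrableZ|exact: rintegrableZ].
  by apply: eq_Rintegral => x _; case: (f x).
rewrite -RintegralD//; [|exact: rintegrableZ|exact: rintegrableZ].
by apply: eq_Rintegral => x _; case: (f x).
Qed.

Lemma cint0 : cint (fun=> 0) = 0.
Proof. by rewrite /cint /= Rintegral_cst// mul0r. Qed.

Lemma cint_sum (I : Type) (s : seq I) (F : I -> T -> R[i]) :
  (forall i, cintegrable (F i)) ->
  cint (fun x => \sum_(i <- s) F i x) = \sum_(i <- s) cint (F i).
Proof.
move=> iF; elim: s => [|i s IH].
  by under eq_fun do rewrite big_nil; rewrite cint0 big_nil.
under eq_fun do rewrite big_cons; rewrite big_cons -IH cintD//.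
exact: cintegrable_sum.
Qed.

Lemma cintB f g : cintegrable f -> cintegrable g ->
  cint (fun x => f x - g x) = cint f - cint g.
Proof.
move=> fi gi; rewrite -mulN1r -(cintZ _ gi) -cintD//; last exact: cintegrableZ.
by congr cint; apply/funext => x; rewrite mulN1r.
Qed.

Lemma cintJ f : cintegrable f -> cint (fun x => conjc (f x)) = conjc (cint f).
Proof.
move=> [fr fi]; rewrite /cint; apply/eqP; rewrite eq_complex /=.
rewrite -[X in _ && (_ == X)]mulN1r -RintegralZl//.
apply/andP; split; apply/eqP; apply: eq_Rintegral => x _.
  by case: (f x).
by case: (f x) => ? ? /=; rewrite mulN1r.
Qed.

Lemma L2fun0 : L2fun (fun=> 0).
Proof.
split; first exact: cmeasurable_cst.
by under eq_fun do rewrite sqn0; exact: integrable0.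
Qed.

Lemma le_L2fun f a : cmeasurable f -> rintegrable a ->
  (forall x, sqn (f x) <= a x) -> L2fun f.
Proof.
move=> mf ia fa; split=> //; apply: le_rintegrable ia _.
  exact: measurable_sqn.
by move=> x; rewrite ger0_norm ?sqn_ge0.
Qed.

Lemma L2funD f g : L2fun f -> L2fun g -> L2fun (fun x => f x + g x).
Proof.
move=> [mf jf] [mg jg].
apply: (@le_L2fun _ (fun x => 2 * sqn (f x) + 2 * sqn (g x))).
- exact: cmeasurableD.
- by apply: rintegrableD; exact: rintegrableZ.
- by move=> x; exact: sqnD_le.
Qed.

Lemma L2funZ c f : L2fun f -> L2fun (fun x => c * f x).
Proof.
move=> [mf jf]; split; first exact: cmeasurableZ.
apply: eq_integrable (rintegrableZ (sqn c) jf) => // x _ /=.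
by rewrite sqnM.
Qed.

Lemma L2funJ f : L2fun f -> L2fun (fun x => conjc (f x)).
Proof.
move=> [mf jf]; split; first exact: cmeasurableJ.
by apply: eq_integrable jf => // x _ /=; rewrite sqnJ.
Qed.

Lemma L2funB f g : L2fun f -> L2fun g -> L2fun (fun x => f x - g x).
Proof.
move=> jf jg; rewrite (_ : (fun _ => _) = fun x => f x + (-1) * g x).
  by apply: L2funD => //; exact: L2funZ.
by apply/funext => x; rewrite mulN1r.
Qed.

Lemma L2fun_sum (I : Type) (s : seq I) (F : I -> T -> R[i]) :
  (forall i, L2fun (F i)) -> L2fun (fun x => \sum_(i <- s) F i x).
Proof.
move=> iF; elim: s => [|i s IH].
  by under eq_fun do rewrite big_nil; exact: L2fun0.
by under eq_fun do rewrite big_cons; exact: L2funD.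
Qed.

Lemma cintegrable_L2M f g :
  L2fun f -> L2fun g -> cintegrable (fun x => f x * g x).
Proof.
move=> [mf jf] [mg jg]; have [mr mi] := cmeasurableM mf mg.
split.
  by apply: le_rintegrable (rintegrableD jf jg) _ => // x; exact: ReM_le.
by apply: le_rintegrable (rintegrableD jf jg) _ => // x; exact: ImM_le.
Qed.

Lemma cintegrable_inner f g :
  L2fun f -> L2fun g -> cintegrable (fun x => f x * conjc (g x)).
Proof. by move=> jf jg; apply: cintegrable_L2M => //; exact: L2funJ. Qed.

Lemma nrm2_ge0 f : 0 <= nrm2 f.
Proof. by apply: Rintegral_ge0 => x _; exact: sqn_ge0. Qed.

Lemma inner_nrm2 f : inner f f = (nrm2 f)%:C%C.
Proof.
rewrite /inner /cint; apply/eqP; rewrite eq_complex /=; apply/andP; split.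
  by apply/eqP/eq_Rintegral => x _; rewrite mul_conjc.
apply/eqP; rewrite (_ : (fun _ => _) = cst 0) ?Rintegral_cst ?mul0r//.
by apply/funext => x; rewrite mul_conjc.
Qed.

Lemma innerC f g : L2fun f -> L2fun g -> inner g f = conjc (inner f g).
Proof.
move=> jf jg; rewrite -cintJ; last exact: cintegrable_inner.
by congr cint; apply/funext => x; rewrite rmorphM/= conjcK mulrC.
Qed.

Lemma innerDl f g h : L2fun f -> L2fun g -> L2fun h ->
  inner (fun x => f x + g x) h = inner f h + inner g h.
Proof.
move=> jf jg jh; rewrite -cintD; try exact: cintegrable_inner.
by congr cint; apply/funext => x; rewrite mulrDl.
Qed.

Lemma innerZl c f h : L2fun f -> L2fun h ->
  inner (fun x => c * f x) h = c * inner f h.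
Proof.
move=> jf jh; rewrite -cintZ; last exact: cintegrable_inner.
by congr cint; apply/funext => x; rewrite mulrA.
Qed.

Lemma innerBl f g h : L2fun f -> L2fun g -> L2fun h ->
  inner (fun x => f x - g x) h = inner f h - inner g h.
Proof.
move=> jf jg jh; rewrite -cintB; try exact: cintegrable_inner.
by congr cint; apply/funext => x; rewrite mulrBl.
Qed.

Lemma innerBr f g h : L2fun f -> L2fun g -> L2fun h ->
  inner h (fun x => f x - g x) = inner h f - inner h g.
Proof.
move=> jf jg jh; rewrite -cintB; try exact: cintegrable_inner.
by congr cint; apply/funext => x; rewrite rmorphB/= mulrBr.
Qed.

Lemma innerDr f g h : L2fun f -> L2fun g -> L2fun h ->
  inner h (fun x => f x + g x) = inner h f + inner h g.
Proof.
move=> jf jg jh; rewrite -cintD; try exact: cintegrable_inner.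
by congr cint; apply/funext => x; rewrite rmorphD/= mulrDr.
Qed.

Lemma innerZr c f h : L2fun f -> L2fun h ->
  inner h (fun x => c * f x) = conjc c * inner h f.
Proof.
move=> jf jh; rewrite -cintZ; last exact: cintegrable_inner.
by congr cint; apply/funext => x; rewrite rmorphM/= mulrCA.
Qed.

Lemma nrm2_parallelogram f g : L2fun f -> L2fun g ->
  nrm2 (fun x => f x + g x) + nrm2 (fun x => f x - g x) = 2 * nrm2 f + 2 * nrm2 g.
Proof.
move=> jf jg; have [_ Df] := L2funD jf jg; have [_ Bf] := L2funB jf jg.
rewrite /nrm2 -RintegralD//.
rewrite -RintegralZl//; last by case: jf.
rewrite -RintegralZl//; last by case: jg.
rewrite -RintegralD//; [|by apply: rintegrableZ; case: jf|by apply: rintegrableZ; case: jg].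
by apply: eq_Rintegral => x _; exact: parallelogram.
Qed.

(** A substitute for the triangle inequality that avoids square roots of [nrm2]; the lost factor is
    harmless in approximation arguments. *)
Lemma nrm2D_le f g : L2fun f -> L2fun g ->
  nrm2 (fun x => f x + g x) <= 2 * nrm2 f + 2 * nrm2 g.
Proof. by move=> jf jg; rewrite -nrm2_parallelogram// lerDl nrm2_ge0. Qed.

Lemma nrm2Z c f : L2fun f -> nrm2 (fun x => c * f x) = sqn c * nrm2 f.
Proof.
move=> [_ jf]; rewrite /nrm2 -RintegralZl//.
by apply: eq_Rintegral => x _; rewrite sqnM.
Qed.

Lemma le_nrm2 (k : R) f g : L2fun f -> L2fun g ->
  (forall x, sqn (f x) <= k * sqn (g x)) -> nrm2 f <= k * nrm2 g.
Proof.
move=> [_ jf] [_ jg] fg; rewrite /nrm2 -RintegralZl//.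
by apply: le_Rintegral => //; exact: rintegrableZ.
Qed.

(** Cauchy-Schwarz. With [c = inner f g], the squared norm of [t f - c g] is a quadratic in the real
    variable [t] that is nonnegative everywhere; its minimum is at [t = sqn c / nrm2 f]. *)
Lemma sqn_inner_le f g : L2fun f -> L2fun g ->
  sqn (inner f g) <= nrm2 f * nrm2 g.
Proof.
move=> jf jg; set c := inner f g; set F := nrm2 f; set G := nrm2 g.
have F0 : 0 <= F := nrm2_ge0 f.
have G0 : 0 <= G := nrm2_ge0 g.
have key (t : R) : 0 <= t ^+ 2 * F - 2 * t * sqn c + sqn c * G.
  have := nrm2_ge0 (fun x => (t%:C)%C * f x - c * g x).
  have j1 := L2funZ (t%:C)%C jf; have j2 := L2funZ c jg.
  rewrite -lecR -inner_nrm2 innerBl//; last exact: L2funB.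
  rewrite !innerBr// !innerZl// !innerZr// !inner_nrm2 -/F -/G.
  rewrite (innerC jf jg) -/c.
  rewrite [X in (_ <= X)%R -> _](_ : _ =
    ((t ^+ 2 * F - 2 * t * sqn c + sqn c * G)%:C)%C) ?lecR//.
  by case: (c) => u v; apply/eqP; rewrite eq_complex /sqn /=; apply/andP;
    split; apply/eqP; ring.
have s0 := sqn_ge0 c; move: key s0; move: (sqn c) => s key s0.
have [F1|F1] := eqVneq F 0.
  have [s1|s1] := eqVneq s 0; first by rewrite s1 mulr_ge0.
  (* When [F = 0] the expression is affine in [t], and this [t] gives it the value -1. *)
  have := key ((s * G + 1) / (2 * s)); rewrite F1 mulr0 add0r.
  rewrite (_ : 2 * _ * s = s * G + 1) ?opprD; last by field.
  by lra.
have Fp : 0 < F by rewrite lt_neqAle eq_sym F1.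
have := key (s / F).
rewrite (_ : _ + _ = (F * G - s) * (s / F)); last by field.
have [->|sn] := eqVneq s 0; first by move=> _; rewrite mulr_ge0.
by rewrite pmulr_lge0 ?subr_ge0// divr_gt0// lt_neqAle eq_sym sn.
Qed.

Lemma nrm2_dominated_cvg (F : nat -> T -> R[i]) f (C : R) :
  (forall n, L2fun (F n)) -> L2fun f ->
  (forall x e, 0 < e -> \forall n \near \oo, sqn (F n x) < e) ->
  (forall n x, sqn (F n x) <= C * sqn (f x)) ->
  nrm2 (F n) @[n --> \oo] --> 0.
Proof.
move=> jF [mf jf] F0 FC.
have [||||_ _ h] := @dominated_convergence _ T R mu setT measurableT
  (fun n x => (sqn (F n x))%:E) (fun=> 0%E) (fun x => (C * sqn (f x))%:E) _ _ _
  (rintegrableZ C jf) _.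
- by move=> n; apply/measurable_EFinP/measurable_sqn; case: (jF n).
- exact: measurable_cst.
- apply: aeW => x _; apply: cvg_EFin; first by near=> n.
  apply/cvgrPdist_lt => e e0; near=> n.
  rewrite /= sub0r normrN ger0_norm ?sqn_ge0//.
  by near: n; exact: F0.
- by apply: aeW => x n _ /=; rewrite lee_fin ger0_norm ?sqn_ge0.
by rewrite integral0 in h; exact: (fine_cvg h).
Unshelve. all: by end_near. Qed.

End complex_integral.
Arguments cint {dd T R} mu f : simpl never.
Arguments inner {dd T R} mu f g : simpl never.
Arguments nrm2 {dd T R} mu f : simpl never.

(** * Plancherel for intervals *)

Section fejer_integral.
Variable R : realType.
Local Notation lam := (@lebesgue_measure R).
Implicit Types (a c t x : R).

Let is_derive_scale c x : is_derive x 1 (fun t : R => c * t) c.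
Proof. by apply: is_derive_eq; rewrite /GRing.scale /=; ring. Qed.

Lemma is_derive_comp_scale (f : R -> R) (df c x : R) :
  is_derive (c * x) 1 f df -> is_derive x 1 (fun t => f (c * t)) (c * df).
Proof.
move=> fd; have cd := is_derive_scale c x.
rewrite mulrC; exact: (@is_derive1_comp _ f (fun t => c * t) x df c fd cd).
Qed.

Lemma cvgy_expRN c : 0 < c -> expR (- c * x) @[x --> +oo] --> 0.
Proof.
move=> c0; apply/cvgrPdist_le => e e0; near=> x.
rewrite sub0r normrN ger0_norm ?expR_ge0//.
have x0 : 0 < x by near: x; exact: nbhs_pinfty_gt.
rewrite mulNr expRN -[leRHS]invrK lef_pV2 ?posrE ?expR_gt0 ?invr_gt0//.
by apply: le_trans (expR_ge1Dx _); rewrite ler_wpDl// mulrC -ler_pdivrMr.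
Unshelve. all: by end_near. Qed.

Lemma cvgy_mul_expRN c : 0 < c -> x * expR (- c * x) @[x --> +oo] --> 0.
Proof.
move=> c0; apply/cvgrPdist_le => e e0; near=> x.
have x0 : 0 < x by near: x; exact: nbhs_pinfty_gt.
rewrite sub0r normrN ger0_norm ?mulr_ge0 ?expR_ge0 ?(ltW x0)//.
rewrite mulNr expRN ler_pdivrMr ?expR_gt0//.
have cx : 0 <= c * x by rewrite mulr_ge0 ?ltW.
have h := expR_ge1Dxn 1%N cx.
have h2 : (c * x) ^+ 2 / 2 <= expR (c * x).
  by apply: le_trans h; rewrite lerDr.
apply: (@le_trans _ _ (e * ((c * x) ^+ 2 / 2))); last by rewrite ler_pM2l.
rewrite (_ : e * _ = x * (x * (e * c ^+ 2 / 2))); last by field.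
by rewrite ler_peMr ?(ltW x0)// -ler_pdivrMr ?mul1r// divr_gt0// mulr_gt0// exprn_gt0.
Unshelve. all: by end_near. Qed.

Lemma integral_mul_expR c : 0 < c ->
  (\int[lam]_(t in `[0%R, +oo[) (t * expR (- c * t))%:E = (c ^- 2)%:E)%E.
Proof.
move=> c0.
pose F t := - ((t / c + c ^- 2) * expR (- c * t)).
have dF x : is_derive x 1 F (x * expR (- c * x)).
  have h2 := is_derive_comp_scale (is_derive_expR (- c * x)).
  have h3 : is_derive x 1 (fun t : R => t / c + c ^- 2) c^-1.
    by apply: is_derive_eq; rewrite /GRing.scale /=; ring.
  apply: is_derive_eq; rewrite /GRing.scale /=; field.
  exact: lt0r_neq0.
have F0 : F x @[x --> +oo] --> 0.
  rewrite (_ : F = fun x => - c^-1 * (x * expR (- c * x)) - c ^- 2 * expR (- c * x)).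
    rewrite -[X in _ --> X](subr0 0) -[X in _ --> X - _](mulr0 (- c^-1)).
    rewrite -[X in _ --> _ - X](mulr0 (c ^- 2)).
    by apply: cvgB; apply: cvgM; [exact: cvg_cst|exact: cvgy_mul_expRN|
      exact: cvg_cst|exact: cvgy_expRN].
  by apply/funext => x; rewrite /F; ring.
have cF : continuous F.
  by move=> x; apply: differentiable_continuous; apply/derivable1_diffP; case: (dF x).
have cf : continuous (fun x => x * expR (- c * x)).
  move=> x; apply: differentiable_continuous; apply/derivable1_diffP.
  by have [] : is_derive x 1 (fun x => x * expR (- c * x)) _ :=
    is_deriveM _ (is_derive_comp_scale (is_derive_expR (- c * x))).
rewrite (@ge0_continuous_FTC2y _ _ F 0 0)//.
- by rewrite -EFinB /F mul0r add0r mulr0 expR0 mulr1 opprK add0r.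
- by move=> x x0; rewrite mulr_ge0// expR_ge0.
- exact: continuous_subspaceT.
- by apply: cvg_at_right_filter; exact: cF.
- by move=> x _; rewrite derive1E; case: (dF x).
Qed.

(** The Laplace transform of [1 - cos (a x)], which is the inner integral once the order of
    integration is exchanged in [integral_1Bcos_sqrV]. *)
Lemma integral_expR_1Bcos a t : 0 < t ->
  (\int[lam]_(x in `[0%R, +oo[) (expR (- t * x) * (1 - cos (a * x)))%:E =
   (a ^+ 2 / (t * (t ^+ 2 + a ^+ 2)))%:E)%E.
Proof.
move=> t0.
have ta0 : 0 < t ^+ 2 + a ^+ 2 by rewrite ltr_wpDr ?sqr_ge0// exprn_gt0.
pose F x := expR (- t * x) *
  ((t * cos (a * x) - a * sin (a * x)) / (t ^+ 2 + a ^+ 2) - t^-1).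
have dF x : is_derive x 1 F (expR (- t * x) * (1 - cos (a * x))).
  have h1 := is_derive_comp_scale (is_derive_expR (- t * x)).
  have h2 := is_derive_comp_scale (is_derive_cos (a * x)).
  have h3 := is_derive_comp_scale (is_derive_sin (a * x)).
  apply: is_derive_eq; rewrite /GRing.scale /=; field.
  by rewrite !lt0r_neq0.
have F0 : F x @[x --> +oo] --> 0.
  pose C := (t + `|a|) / (t ^+ 2 + a ^+ 2) + t^-1.
  have C0 : 0 < C by rewrite ltr_wpDl ?invr_gt0// divr_ge0 ?(ltW ta0)// addr_ge0// ltW.
  have FC x : `|F x| <= expR (- t * x) * C.
    rewrite /F normrM (ger0_norm (expR_ge0 _)) ler_pM2l ?expR_gt0//.
    rewrite (le_trans (ler_normB _ _))// lerD//; last by rewrite gtr0_norm ?invr_gt0.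
    rewrite normrM normfV (gtr0_norm ta0) ler_pM2r ?invr_gt0//.
    rewrite (le_trans (ler_normB _ _))// !normrM (gtr0_norm t0) lerD//.
      by rewrite ler_piMr ?cos_max// ltW.
    by rewrite ler_piMr ?sin_max.
  apply/cvgrPdist_le => e e0; have /cvgrPdist_le := cvgy_expRN t0.
  move=> /(_ _ (divr_gt0 e0 C0)); apply: filterS => x.
  rewrite !sub0r !normrN (ger0_norm (expR_ge0 _)) ler_pdivlMr// => h.
  exact: le_trans (FC x) h.
have cF : continuous F.
  by move=> x; apply: differentiable_continuous; apply/derivable1_diffP; case: (dF x).
have cf : continuous (fun x => expR (- t * x) * (1 - cos (a * x))).
  move=> x; have h1 := is_derive_comp_scale (is_derive_expR (- t * x)).
  have h2 := is_derive_comp_scale (is_derive_cos (a * x)).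
  apply: differentiable_continuous; apply/derivable1_diffP.
  exact: ex_derive.
rewrite (@ge0_continuous_FTC2y _ _ F 0 0)//.
- rewrite -EFinB /F !mulr0 expR0 cos0 sin0 mulr1 mulr0 subr0 mul1r; congr EFin.
  by field; rewrite !lt0r_neq0.
- exact: continuous_subspaceT.
- by apply: cvg_at_right_filter; exact: cF.
- by move=> x _; rewrite derive1E; case: (dF x).
Qed.

Lemma integral_sqrDV a : 0 < a ->
  (\int[lam]_(t in `[0%R, +oo[) (a ^+ 2 / (t ^+ 2 + a ^+ 2))%:E = (a * (pi / 2))%:E)%E.
Proof.
move=> a0; pose F t := a * atan (a^-1 * t).
have ta0 t : 0 < t ^+ 2 + a ^+ 2 by rewrite ltr_wpDl ?sqr_ge0// exprn_gt0.
have dF x : is_derive x 1 F (a ^+ 2 / (x ^+ 2 + a ^+ 2)).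
  have h1 := is_derive_comp_scale (is_derive1_atan (a^-1 * x)).
  apply: is_derive_eq; rewrite /GRing.scale /=; field.
  by rewrite !lt0r_neq0 //= ltr_wpDr ?sqr_ge0.
have F0 : F x @[x --> +oo] --> a * (pi / 2).
  apply: cvgM; first exact: cvg_cst.
  apply: (@cvg_comp _ _ _ (fun t => a^-1 * t) atan _ +oo); last exact: cvgy_atan.
  apply/cvgryPge => A; near=> x.
  rewrite mulrC ler_pdivlMr//.
have cF : continuous F.
  by move=> x; apply: differentiable_continuous; apply/derivable1_diffP; case: (dF x).
have cf : continuous (fun t => a ^+ 2 / (t ^+ 2 + a ^+ 2)).
  move=> x; apply: cvgM; first exact: cvg_cst.
  apply: cvgV; first exact: lt0r_neq0.
  by apply: cvgD; [exact: exprn_continuous|exact: cvg_cst].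
rewrite (@ge0_continuous_FTC2y _ _ F 0 (a * (pi / 2)))//.
- by rewrite -EFinB /F mulr0 atan0 mulr0 subr0.
- by move=> x x0; rewrite divr_ge0 ?sqr_ge0// ltW.
- exact: continuous_subspaceT.
- by apply: cvg_at_right_filter; exact: cF.
- by move=> x _; rewrite derive1E; case: (dF x).
Unshelve. all: by end_near. Qed.

Lemma integral_expR_norm_1Bcos a t : 0 < t ->
  (\int[lam]_x (expR (- t * `|x|) * (1 - cos (a * x)))%:E =
   (2 * (a ^+ 2 / (t * (t ^+ 2 + a ^+ 2))))%:E)%E.
Proof.
move=> t0; rewrite ge0_symfun_integralT.
- rewrite -set_itvcy EFinM -integral_expR_1Bcos//; congr (_ * _)%E.
  by apply: eq_integral => x; rewrite inE/= in_itv/= andbT => x0; rewrite ger0_norm.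
- by move=> x; rewrite mulr_ge0 ?expR_ge0// subr_ge0 cos_le1.
- move=> x; apply: cvgM.
    apply: (@continuous_comp _ _ _ (fun x => - t * `|x|) expR); last exact: continuous_expR.
    by apply: cvgM; [exact: cvg_cst|exact: norm_continuous].
  apply: cvgB; first exact: cvg_cst.
  apply: (@continuous_comp _ _ _ (fun x => a * x) cos); last exact: continuous_cos.
  by apply: cvgM; [exact: cvg_cst|exact: cvg_id].
- by move=> x /=; rewrite normrN mulrN cosN.
Qed.

(* Tonelli, after writing [x^-2] as the integral of [t * exp (- t |x|)] over
   [t > 0]. *)
Lemma integral_1Bcos_sqrV a :
  (\int[lam]_x ((1 - cos (a * x)) / x ^+ 2)%:E = (pi * `|a|)%:E)%E.
Proof.
wlog a0 : a / 0 < a.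
  move=> wl; have [a0|a0|<-] := ltgtP 0 a; first exact: wl.
    rewrite -normrN -wl ?oppr_gt0//; apply: eq_integral => x _.
    by rewrite mulNr cosN.
  rewrite normr0 mulr0; apply: integral0_eq => x _.
  by rewrite mul0r cos0 subrr mul0r.
rewrite (gtr0_norm a0).
(* The indicator moves the domain [t > 0] into the integrand, and so makes [h] nonnegative on the
   whole plane, as Tonelli's theorem requires. *)
pose h (p : measurableTypeR R * measurableTypeR R) : R :=
  p.1 * expR (- p.1 * `|p.2|) * (1 - cos (a * p.2)) * \1_(`]0, +oo[) p.1.
have h0 p : (0 <= (h p)%:E)%E.
  rewrite lee_fin /h indicE; have [|_] := boolP (_ \in _); last by rewrite mulr0.
  rewrite inE/= in_itv/= andbT => p0.
  by rewrite mulr1 !mulr_ge0 ?expR_ge0 ?subr_ge0 ?cos_le1// ltW.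
have mh : measurable_fun setT (EFin \o h).
  have m1 : measurable_fun setT (fst : measurableTypeR R * measurableTypeR R -> R).
    exact: measurable_fst.
  have m2 : measurable_fun setT (snd : measurableTypeR R * measurableTypeR R -> R).
    exact: measurable_snd.
  have mI : measurable_fun setT (\1_(`]0%R, +oo[) : R -> R).
    by apply: measurable_indic; exact: measurable_itv.
  apply/measurable_EFinP; apply: measurable_funM; last exact: measurableT_comp mI m1.
  apply: measurable_funM.
    apply: measurable_funM => //.
    apply: measurableT_comp; first exact: measurable_expR.
    apply: measurable_funM; first exact: measurable_funN.
    by apply: measurableT_comp => //; exact: normr_measurable.
  apply: measurable_funB => //.
  apply: measurableT_comp; last exact: measurable_funM.
  by apply: continuous_measurable_fun; exact: continuous_cos.
transitivity (\int[lam]_x \int[lam]_t (h (t, x))%:E)%E.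
  apply: eq_integral => x _.
  transitivity (\int[lam]_(t in `]0%R, +oo[)
      ((1 - cos (a * x))%:E * (t * expR (- `|x| * t))%:E))%E; last first.
    rewrite integral_mkcond; apply: eq_integral => t _.
    rewrite /h /patch indicE; case: ifPn => _; last by rewrite mulr0.
    by rewrite -EFinM mulr1; congr EFin; rewrite [LHS]mulrC /= !mulNr (mulrC `|x|).
  rewrite integral_itv_obnd_cbnd; last first.
    apply/measurable_funeM/measurable_EFinP/measurable_funTS.
    apply: measurable_funM => //; apply: measurableT_comp; first exact: measurable_expR.
    exact: measurable_funM.
  rewrite ge0_integralZl//; last 2 first.
  - apply/measurable_EFinP/measurable_funTS; apply: measurable_funM => //.
    apply: measurableT_comp; first exact: measurable_expR.
    exact: measurable_funM.
  - move=> t; rewrite /= in_itv/= andbT => t0.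
    by rewrite lee_fin mulr_ge0// expR_ge0.
  (* At [x = 0] the integral over [t] diverges, but its coefficient [1 - cos 0] is 0. *)
  have [->|x0] := eqVneq x 0; first by rewrite mulr0 cos0 subrr mul0r mul0e.
  by rewrite integral_mul_expR ?normr_gt0// -EFinM -normrX ger0_norm ?sqr_ge0.
rewrite -(@fubini_tonelli _ _ _ _ _ lam lam (EFin \o h))//.
transitivity (\int[lam]_(t in `]0%R, +oo[)
  (2%:E * (a ^+ 2 / (t ^+ 2 + a ^+ 2))%:E))%E.
  rewrite [RHS]integral_mkcond; apply: eq_integral => t _.
  rewrite /patch; case: ifPn => [tI|tI]; last first.
    by apply: integral0_eq => x _; rewrite /h /= indicE (negbTE tI) mulr0.
  under eq_integral do rewrite /h /= indicE tI mulr1.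
  move: tI; rewrite inE/= in_itv/= andbT => t0.
  rewrite -EFinM (_ : 2 * _ = t * (2 * (a ^+ 2 / (t * (t ^+ 2 + a ^+ 2))))); last first.
    field; rewrite !lt0r_neq0// ltr_wpDr ?sqr_ge0// exprn_gt0//.
  rewrite EFinM -integral_expR_norm_1Bcos// -ge0_integralZl ?lee_fin ?(ltW t0)//.
  - by apply: eq_integral => x _; rewrite -EFinM mulrA.
  - apply/measurable_EFinP/measurable_funTS; apply: measurable_funM.
      apply: measurableT_comp; first exact: measurable_expR.
      by apply: measurable_funM => //; exact: normr_measurable.
    apply: measurable_funB => //.
    apply: measurableT_comp; last exact: measurable_funM.
    by apply: continuous_measurable_fun; exact: continuous_cos.
have mq : measurable_fun setT (fun t : R => a ^+ 2 / (t ^+ 2 + a ^+ 2)).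
  apply: continuous_measurable_fun => x; apply: cvgM; first exact: cvg_cst.
  apply: cvgV; first by rewrite lt0r_neq0// ltr_wpDl ?sqr_ge0// exprn_gt0.
  by apply: cvgD; [exact: exprn_continuous|exact: cvg_cst].
rewrite integral_itv_obnd_cbnd; last first.
  exact/measurable_funeM/measurable_EFinP/measurable_funTS.
rewrite ge0_integralZl//.
- by rewrite integral_sqrDV// -EFinM; congr EFin; field.
- by apply/measurable_EFinP/measurable_funTS.
- by move=> t _; rewrite lee_fin divr_ge0 ?sqr_ge0// addr_ge0 ?sqr_ge0.
Qed.

End fejer_integral.

(** * Fourier transforms of intervals and their products *)

Section interval_fourier.
Variable R : realType.
Local Notation lam := (@lebesgue_measure R).
Implicit Types (a b c k t x : R) (A B : set R).

Definition fourier1 (f : R -> R[i]) x : R[i] :=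
  cint lam (fun t => f t * cis (- (2 * pi * (x * t)))).

Local Notation ftI A := (fourier1 (fun t => (\1_A t)%:C%C)).

Lemma measurable_invr : measurable_fun [set: R] (fun x : R => x^-1).
Proof.
rewrite -(setUv [set (0 : R)]); apply/measurable_funU => //.
  exact: measurableC.
split; first exact: measurable_fun_set1.
apply: open_continuous_measurable_fun.
  by apply: closed_openC; exact: closed_eq.
by move=> x; rewrite inE/= => /eqP x0; exact: inv_continuous.
Qed.

Lemma integral_ocitv_FTC (f F : R -> R) a b : a <= b -> continuous f ->
  (forall x, is_derive x 1 F (f x)) ->
  \int[lam]_x (\1_(`]a, b]) x * f x) = F b - F a.
Proof.
move=> ab cf dF.
rewrite (_ : (fun x => _) = f \_ `]a, b]); last first.
  apply/funext => x; rewrite patchE indicE; case: ifPn => _; last by rewrite mul0r.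
  by rewrite mul1r.
rewrite -Rintegral_mkcond.
move: ab; rewrite le_eqVlt => /predU1P[<-|ab].
  by rewrite set_itvoc0// Rintegral_set0 subrr.
have cF x : {for x, continuous F}.
  by apply: differentiable_continuous; apply/derivable1_diffP; case: (dF x).
have icf : lam.-integrable `[a, b] (EFin \o f).
  by apply: continuous_compact_integrable; [exact: segment_compact|
    exact: continuous_subspaceT].
rewrite Rintegral_itv_obnd_cbnd; last first.
  by apply: (integrableS _ _ _ icf) => //; exact: subset_itv_oc_cc.
rewrite /Rintegral (@continuous_FTC2 _ f F)//.
- exact: continuous_subspaceT.
- split=> /=.
  + by move=> x _; case: (dF x).
  + by apply: cvg_at_right_filter; exact: cF.
  + by apply: cvg_at_left_filter; exact: cF.
- by move=> x _; rewrite derive1E; case: (dF x).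
Qed.

(** The formula covers every [x]: at 0 the first term vanishes and the indicator supplies the length
    of the interval. Later algebra is then pointwise, with no exceptional null set. *)
Lemma fourier1_ocitv a b x : a <= b ->
  ftI `]a, b]%classic x = (cis (- (2 * pi * x * b)) - cis (- (2 * pi * x * a))) *
    Complex 0 (2 * pi * x)^-1 + ((b - a) * \1_[set 0] x)%:C%C.
Proof.
move=> ab; rewrite /fourier1 /cint; set k := 2 * pi * x.
rewrite (_ : (fun t => complex.Re _) =
    fun t => \1_(`]a, b]%classic) t * cos (- k * t)); last first.
  by apply/funext => t /=; rewrite mul0r subr0 /k mulNr mulrA.
rewrite (_ : (fun t => complex.Im _) =
    fun t => \1_(`]a, b]%classic) t * sin (- k * t)); last first.
  by apply/funext => t /=; rewrite mul0r addr0 /k mulNr mulrA.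
have cc : continuous (fun t => cos (- k * t)).
  move=> t; apply: (@continuous_comp _ _ _ (fun x => - k * x) cos).
    by apply: cvgM; [exact: cvg_cst|exact: cvg_id].
  exact: continuous_cos.
have cs : continuous (fun t => sin (- k * t)).
  move=> t; apply: (@continuous_comp _ _ _ (fun x => - k * x) sin).
    by apply: cvgM; [exact: cvg_cst|exact: cvg_id].
  exact: continuous_sin.
have [x0|x0] := eqVneq x 0.
  have k0 : k = 0 by rewrite /k x0 mulr0.
  have d1 (y : R) : is_derive y 1 (id : R -> R) (cos (- k * y)).
    by rewrite k0 oppr0 mul0r cos0; exact: is_derive_id.
  have d2 (y : R) : is_derive y 1 (cst 0 : R -> R) (sin (- k * y)).
    by rewrite k0 oppr0 mul0r sin0; exact: is_derive_cst.
  rewrite (integral_ocitv_FTC ab cc d1) (integral_ocitv_FTC ab cs d2).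
  rewrite (_ : cis (- (k * b)) - cis (- (k * a)) = 0); last by rewrite k0 !mul0r subrr.
  by rewrite mul0r !add0r x0 indicE mem_set// mulr1 /cst oppr0.
have k0 : k != 0 by rewrite /k !mulf_neq0 ?pnatr_eq0//= gt_eqF ?pi_gt0.
have d1 (y : R) : is_derive y 1 (fun t => - k^-1 * sin (- k * t)) (cos (- k * y)).
  have h := is_derive_comp_scale (is_derive_sin (- k * y)).
  by apply: is_derive_eq; rewrite /GRing.scale /=; field.
have d2 (y : R) : is_derive y 1 (fun t => k^-1 * cos (- k * t)) (sin (- k * y)).
  have h := is_derive_comp_scale (is_derive_cos (- k * y)).
  by apply: is_derive_eq; rewrite /GRing.scale /=; field.
rewrite (integral_ocitv_FTC ab cc d1) (integral_ocitv_FTC ab cs d2).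
rewrite indicE memNset; last by move=> /= /eqP; rewrite (negbTE x0).
rewrite mulr0; apply/eqP; rewrite eq_complex /= !mulNr; apply/andP.
by split; apply/eqP; ring.
Qed.

(** For [x] nonzero this is [sin (pi a x) ^ 2 / (2 pi^2 x^2)], half of an unnormalised Fejér
    kernel. *)
Definition fejer a x : R := (1 - cos (2 * pi * a * x)) / x ^+ 2 / (4 * pi ^+ 2).

Lemma measurable_fejer a : measurable_fun setT (fejer a).
Proof.
apply: measurable_funM => //; apply: measurable_funM.
  apply: measurable_funB => //.
  apply: measurableT_comp; last exact: measurable_funM.
  by apply: continuous_measurable_fun; exact: continuous_cos.
apply: measurableT_comp; first exact: measurable_invr.
exact: measurable_funX.
Qed.

Lemma fejer_ge0 a x : 0 <= fejer a x.
Proof.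
rewrite /fejer !mulr_ge0 ?invr_ge0 ?sqr_ge0 ?subr_ge0 ?cos_le1//.
by rewrite mulr_ge0 ?sqr_ge0.
Qed.

Lemma integral_fejer a : (\int[lam]_x (fejer a x)%:E = (`|a| / 2)%:E)%E.
Proof.
have p0 : 0 < pi :> R := pi_gt0 R.
under eq_integral do rewrite /fejer mulrC EFinM.
rewrite ge0_integralZl//.
- rewrite integral_1Bcos_sqrV -EFinM; congr EFin.
  rewrite !normrM (gtr0_norm p0) (@ger0_norm _ 2)//.
  by move: (@pi R) p0 => p p0; field; exact: lt0r_neq0.
- apply/measurable_EFinP; apply: measurable_funM.
    apply: measurable_funB => //.
    apply: measurableT_comp; last exact: measurable_funM.
    by apply: continuous_measurable_fun; exact: continuous_cos.
  apply: measurableT_comp; first exact: measurable_invr.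
  exact: measurable_funX.
- by move=> x _; rewrite lee_fin mulr_ge0 ?invr_ge0 ?sqr_ge0// subr_ge0 cos_le1.
- by rewrite lee_fin invr_ge0 mulr_ge0// sqr_ge0.
Qed.

Lemma integrable_fejer a : lam.-integrable setT (EFin \o fejer a).
Proof.
apply/integrableP; split; first by apply/measurable_EFinP; exact: measurable_fejer.
rewrite (_ : (\int[lam]_x _)%E = (`|a| / 2)%:E) ?ltry// -integral_fejer.
by apply: eq_integral => x _ /=; rewrite ger0_norm ?fejer_ge0.
Qed.

Lemma integrable_indic1 (r : R) : lam.-integrable setT (EFin \o \1_[set r]).
Proof.
by rewrite -set_itv1; exact: integrable_indic_itv.
Qed.

Lemma Rintegral_indic_set1 (r : R) : \int[lam]_x \1_[set r] x = 0.
Proof.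
rewrite /Rintegral integral_indic//.
by rewrite setIT; exact: (congr1 fine (lebesgue_measure_set1 r)).
Qed.

Lemma indic_set1 (r x : R) : \1_[set r] x = (x == r)%:R :> R.
Proof.
rewrite indicE; case: eqVneq => [->|/eqP xr]; first by rewrite mem_set.
by rewrite memNset.
Qed.

Lemma fourier1_ocitvN a b x : a <= b ->
  ftI `]a, b]%classic (- x) = conjc (ftI `]a, b]%classic x).
Proof.
move=> ab; rewrite !fourier1_ocitv//.
rewrite !indic_set1 oppr_eq0.
rewrite !(mulrN, mulNr) invrN !opprK !cisN /cis.
by apply/eqP; rewrite eq_complex /=; apply/andP; split; apply/eqP; ring.
Qed.

Lemma cmeasurable_fourier1_ocitv a b : a <= b ->
  cmeasurable (fun x => ftI `]a, b]%classic x).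
Proof.
move=> ab; under eq_fun do rewrite fourier1_ocitv//.
have mcis (c : R) : cmeasurable (fun x => cis (- (2 * pi * x * c))).
  have ml : measurable_fun setT (fun x : R => - (2 * pi * x * c)).
    by apply: measurable_funN; exact: measurable_funM.
  split; apply: measurableT_comp ml; apply: continuous_measurable_fun.
    exact: continuous_cos.
  exact: continuous_sin.
apply: cmeasurableD; last first.
  split; last exact: measurable_cst.
  by apply: measurable_funM => //; exact: measurable_indic.
apply: cmeasurableM; first exact: cmeasurableB.
split; first exact: measurable_cst.
apply: measurableT_comp; first exact: measurable_invr.
exact: measurable_funM.
Qed.

(* The indicator corrects the value at 0, where [fejer] is 0 by [x / 0 = 0]. *)
Lemma fourier1_ocitv_mul a b c d x : a <= b -> c <= d ->
  complex.Re (ftI `]a, b]%classic x * conjc (ftI `]c, d]%classic x)) =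
  fejer (c - b) x + fejer (d - a) x - fejer (c - a) x - fejer (d - b) x +
  (b - a) * (d - c) * \1_[set 0] x.
Proof.
move=> ab cd; rewrite !fourier1_ocitv// /fejer.
have [->|x0] := eqVneq x 0.
  rewrite !(mulr0, mul0r, mulr1, oppr0, cos0, invr0) indicE mem_set//.
  rewrite !(mulr0, mul0r, mulr1, oppr0, cos0, invr0, subrr, add0r) /=.
  by ring.
rewrite indicE memNset; last by move=> /= /eqP; rewrite (negbTE x0).
have e (s t : R) : cos (2 * pi * (s - t) * x) =
    cos (2 * pi * x * s) * cos (2 * pi * x * t) + sin (2 * pi * x * s) * sin (2 * pi * x * t).
  by rewrite -cosB; congr cos; ring.
rewrite !e !mulr0 !addr0 /cis /= !cosN !sinN.
move: (cos (2 * pi * x * a)) (cos (2 * pi * x * b)) (cos (2 * pi * x * c))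
  (cos (2 * pi * x * d)) (sin (2 * pi * x * a)) (sin (2 * pi * x * b))
  (sin (2 * pi * x * c)) (sin (2 * pi * x * d)) => ca cb cc cd' sa sb sc sd.
move: (@pi R) (pi_gt0 R) => p p0.
by field; rewrite x0 gt_eqF.
Qed.

Lemma L2fun_fourier1_ocitv a b : a <= b ->
  L2fun lam (fun x => ftI `]a, b]%classic x).
Proof.
move=> ab; split; first exact: cmeasurable_fourier1_ocitv.
under eq_fun.
  move=> x; rewrite (_ : sqn _ = complex.Re ((sqn (ftI `]a, b]%classic x))%:C%C))//.
  rewrite -mul_conjc fourier1_ocitv_mul//; over.
apply: rintegrableD; last exact/rintegrableZ/integrable_indic1.
have iN c : lam.-integrable setT (EFin \o (fun x => - fejer c x)).
  by apply: eq_integrable (rintegrableZ (-1) (integrable_fejer c)) => // x _ /=;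
    rewrite mulN1r.
by do 3?[apply: rintegrableD => //]; exact: integrable_fejer.
Qed.

(** The left side is what the four [fejer] terms of [fourier1_ocitv_mul] integrate to; the right
    side is the length of the intersection of the two intervals. *)
Lemma itv_overlap a b c e : a <= b -> c <= e ->
  (`|c - b| + `|e - a| - `|c - a| - `|e - b|) / 2 =
  if Num.max a c < Num.min b e then Num.min b e - Num.max a c else 0.
Proof.
rewrite maxEle minEle => ab ce.
have [ac|ac] := leP a c; have [be|be] := leP b e;
  have [h|h] := ger0P (c - a); have [h'|h'] := ger0P (e - b);
  have [k|k] := ger0P (c - b); have [k'|k'] := ger0P (e - a);
  case: ltP => m; lra.
Qed.

End interval_fourier.
Arguments fourier1 {R} f x : simpl never.

(** * Reflection and translation invariance of the Lebesgue measure on R *)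

Section lebesgue_invariance.
Variable R : realType.
Local Notation lam := (@lebesgue_measure R).
Implicit Types (a b c k t x : R) (A B : set R).

Lemma lebesgue_measureN A : measurable A -> lam (-%R @^-1` A) = lam A.
Proof.
have mN : measurable_fun setT (-%R : measurableTypeR R -> measurableTypeR R).
  exact: measurable_funN.
pose nu := pushforward lam (-%R : measurableTypeR R -> measurableTypeR R).
move=> mA; apply/esym.
have := @lebesgue_measure_unique R (measure_function_pushforward__canonical__measure_function_Measure lam mN).
apply => // X [[a b] _ <-] /=.
rewrite /pushforward (_ : _ @^-1` _ = `[- b, - a[%classic); last first.
  by apply/seteqP; split=> x /=; rewrite !in_itv /= lerNl ltrNr andbC.
rewrite !lebesgue_measure_itv /= !lte_fin ltrN2; case: ifP => // _.
by rewrite -!EFinD opprK addrC.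
Qed.

Lemma lebesgue_measure_shift A v : measurable A -> lam ((fun x => x + v) @^-1` A) = lam A.
Proof.
have mN : measurable_fun setT ((fun x => x + v) : measurableTypeR R -> measurableTypeR R).
  exact: measurable_funD.
move=> mA; apply/esym.
have := @lebesgue_measure_unique R (measure_function_pushforward__canonical__measure_function_Measure lam mN).
apply => // X [[a b] _ <-] /=.
rewrite /pushforward (_ : _ @^-1` _ = `]a - v, b - v]%classic); last first.
  by apply/seteqP; split=> x /=; rewrite !in_itv /= ltrBlDr lerBrDr.
rewrite !lebesgue_measure_itv /= !lte_fin ltrD2r; case: ifP => // _.
by rewrite -!EFinB; congr EFin; ring.
Qed.

Lemma RintegralN_odd (f : R -> R) : lam.-integrable setT (EFin \o f) ->
  (forall x, f (- x) = - f x) -> \int[lam]_x f x = 0.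
Proof.
move=> jf oddf.
have mN : measurable_fun setT (-%R : measurableTypeR R -> measurableTypeR R).
  exact: measurable_funN.
have mf : measurable_fun setT (EFin \o f) by exact: measurable_int jf.
have jfN : lam.-integrable setT ((EFin \o f) \o -%R).
  apply: eq_integrable (rintegrableZ (-1) jf) => // x _ /=.
  by rewrite mulN1r oddf.
have := @integral_pushforward _ _ _ _ R _ mN lam setT (EFin \o f) mf.
rewrite preimage_setT => /(_ jfN measurableT).
rewrite (_ : integral _ _ _ = \int[lam]_x (EFin \o f) x)%E; last first.
  by apply: eq_measure_integral => A mA _; rewrite -[RHS]lebesgue_measureN.
move=> /(congr1 fine); rewrite -/(Rintegral lam setT f) => e.
have : \int[lam]_x f x = - \int[lam]_x f x.
  rewrite [LHS]e -mulN1r -RintegralZl//; congr fine.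
  by apply: eq_integral => x _ /=; rewrite oddf mulN1r.
by move=> /eqP; rewrite -addr_eq0 -mulr2n mulrn_eq0 /= => /eqP.
Qed.

End lebesgue_invariance.

Section interval_plancherel.
Variable R : realType.
Local Notation lam := (@lebesgue_measure R).
Implicit Types (a b c k t x : R) (A B : set R).
Local Notation ftI A := (fourier1 (fun t => (\1_A t)%:C%C)).

Lemma ocitv_le A : ocitv A -> exists a, exists2 b, a <= b & A = `]a, b]%classic.
Proof.
move=> /ocitvP[->|[p /ltW pp ->]]; last by exists p.1, p.2.
by exists 0, 0 => //; rewrite set_itvoc0.
Qed.

Lemma L2fun_fourier1 A : ocitv A -> L2fun lam (ftI A).
Proof. by move=> /ocitv_le[a [b ab ->]]; exact: L2fun_fourier1_ocitv. Qed.

(** The real part is a combination of kernels with known integrals, and these add up to the length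
    of the overlap by [itv_overlap]. *)
Lemma fourier1_plancherel A B : ocitv A -> ocitv B ->
  cint lam (fun x => ftI A x * conjc (ftI B x)) = (fine (lam (A `&` B)))%:C%C.
Proof.
move=> oA oB; have := cintegrable_inner (L2fun_fourier1 oA) (L2fun_fourier1 oB).
move: oA oB => /ocitv_le[a [b ab ->]] /ocitv_le[c [d cd ->]] [iR iI].
rewrite /cint; congr Complex; last first.
  (* The transform of a real function at [- x] is the conjugate of that at [x], so the imaginary
     part of the product is odd. *)
  apply: RintegralN_odd => // x; rewrite !fourier1_ocitvN//.
  move: (ftI `]a, b]%classic x) (ftI `]c, d]%classic x) => [u v] [w z] /=; ring.
under eq_Rintegral do rewrite fourier1_ocitv_mul//.
have jf e : lam.-integrable setT (EFin \o fejer e) := integrable_fejer e.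
have j1 : lam.-integrable setT
  (EFin \o (fun x => (b - a) * (d - c) * \1_[set 0] x)).
  exact/rintegrableZ/integrable_indic1.
have j2 : lam.-integrable setT (EFin \o (fun x => fejer (c - b) x + fejer (d - a) x)).
  exact: rintegrableD.
have j3 : lam.-integrable setT
    (EFin \o (fun x => fejer (c - b) x + fejer (d - a) x - fejer (c - a) x)).
  exact: (integrableB _ j2 (jf _)).
have j4 : lam.-integrable setT (EFin \o
    (fun x => fejer (c - b) x + fejer (d - a) x - fejer (c - a) x - fejer (d - b) x)).
  exact: (integrableB _ j3 (jf _)).
rewrite RintegralD// RintegralB// RintegralB// RintegralD//.
rewrite RintegralZl//; last exact: integrable_indic1.
rewrite Rintegral_indic_set1 mulr0 addr0.
have fE e : \int[lam]_x fejer e x = `|e| / 2.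
  by rewrite /Rintegral integral_fejer.
rewrite !fE.
rewrite (_ : _ `&` _ = `]Num.max a c, Num.min b d]%classic); last first.
  apply/seteqP; split=> x /=; rewrite !in_itv /= gt_max le_min.
    by move=> [/andP[-> ->] /andP[-> ->]].
  by move=> /andP[/andP[-> ->] /andP[-> ->]].
rewrite lebesgue_measure_itv /= lte_fin.
rewrite -EFinB (_ : fine _ = if Num.max a c < Num.min b d
  then Num.min b d - Num.max a c else 0); last by case: ifP.
by rewrite -itv_overlap//; field.
Qed.

End interval_plancherel.

(** * Integrals over products and images of measures *)

Section product_integral.
Context d1 d2 (T1 : measurableType d1) (T2 : measurableType d2) (R : realType).
Variables (m1 : {sigma_finite_measure set T1 -> \bar R})
  (m2 : {sigma_finite_measure set T2 -> \bar R}).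

Lemma integrable_tensor (f : T1 -> R) (g : T2 -> R) :
  m1.-integrable setT (EFin \o f) -> m2.-integrable setT (EFin \o g) ->
  (m1 \x m2)%E.-integrable setT (EFin \o (fun p => f p.1 * g p.2)).
Proof.
move=> jf jg; have /integrableP[/measurable_EFinP mf fy] := jf.
have /integrableP[/measurable_EFinP mg gy] := jg.
apply/integrable12ltyP.
  by apply/measurable_EFinP; apply: measurable_funM; exact: measurableT_comp.
rewrite (_ : (\int[m1]_x _)%E =
    (\int[m1]_x `|(f x)%:E| * \int[m2]_y `|(g y)%:E|)%E); last first.
  rewrite -ge0_integralZr//; last 2 first.
  - by apply: measurableT_comp => //; exact/measurable_EFinP.
  - exact: integral_ge0.
  apply: eq_integral => x _; rewrite -ge0_integralZl//; last first.
    by apply: measurableT_comp => //; exact/measurable_EFinP.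
  by apply: eq_integral => y _; rewrite /= normrM.
by rewrite lte_mul_pinfty// ?integral_ge0// ge0_fin_numE ?integral_ge0.
Qed.

Lemma Rintegral_tensor (f : T1 -> R) (g : T2 -> R) :
  m1.-integrable setT (EFin \o f) -> m2.-integrable setT (EFin \o g) ->
  \int[(m1 \x m2)%E]_p (f p.1 * g p.2) = \int[m1]_x f x * \int[m2]_y g y.
Proof.
move=> jf jg; rewrite /Rintegral -integral12_prod_meas1; last exact: integrable_tensor.
rewrite -fineM; [|exact: integrable_fin_num|exact: integrable_fin_num].
have gf := integrable_fin_num measurableT jg.
rewrite -(fineK gf) -integralZr//; congr fine; apply: eq_integral => x _.
rewrite /fubini_F /=; under eq_integral do rewrite EFinM.
by rewrite integralZl// fineK.
Qed.

Lemma cintegrable_tensor (f : T1 -> R[i]) (g : T2 -> R[i]) :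
  cintegrable m1 f -> cintegrable m2 g ->
  cintegrable (m1 \x m2)%E (fun p => f p.1 * g p.2).
Proof.
move=> [fr fi] [gr gi]; split.
  have := rintegrableD (integrable_tensor fr gr)
    (rintegrableZ (-1) (integrable_tensor fi gi)).
  by apply: eq_integrable => // -[x y] _ /=; case: (f x) (g y) => ? ? [? ?] /=;
    rewrite mulN1r.
have := rintegrableD (integrable_tensor fr gi) (integrable_tensor fi gr).
by apply: eq_integrable => // -[x y] _ /=; case: (f x) (g y) => ? ? [? ?].
Qed.

Lemma cint_tensor (f : T1 -> R[i]) (g : T2 -> R[i]) :
  cintegrable m1 f -> cintegrable m2 g ->
  cint (m1 \x m2)%E (fun p => f p.1 * g p.2) = cint m1 f * cint m2 g.
Proof.
move=> [fr fi] [gr gi]; rewrite /cint; apply/eqP; rewrite eq_complex /=.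
rewrite -!Rintegral_tensor//; apply/andP; split; apply/eqP.
  rewrite -RintegralB//; [|exact: (integrable_tensor fr gr)|exact: (integrable_tensor fi gi)].
  by apply: eq_Rintegral => -[x y] _ /=; case: (f x) (g y) => ? ? [].
rewrite -RintegralD//; [|exact: (integrable_tensor fr gi)|exact: (integrable_tensor fi gr)].
by apply: eq_Rintegral => -[x y] _ /=; case: (f x) (g y) => ? ? [].
Qed.

End product_integral.

Section pushforward_complex.
Context d1 d2 (T1 : measurableType d1) (T2 : measurableType d2) (R : realType).
Variables (m1 : {measure set T1 -> \bar R}) (m2 : {measure set T2 -> \bar R}).
Variable phi : T1 -> T2.
Hypothesis mphi : measurable_fun setT phi.
Hypothesis m2E : forall A, measurable A -> m2 A = m1 (phi @^-1` A).

Lemma ge0_integral_image (f : T2 -> \bar R) : measurable_fun setT f ->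
  (forall y, 0 <= f y)%E -> (\int[m2]_y f y = \int[m1]_x f (phi x))%E.
Proof.
move=> mf f0; rewrite (eq_measure_integral (pushforward m1 phi)).
  by rewrite ge0_integral_pushforward// preimage_setT.
by move=> A mA _; rewrite m2E.
Qed.

Lemma integrable_image (f : T2 -> R) : measurable_fun setT f ->
  m1.-integrable setT (EFin \o (f \o phi)) -> m2.-integrable setT (EFin \o f).
Proof.
move=> mf /integrableP[_ jf]; apply/integrableP; split; first exact/measurable_EFinP.
rewrite ge0_integral_image//.
by apply: measurableT_comp => //; exact/measurable_EFinP.
Qed.

Lemma Rintegral_image (f : T2 -> R) : measurable_fun setT f ->
  m1.-integrable setT (EFin \o (f \o phi)) ->
  \int[m2]_y f y = \int[m1]_x f (phi x).
Proof.
move=> mf jf; rewrite /Rintegral.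
rewrite (eq_measure_integral (pushforward m1 phi)); last by move=> A mA _; rewrite m2E.
by rewrite (integral_pushforward mphi) ?preimage_setT//; exact/measurable_EFinP.
Qed.

Lemma cintegrable_image (f : T2 -> R[i]) : cmeasurable f ->
  cintegrable m1 (f \o phi) -> cintegrable m2 f.
Proof. by move=> [mr mi] [jr ji]; split; exact: integrable_image. Qed.

Lemma cint_image (f : T2 -> R[i]) : cmeasurable f ->
  cintegrable m1 (f \o phi) -> cint m2 f = cint m1 (f \o phi).
Proof. by move=> [mr mi] [jr ji]; rewrite /cint; congr Complex; exact: Rintegral_image. Qed.

End pushforward_complex.

(** * Integration on R^d: translations and products over coordinates *)

Section rV_integral.
Variable R : realType.
Local Notation lam := (@lebesgue_measure R).
Local Notation mu d := (@lebesgue_rV R d).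

Lemma lebesgue_rVS d (A : set 'rV[R]_d.+1) :
  mu d.+1 A = (lam \x mu d)%E (@cons_rV R d @^-1` A).
Proof. by []. Qed.

Lemma measurable_shift_rV d (v : 'rV[R]_d) : measurable_fun setT (fun x : 'rV[R]_d => x + v).
Proof.
apply: measurable_fun_coordP => i.
apply: (eq_measurable_fun (fun x : 'rV[R]_d => x ord0 i + v ord0 i)).
  by move=> x _; rewrite mxE.
by apply: measurable_funD => //; exact: measurable_coord.
Qed.

(** By induction on the dimension: a translation acts on each factor of [cons_rV] separately, so
    uniqueness of the product measure reduces the claim to rectangles. *)
Lemma lebesgue_rV_shift d (v : 'rV[R]_d) A : measurable A ->
  mu d A = mu d ((fun x => x + v) @^-1` A).
Proof.
elim: d v A => [|d IH] v A mA.
  rewrite (_ : _ @^-1` _ = A)//.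
  by apply/seteqP; split=> x /=; rewrite (_ : x + v = x)//; apply/rowP => -[].
pose t0 := v ord0 ord0; pose w : 'rV[R]_d := \row_i v ord0 (lift ord0 i).
pose S (p : measurableTypeR R * 'rV[R]_d) : measurableTypeR R * 'rV[R]_d :=
  (p.1 + t0, p.2 + w).
have mS : measurable_fun setT S.
  apply: measurable_fun_pair.
    by apply: measurable_funD => //; exact: measurable_fst.
  exact: (measurableT_comp (measurable_shift_rV w) measurable_snd).
have cS p : cons_rV (S p) = cons_rV p + v.
  apply/rowP => i.
  rewrite -[LHS]/(cons_rV (S p) ord0 i) -[RHS]/((cons_rV p + v) ord0 i) [RHS]mxE.
  case: (unliftP ord0 i) => [j|] ->.
    apply: etrans (cons_rVS _ _) _; rewrite /S /= [LHS]mxE [w _ _]mxE; congr (_ + _).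
    exact: esym (cons_rVS _ _).
  apply: etrans (cons_rV0 _) _; rewrite /S /=; congr (_ + _).
  exact: esym (cons_rV0 _).
rewrite !lebesgue_rVS.
rewrite (_ : @cons_rV R d @^-1` ((fun x => x + v) @^-1` A) =
  S @^-1` (@cons_rV R d @^-1` A)); last first.
  apply/seteqP; split=> p; first by rewrite /preimage /mkset cS.
  by rewrite /preimage /mkset cS.
have mA' : measurable (@cons_rV R d @^-1` A).
  by rewrite -[X in measurable X]setTI; exact: measurable_cons_rV.
have := @product_measure_unique _ _ _ _ R lam (mu d)
  (measure_function_pushforward__canonical__measure_function_Measure (lam \x mu d)%E mS).
apply => //= B C mB mC; rewrite /pushforward.
rewrite (_ : S @^-1` (B `*` C) =
  ((fun x => x + t0) @^-1` B) `*` ((fun x => x + w) @^-1` C)); last by [].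
rewrite product_measure1E.
- by congr (_ * _)%E; [exact: lebesgue_measure_shift|exact/esym/IH].
- rewrite -[X in measurable X]setTI.
  by have := @measurable_funD _ _ R setT id (cst t0); apply.
- by rewrite -[X in measurable X]setTI; exact: measurable_shift_rV.
Qed.

Lemma cmeasurable_prod d (T : measurableType d) (n : nat) (u : 'I_n -> T -> R[i]) :
  (forall i, cmeasurable (u i)) -> cmeasurable (fun x : T => \prod_i u i x).
Proof.
elim: n u => [|n IH] u mu.
  by under eq_fun do rewrite big_ord0; exact: cmeasurable_cst.
under eq_fun do rewrite big_ord_recl.
by apply: cmeasurableM => //; exact: (IH (fun i => u (lift ord0 i))).
Qed.

Lemma cmeasurable_coord d (i : 'I_d) (u : R -> R[i]) :
  cmeasurable (u : measurableTypeR R -> R[i]) ->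
  cmeasurable (fun x : 'rV[R]_d => u (x ord0 i)).
Proof.
by move=> [r im]; split; [exact: (measurableT_comp r (@measurable_coord R d i))|
  exact: (measurableT_comp im (@measurable_coord R d i))].
Qed.

(** Fubini, one coordinate at a time. Integrability is part of the conclusion because the induction
    step needs it for the remaining coordinates. *)
Lemma cint_prod_coord d (u : 'I_d -> R -> R[i]) :
  (forall i, cintegrable lam (u i)) ->
  cintegrable (mu d) (fun x => \prod_i u i (x ord0 i)) /\
  cint (mu d) (fun x => \prod_i u i (x ord0 i)) = \prod_i cint lam (u i).
Proof.
elim: d u => [|d IH] u ju.
  under eq_fun do rewrite big_ord0.
  rewrite big_ord0; split.
    by split=> /=; exact: finite_measure_integrable_cst.
  have m0 : mu 0%N setT = 1%E by rewrite /= diracE mem_set.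
  rewrite /cint !Rintegral_cst// mul0r mul1r.
  exact: (congr1 (fun z : \bar R => Complex (fine z) 0) m0).
have [jG eG] := IH (fun i => u (lift ord0 i)) (fun i => ju (lift ord0 i)).
have mp : cmeasurable (fun x : 'rV[R]_d.+1 => \prod_i u i (x ord0 i)).
  apply: cmeasurable_prod => i; apply: cmeasurable_coord.
  exact: cintegrable_measurable (ju i).
have e : (fun x : 'rV[R]_d.+1 => \prod_i u i (x ord0 i)) \o @cons_rV R d =
    (fun p => u ord0 p.1 * \prod_i u (lift ord0 i) (p.2 ord0 i)).
  apply/funext => p /=; rewrite big_ord_recl cons_rV0; congr (_ * _).
  by apply: eq_bigr => i _; rewrite cons_rVS.
have jp := cintegrable_tensor (ju ord0) jG; rewrite -e in jp.
split; first by apply: cintegrable_image jp => //; exact: measurable_cons_rV.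
rewrite (@cint_image _ _ _ _ R _ (mu d.+1) _ (@measurable_cons_rV R d)
  (fun A _ => lebesgue_rVS A) _ mp jp) e.
by rewrite big_ord_recl -eG; exact: (cint_tensor (ju ord0) jG).
Qed.

End rV_integral.

(** * Plancherel on R^d *)

Section fourier_box.
Variables (R : realType) (d : nat).
Local Notation V := 'rV[R]_d.
Local Notation lam := (@lebesgue_measure R).
Local Notation mu := (@lebesgue_rV R d).
Implicit Types (f g h : V -> R[i]) (a b x y xi : V) (c : R[i]) (r : R) (A : set V).

Definition cindic A : V -> R[i] := fun x => ((\1_A x : R)%:C)%C.

(** Half-open sides match the intervals already treated, and keep the family closed under
    intersection. *)
Definition box a b : set V := [set x | forall i, `]a ord0 i, b ord0 i]%classic (x ord0 i)].

Definition cube r : set V := box (const_mx (- r)) (const_mx r).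

(** Bounded support makes a square-integrable function integrable, so that [fourier] is an
    absolutely convergent integral and a continuous function. *)
Definition L2c f := L2fun mu f /\ exists r, forall x, ~ cube r x -> f x = 0.

Definition modulate y f : V -> R[i] := fun x => f x * cis (- (2 * pi * dotp y x)).

Lemma fourierE f xi : fourier f xi = cint mu (modulate xi f).
Proof. by []. Qed.

Lemma dotpDl x y z : dotp (x + y) z = dotp x z + dotp y z :> R.
Proof. by rewrite /dotp -big_split; apply: eq_bigr => i _; rewrite mxE mulrDl. Qed.

Lemma dotpDr x y z : dotp z (x + y) = dotp z x + dotp z y :> R.
Proof. by rewrite /dotp -big_split; apply: eq_bigr => i _; rewrite mxE mulrDr. Qed.

Lemma dotpNl x y : dotp (- x) y = - dotp x y :> R.
Proof. by rewrite /dotp -sumrN; apply: eq_bigr => i _; rewrite mxE mulNr. Qed.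

Lemma dotpNr x y : dotp x (- y) = - dotp x y :> R.
Proof. by rewrite /dotp -sumrN; apply: eq_bigr => i _; rewrite mxE mulrN. Qed.

Lemma dotp0l x : dotp 0 x = 0 :> R.
Proof. by rewrite /dotp big1// => i _; rewrite mxE mul0r. Qed.

Lemma modulateD x y f : modulate x (modulate y f) = modulate (x + y) f.
Proof.
apply/funext => t; rewrite /modulate -mulrA -cisD; congr (_ * cis _).
by rewrite dotpDl; ring.
Qed.

Lemma modulate0 f : modulate 0 f = f.
Proof. by apply/funext => t; rewrite /modulate dotp0l mulr0 oppr0 cis0 mulr1. Qed.

Lemma sqn_modulate y f x : sqn (modulate y f x) = sqn (f x).
Proof. by rewrite /modulate sqnM sqn_cis mulr1. Qed.

Lemma nrm2_modulate y f : nrm2 mu (modulate y f) = nrm2 mu f.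
Proof. by rewrite /nrm2; under eq_Rintegral do rewrite sqn_modulate. Qed.

Lemma fourier_modulate y f xi : fourier (modulate y f) xi = fourier f (xi + y).
Proof. by rewrite !fourierE modulateD. Qed.

Lemma modulateDf y f g : modulate y (fun x => f x + g x) =
  (fun x => modulate y f x + modulate y g x).
Proof. by apply/funext => x; rewrite /modulate mulrDl. Qed.

Lemma modulateZf y c f : modulate y (fun x => c * f x) = (fun x => c * modulate y f x).
Proof. by apply/funext => x; rewrite /modulate mulrA. Qed.

Lemma measurable_dotp y : measurable_fun setT (fun x : V => dotp y x).
Proof.
apply: measurable_sum => i; apply: measurable_funM => //.
exact: measurable_coord.
Qed.

Lemma cmeasurable_cis (u : V -> R) : measurable_fun setT u -> cmeasurable (fun x => cis (u x)).
Proof.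
by move=> mf; split; apply: measurableT_comp mf; apply: continuous_measurable_fun;
  [exact: continuous_cos|exact: continuous_sin].
Qed.

Lemma cmeasurable_char y : cmeasurable (fun x : V => cis (- (2 * pi * dotp y x))).
Proof.
apply: cmeasurable_cis; apply: measurable_funN; apply: measurable_funM => //.
exact: measurable_dotp.
Qed.

Lemma L2fun_modulate y f : L2fun mu f -> L2fun mu (modulate y f).
Proof.
move=> [mf jf]; split; first by apply: cmeasurableM => //; exact: cmeasurable_char.
by apply: eq_integrable jf => // x _ /=; rewrite sqn_modulate.
Qed.

Lemma cmeasurable_cindic A : measurable A -> cmeasurable (cindic A).
Proof. by move=> mA; split; [exact: measurable_indic|exact: measurable_cst]. Qed.

Lemma sqn_cindic A x : sqn (cindic A x) = \1_A x.
Proof.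
by rewrite /cindic sqnR indicE; case: (x \in A); rewrite ?expr1n// expr0n.
Qed.

Lemma L2fun_cindic A : measurable A -> (mu A < +oo)%E -> L2fun mu (cindic A).
Proof.
move=> mA Ay; split; first exact: cmeasurable_cindic.
apply/integrableP; split.
  by apply/measurable_EFinP/measurable_sqn; exact: cmeasurable_cindic.
under eq_integral do rewrite /= ger0_norm ?sqn_ge0// sqn_cindic.
by rewrite integral_indic// setIT.
Qed.

Lemma nrm2_cindic A : measurable A -> nrm2 mu (cindic A) = fine (mu A).
Proof.
move=> mA; rewrite /nrm2; under eq_Rintegral do rewrite sqn_cindic.
by rewrite /Rintegral integral_indic// setIT.
Qed.

Lemma measurable_box a b : measurable (box a b).
Proof.
rewrite (_ : box a b = \bigcap_(i in [set: 'I_d])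
    ((fun y : V => y ord0 i) @^-1` `]a ord0 i, b ord0 i]%classic)).
  apply: fin_bigcap_measurable => // i _; rewrite -[X in measurable X]setTI.
  exact: measurable_coord.
by apply/seteqP; split=> x /= xA i; [move=> _|]; exact: xA.
Qed.

Lemma boxE a b : mu (box a b) =
  (\prod_(i < d) Num.max 0 (b ord0 i - a ord0 i))%:E.
Proof.
apply: etrans (@lebesgue_rV_box R d (fun i => `]a ord0 i, b ord0 i]%classic) _) _.
  by move=> i; exact: measurable_itv.
rewrite -prodEFin; apply: eq_bigr => i _.
rewrite lebesgue_measure_itv /= lte_fin -EFinB; case: ltP => h; congr EFin.
  by apply/esym/max_r; rewrite subr_ge0 ltW.
by apply/esym/max_l; rewrite subr_le0.
Qed.

Lemma box_lty a b : (mu (box a b) < +oo)%E.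
Proof. by rewrite boxE ltry. Qed.

Lemma boxI a b a' b' : box a b `&` box a' b' =
  box (\row_i Num.max (a ord0 i) (a' ord0 i)) (\row_i Num.min (b ord0 i) (b' ord0 i)).
Proof.
apply/seteqP; split=> x /=.
  move=> [h h'] i; move: (h i) (h' i).
  by rewrite /= !in_itv/= !mxE gt_max le_min => /andP[-> ->] /andP[-> ->].
move=> h; split=> i; move: (h i);
  by rewrite /= !in_itv/= !mxE gt_max le_min => /andP[/andP[? ?] /andP[? ?]]; apply/andP.
Qed.

Lemma cubeS r r' : r <= r' -> cube r `<=` cube r'.
Proof.
move=> rr x h i; move: (h i); rewrite /= !in_itv/= !mxE => /andP[h1 h2].
by rewrite (le_lt_trans _ h1) ?lerN2//= (le_trans h2).
Qed.

Lemma L2c_L2fun f : L2c f -> L2fun mu f. Proof. by case. Qed.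

Lemma L2c_cube f : L2c f -> exists2 r, 0 < r & forall x, f x = f x * cindic (cube r) x.
Proof.
move=> [_ [r h]]; exists (Num.max r 1); first by rewrite lt_max ltr01 orbT.
move=> x; rewrite /cindic indicE; have [|xr] := boolP (x \in cube _).
  by rewrite mulr1.
rewrite mulr0 h// => xr'; move/negP: xr; apply; rewrite inE.
by apply: cubeS xr'; rewrite le_max lexx.
Qed.

Lemma L2c_cindic_box a b : L2c (cindic (box a b)).
Proof.
split; first by apply: L2fun_cindic; [exact: measurable_box|exact: box_lty].
exists (\sum_i (`|a ord0 i| + `|b ord0 i|) + 1) => x nx.
rewrite /cindic indicE memNset// => xab; apply: nx => i.
have := xab i; rewrite /= !in_itv/= !mxE => /andP[h1 h2].
have h : `|a ord0 i| + `|b ord0 i| <= \sum_i (`|a ord0 i| + `|b ord0 i|).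
  by rewrite (bigD1 i)//= lerDl sumr_ge0// => j _; rewrite addr_ge0.
apply/andP; split.
  rewrite ltrNl; apply: lt_le_trans (_ : `|a ord0 i| + 1 <= _); last first.
    by rewrite lerD2r (le_trans _ h)// lerDl.
  have := ler_norm (- a ord0 i); rewrite normrN => k.
  by rewrite ltr_pwDr// (le_trans _ k)// lerN2 ltW.
by rewrite (le_trans h2)// (le_trans (ler_norm _))// ler_wpDr// (le_trans _ h)// lerDr.
Qed.

Lemma L2cD f g : L2c f -> L2c g -> L2c (fun x => f x + g x).
Proof.
move=> [jf [r hf]] [jg [s hg]]; split; first exact: L2funD.
exists (Num.max r s) => x nx; rewrite hf ?hg ?addr0// => h; apply: nx.
  by apply: cubeS h; rewrite le_max lexx orbT.
by apply: cubeS h; rewrite le_max lexx.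
Qed.

Lemma L2cZ c f : L2c f -> L2c (fun x => c * f x).
Proof.
move=> [jf [r hf]]; split; first exact: L2funZ.
by exists r => x nx; rewrite hf// mulr0.
Qed.

Lemma L2cB f g : L2c f -> L2c g -> L2c (fun x => f x - g x).
Proof.
move=> jf jg; rewrite (_ : (fun _ => _) = fun x => f x + (-1) * g x).
  by apply: L2cD => //; exact: L2cZ.
by apply/funext => x; rewrite mulN1r.
Qed.

Lemma L2c_modulate y f : L2c f -> L2c (modulate y f).
Proof.
move=> [jf [r hf]]; split; first exact: L2fun_modulate.
by exists r => x nx; rewrite /modulate hf// mul0r.
Qed.

Lemma L2c_restrict f A : L2c f -> measurable A -> L2c (fun x => f x * cindic A x).
Proof.
move=> [jf [r hf]] mA; split; last first.
  by exists r => x nx; rewrite hf// mul0r.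
have [mf kf] := jf.
apply: (@le_L2fun _ _ _ _ _ (fun x => sqn (f x))) => //.
  by apply: cmeasurableM => //; exact: cmeasurable_cindic.
by move=> x; rewrite sqnM sqn_cindic ler_piMr ?sqn_ge0.
Qed.

Lemma cintegrable_L2c f : L2c f -> cintegrable mu f.
Proof.
move=> jf; have [r _ h] := L2c_cube jf; rewrite (funext h).
apply: cintegrable_L2M; first exact: L2c_L2fun.
by apply: L2fun_cindic; [exact: measurable_box|exact: box_lty].
Qed.

Lemma fourierD f g : L2c f -> L2c g ->
  fourier (fun x => f x + g x) = (fun x => fourier f x + fourier g x).
Proof.
move=> jf jg; apply/funext => x; rewrite !fourierE modulateDf cintD//;
  by apply: cintegrable_L2c; exact: L2c_modulate.
Qed.

Lemma fourierZ c f : L2c f ->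
  fourier (fun x => c * f x) = (fun x => c * fourier f x).
Proof.
move=> jf; apply/funext => x; rewrite !fourierE modulateZf cintZ//.
by apply: cintegrable_L2c; exact: L2c_modulate.
Qed.

Lemma fourierB f g : L2c f -> L2c g ->
  fourier (fun x => f x - g x) = (fun x => fourier f x - fourier g x).
Proof.
move=> jf jg; rewrite (_ : (fun x => f x - g x) = fun x => f x + (-1) * g x).
  by rewrite fourierD//; [rewrite fourierZ//; apply/funext => x; rewrite mulN1r|exact: L2cZ].
by apply/funext => x; rewrite mulN1r.
Qed.

Lemma cis_sum (I : Type) (s : seq I) (u : I -> R) :
  cis (\sum_(i <- s) u i) = \prod_(i <- s) cis (u i).
Proof.
elim: s => [|i s IH]; first by rewrite !big_nil cis0.
by rewrite !big_cons cisD IH.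
Qed.

Lemma cindic_box a b x :
  cindic (box a b) x = \prod_i ((\1_(`]a ord0 i, b ord0 i]%classic) (x ord0 i) : R)%:C)%C.
Proof.
rewrite /cindic indicE; have [|] := boolP (x \in box a b).
  rewrite inE => h; rewrite big1// => i _.
  by rewrite indicE mem_set//; exact: h.
move/negP; rewrite inE => h.
have [i hi] : exists i, ~ `]a ord0 i, b ord0 i]%classic (x ord0 i).
  by apply/not_existsP => k; apply: h => i; have := k i; exact: contrapT.
by rewrite (bigD1 i)//= indicE memNset// mul0r.
Qed.

Let cintegrable_itv_cis (s t k : R) :
  cintegrable lam (fun u : R => (\1_(`]s, t]%classic) u : R)%:C%C * cis (- (2 * pi * (k * u)))).
Proof.
have ml : measurable_fun setT (fun u : R => - (2 * pi * (k * u))).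
  by apply: measurable_funN; apply: measurable_funM => //; exact: measurable_funM.
have mc : cmeasurable (fun u : R =>
    (\1_(`]s, t]%classic) u : R)%:C%C * cis (- (2 * pi * (k * u)))).
  apply: cmeasurableM.
    by split; [exact: measurable_indic|exact: measurable_cst].
  split; apply: measurableT_comp ml; apply: continuous_measurable_fun;
    [exact: continuous_cos|exact: continuous_sin].
case: mc => mr mi.
have ji : lam.-integrable setT (EFin \o \1_(`]s, t]%classic)).
  exact: integrable_indic_itv.
split; apply: le_rintegrable ji _ => // u.
  rewrite /= mul0r subr0 normrM ger0_norm// ler_piMr// cos_max//.
rewrite /= mul0r addr0 normrM ger0_norm// ler_piMr// sin_max//.
Qed.

Lemma fourier_box a b xi : fourier (cindic (box a b)) xi =
  \prod_i fourier1 (fun t => (\1_(`]a ord0 i, b ord0 i]%classic) t : R)%:C%C) (xi ord0 i).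
Proof.
have [_ <-] := cint_prod_coord (fun i : 'I_d => cintegrable_itv_cis (a ord0 i) (b ord0 i) (xi ord0 i)).
rewrite fourierE; congr cint; apply/funext => x.
rewrite /modulate cindic_box big_split /=; congr (_ * _).
by rewrite -cis_sum sumrN -mulr_sumr.
Qed.

End fourier_box.

(** * Plancherel for step functions *)

Section step_plancherel.
Variables (R : realType) (d : nat).
Local Notation V := 'rV[R]_d.
Local Notation lam := (@lebesgue_measure R).
Local Notation mu := (@lebesgue_rV R d).
Implicit Types (f g h : V -> R[i]) (a b x y xi : V) (c : R[i]) (r : R) (A : set V).

Lemma cindicI A B x : cindic A x * conjc (cindic B x) = cindic (A `&` B) x.
Proof.
rewrite /cindic conjc_real -rmorphM; congr (real_complex _ _).
by rewrite !indicE in_setI -natrM mulnb.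
Qed.

Lemma cint_cindic A : measurable A -> cint mu (cindic A) = ((fine (mu A))%:C)%C.
Proof.
move=> mA; rewrite /cint; congr Complex; last by rewrite Rintegral_cst// mul0r.
by rewrite /Rintegral integral_indic// setIT.
Qed.

Lemma inner_cindic A B : measurable A -> measurable B ->
  inner mu (cindic A) (cindic B) = ((fine (mu (A `&` B)))%:C)%C.
Proof.
move=> mA mB; rewrite -cint_cindic; last exact: measurableI.
by congr cint; apply/funext => x; rewrite cindicI.
Qed.

(** Both inner products factor over the coordinates, which leaves the identity for intervals. *)
Lemma fourier_box_plancherel a b a' b' :
  L2fun mu (fourier (cindic (box a b))) /\
  inner mu (fourier (cindic (box a b))) (fourier (cindic (box a' b'))) =
  inner mu (cindic (box a b)) (cindic (box a' b')).
Proof.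
pose v (a b : V) (i : 'I_d) := fourier1 (fun t : R => (\1_(`]a ord0 i, b ord0 i]%classic) t : R)%:C%C).
have jv (p q : V) i : L2fun lam (v p q i) by apply: L2fun_fourier1; exact: is_ocitv.
pose u (a b a' b' : V) (i : 'I_d) (t : R) := v a b i t * conjc (v a' b' i t).
have ju p q p' q' i : cintegrable lam (u p q p' q' i) by exact: cintegrable_inner.
have e p q p' q' x : fourier (cindic (box p q)) x * conjc (fourier (cindic (box p' q')) x)
    = \prod_i u p q p' q' i (x ord0 i).
  rewrite !fourier_box (big_morph _ (rmorphM conjc) (rmorph1 conjc)).
  by rewrite -big_split.
split.
  have mF : cmeasurable (fourier (cindic (box a b))).
    rewrite (_ : fourier _ = fun x : V => \prod_i v a b i (x ord0 i)).
      apply: cmeasurable_prod => i; apply: cmeasurable_coord.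
      by case: (jv a b i).
    by apply/funext => x; rewrite fourier_box.
  split=> //.
  have [[jr _] _] := cint_prod_coord (ju a b a b).
  by apply: eq_integrable jr => // x _; rewrite /comp -e mul_conjc.
rewrite [LHS]/inner (funext (e a b a' b')).
have [_ ->] := cint_prod_coord (ju a b a' b').
rewrite inner_cindic; [|exact: measurable_box|exact: measurable_box].
pose A i := `]a ord0 i, b ord0 i]%classic `&` `]a' ord0 i, b' ord0 i]%classic.
have -> : box a b `&` box a' b' = [set x | forall i, A i (x ord0 i)].
  by apply/seteqP; split=> x /=; [move=> [h h'] i; split; [exact: h|exact: h']|
    move=> h; split=> i; have [] := h i].
have mA i : measurable (A i) by apply: measurableI; exact: measurable_itv.
have Ay i : lam (A i) \is a fin_num.
  rewrite ge0_fin_numE//.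
  apply: (@le_lt_trans _ _ (lam `]a ord0 i, b ord0 i]%classic)).
    by apply: (@le_measure _ _ _ lam); rewrite ?inE; [exact: mA|exact: measurable_itv|exact: subIsetl].
  by rewrite [X in (X < _)%E]lebesgue_measure_itv; case: ifP => _; rewrite -?EFinB ltry.
have -> : mu [set x : V | forall i, A i (x ord0 i)] = (\prod_i fine (lam (A i)))%:E.
  apply: etrans (lebesgue_rV_box mA) _.
  by rewrite -prodEFin; apply: eq_bigr => i _; rewrite fineK.
rewrite /= rmorph_prod; apply: eq_bigr => i _.
by apply: fourier1_plancherel; exact: is_ocitv.
Qed.

Definition step_fun f := exists s : seq (R[i] * (V * V)),
  f = fun x => \sum_(p <- s) p.1 * cindic (box p.2.1 p.2.2) x.

Lemma step_fun_ind (P : (V -> R[i]) -> Prop) :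
  P (fun=> 0) ->
  (forall c a b f, step_fun f -> P f -> P (fun x => c * cindic (box a b) x + f x)) ->
  forall f, step_fun f -> P f.
Proof.
move=> P0 PS f [s ->]; elim: s => [|[c [a b]] s IH].
  by rewrite (_ : (fun _ => _) = fun=> 0)//; apply/funext => x; rewrite big_nil.
rewrite (_ : (fun _ => _) = fun x => c * cindic (box a b) x +
  \sum_(p <- s) p.1 * cindic (box p.2.1 p.2.2) x); first by apply: PS => //; exists s.
by apply/funext => x; rewrite big_cons.
Qed.

Lemma step_fun0 : step_fun (fun=> 0).
Proof. by exists [::]; apply/funext => x; rewrite big_nil. Qed.

Lemma step_funD f g : step_fun f -> step_fun g -> step_fun (fun x => f x + g x).
Proof.
move=> [s ->] [t ->]; exists (s ++ t).
by apply/funext => x; rewrite big_cat.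
Qed.

Lemma step_funZ c f : step_fun f -> step_fun (fun x => c * f x).
Proof.
move=> [s ->]; exists [seq (c * p.1, p.2) | p <- s].
by apply/funext => x; rewrite big_map mulr_sumr; apply: eq_bigr => p _; rewrite mulrA.
Qed.

Lemma step_fun_box a b : step_fun (cindic (box a b)).
Proof. by exists [:: (1, (a, b))]; apply/funext => x; rewrite big_seq1 mul1r. Qed.

Lemma step_fun_L2c f : step_fun f -> L2c f.
Proof.
move: f; apply: step_fun_ind => [|c a b f _ jf].
  by split; [exact: L2fun0|exists 0].
by apply: L2cD => //; apply: L2cZ; exact: L2c_cindic_box.
Qed.

Lemma fourier0 : fourier (fun _ : V => 0) = fun=> 0.
Proof.
apply/funext => x; rewrite fourierE (_ : modulate _ _ = fun=> 0) ?cint0//.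
by apply/funext => t; rewrite /modulate mul0r.
Qed.

Lemma L2fun_fourier_step f : step_fun f -> L2fun mu (fourier f).
Proof.
move: f; apply: step_fun_ind => [|c a b f sf jf].
  by rewrite fourier0; exact: L2fun0.
have jb : L2c (fun x => c * cindic (box a b) x) by apply/L2cZ/L2c_cindic_box.
rewrite (fourierD jb (step_fun_L2c sf)) (fourierZ c (L2c_cindic_box a b)).
apply: L2funD jf; apply: L2funZ; by have [] := fourier_box_plancherel a b a b.
Qed.

Lemma inner0l g : inner mu (fun=> 0) g = 0.
Proof. by rewrite /inner; under eq_fun do rewrite mul0r; exact: cint0. Qed.

Lemma inner_fourier_step_box f a b : step_fun f ->
  inner mu (fourier f) (fourier (cindic (box a b))) = inner mu f (cindic (box a b)).
Proof.
move: f; apply: step_fun_ind => [|c a' b' f sf IH].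
  by rewrite fourier0 !inner0l.
have jbb := L2c_cindic_box a' b'; have jb := L2cZ c jbb.
have jf := step_fun_L2c sf; have jFf := L2fun_fourier_step sf.
have [jF e] := fourier_box_plancherel a' b' a b.
have [jF' _] := fourier_box_plancherel a b a' b'.
have jab := L2c_L2fun (L2c_cindic_box a b).
rewrite (fourierD jb jf) (fourierZ c jbb) (innerDl (L2funZ c jF) jFf jF').
rewrite (innerZl c jF jF') e IH.
by rewrite (innerDl (L2c_L2fun jb) (L2c_L2fun jf) jab) (innerZl c (L2c_L2fun jbb) jab).
Qed.

Lemma inner_fourier_step f g : step_fun f -> step_fun g ->
  inner mu (fourier f) (fourier g) = inner mu f g.
Proof.
move=> sf; move: g.
have jf := step_fun_L2c sf; have jFf := L2fun_fourier_step sf.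
apply: step_fun_ind => [|c a b g sg IH].
  rewrite fourier0 (innerC (L2fun0 mu) jFf) inner0l.
  by rewrite (innerC (L2fun0 mu) (L2c_L2fun jf)) inner0l.
have jbb := L2c_cindic_box a b; have jb := L2cZ c jbb.
have jg := step_fun_L2c sg; have jFg := L2fun_fourier_step sg.
have [jF _] := fourier_box_plancherel a b a b.
rewrite (fourierD jb jg) (fourierZ c jbb) (innerDr (L2funZ c jF) jFg jFf).
rewrite (innerZr c jF jFf) (inner_fourier_step_box a b sf) IH.
rewrite (innerDr (L2c_L2fun jb) (L2c_L2fun jg) (L2c_L2fun jf)).
by rewrite (innerZr c (L2c_L2fun jbb) (L2c_L2fun jf)).
Qed.

Lemma nrm2_fourier_step f : step_fun f -> nrm2 mu (fourier f) = nrm2 mu f.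
Proof.
move=> sf; apply: complexI; rewrite -!inner_nrm2.
exact: inner_fourier_step.
Qed.

End step_plancherel.

(** * Approximation of indicators by step functions *)

Section step_density.
Variables (R : realType) (d : nat).
Local Notation V := 'rV[R]_d.
Local Notation mu := (@lebesgue_rV R d).
Implicit Types (f g h : V -> R[i]) (a b x y xi : V) (c : R[i]) (r : R) (A : set V).

Let coord (i : 'I_d) (x : V) : R := x ord0 i.

(** Sides equal to the whole line are allowed so that the family contains the one-coordinate
    cylinders, which generate the sigma-algebra, and is still closed under intersection. *)
Let cyl : set (set V) := [set A | exists I : 'I_d -> set R,
  (forall i, ocitv (I i) \/ I i = setT) /\ A = [set x : V | forall i, I i (x ord0 i)]].

Let cylI : setI_closed cyl.
Proof.
move=> _ _ [I [hI ->]] [J [hJ ->]]; exists (fun i => I i `&` J i); split.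
  move=> i; have [oI|->] := hI i; last by rewrite setTI.
  by have [oJ|->] := hJ i; [left; exact: ocitvI|left; rewrite setIT].
by apply/seteqP; split=> x /=; [move=> [h h'] i; split; [exact: h|exact: h']|
  move=> h; split=> i; have [] := h i].
Qed.

Let sigma_cyl : @measurable _ V = <<s cyl >>.
Proof.
apply/seteqP; split; last first.
  apply: smallest_sub; first exact: sigma_algebra_measurable.
  move=> _ [I [hI ->]].
  rewrite (_ : [set x | _] = \bigcap_(i in [set: 'I_d]) (coord i @^-1` I i)).
    apply: fin_bigcap_measurable => // i _; rewrite -[X in measurable X]setTI.
    apply: measurable_coord => //.
    have [oI|->//] := hI i.
    by have [a [b _ ->]] := ocitv_le oI; exact: measurable_itv.
  by apply/seteqP; split=> x /= xA i; [move=> _|]; exact: xA.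
apply: smallest_sub; first exact: smallest_sigma_algebra.
rewrite -bigcup_seq; apply: bigcup_sub => i _ B [Y mY <-]; rewrite setTI.
suff sub : @measurable _ (measurableTypeR R) `<=` [set Y | <<s cyl >> (coord i @^-1` Y)].
  exact: (sub Y mY).
have [s0 sC sU] := smallest_sigma_algebra setT cyl.
apply: smallest_sub.
  split=> /=; first by rewrite preimage_set0.
    by move=> A sA; rewrite setTD preimage_setC -setTD; exact: sC.
  by move=> F sF; rewrite preimage_bigcup; exact: sU.
move=> A oA /=; apply: sub_gen_smallest.
exists (fun j => if j == i then A else setT); split.
  by move=> j; case: eqP; [left|right].
apply/seteqP; split=> x /=; first by move=> xA j; case: eqP => // ->.
by move=> /(_ i); rewrite eqxx.
Qed.

Definition step_approx f := forall e : R, 0 < e ->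
  exists2 g, step_fun g & nrm2 mu (fun x => f x - g x) < e.

Lemma step_approx_step f : step_fun f -> step_approx f.
Proof.
move=> sf e e0; exists f => //; rewrite (_ : nrm2 _ _ = 0)//.
rewrite /nrm2; under eq_Rintegral do rewrite subrr sqn0.
by rewrite Rintegral_cst// mul0r.
Qed.

Lemma step_approxD f g : L2fun mu f -> L2fun mu g ->
  step_approx f -> step_approx g -> step_approx (fun x => f x + g x).
Proof.
move=> jf jg af ag e e0; have e4 : 0 < e / 4 by rewrite divr_gt0.
have [f' sf' hf] := af _ e4; have [g' sg' hg] := ag _ e4.
exists (fun x => f' x + g' x); first exact: step_funD.
have jf' := L2c_L2fun (step_fun_L2c sf'); have jg' := L2c_L2fun (step_fun_L2c sg').
rewrite (_ : (fun _ => _) = fun x => (f x - f' x) + (g x - g' x)); last first.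
  by apply/funext => x; ring.
apply: (le_lt_trans (nrm2D_le (L2funB jf jf') (L2funB jg jg'))).
by lra.
Qed.

Lemma step_approxZ c f : L2fun mu f ->
  step_approx f -> step_approx (fun x => c * f x).
Proof.
move=> jf af e e0; have c1 : 0 < sqn c + 1 by rewrite ltr_wpDl ?sqn_ge0.
have [f' sf' hf] := af _ (divr_gt0 e0 c1).
exists (fun x => c * f' x); first exact: step_funZ.
have jf' := L2c_L2fun (step_fun_L2c sf').
rewrite (_ : (fun _ => _) = fun x => c * (f x - f' x)); last first.
  by apply/funext => x; ring.
rewrite nrm2Z; last exact: L2funB.
move: hf; rewrite ltr_pdivlMr// => hf; apply: le_lt_trans hf.
by rewrite mulrC ler_wpM2l ?nrm2_ge0// lerDl.
Qed.

Lemma step_approx_lim f : L2fun mu f ->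
  (forall e : R, 0 < e -> exists g, [/\ L2fun mu g, step_approx g &
    nrm2 mu (fun x => f x - g x) < e]) -> step_approx f.
Proof.
move=> jf lf e e0; have e4 : 0 < e / 4 by rewrite divr_gt0.
have [g [jg ag hg]] := lf _ e4; have [h sh hh] := ag _ e4.
exists h => //; have jh := L2c_L2fun (step_fun_L2c sh).
rewrite (_ : (fun _ => _) = fun x => (f x - g x) + (g x - h x)); last first.
  by apply/funext => x; ring.
apply: (le_lt_trans (nrm2D_le (L2funB jf jg) (L2funB jg jh))).
by lra.
Qed.

Lemma step_approx_seq f (F : nat -> V -> R[i]) (C : R) (g : V -> R[i]) :
  L2fun mu f -> L2fun mu g -> (forall n, L2fun mu (F n)) ->
  (forall n, step_approx (F n)) ->
  (forall n x, sqn (f x - F n x) <= C * sqn (g x)) ->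
  (forall x e, 0 < e -> \forall n \near \oo, sqn (f x - F n x) < e) ->
  step_approx f.
Proof.
move=> jf jg jF aF dF cF; apply: step_approx_lim => // e e0.
have := nrm2_dominated_cvg (fun n => L2funB jf (jF n)) jg cF dF.
move=> /cvgrPdist_lt /(_ _ e0) [N _ /(_ N (leqnn N))].
rewrite sub0r normrN ger0_norm ?nrm2_ge0// => h.
by exists (F N).
Qed.

Lemma measurable_cube r : measurable (cube r : set V).
Proof. exact: measurable_box. Qed.

Lemma cube_lty r : (mu (cube r) < +oo)%E.
Proof. exact: box_lty. Qed.

Lemma L2fun_cindic_cube A r : measurable A -> L2fun mu (cindic (A `&` cube r)).
Proof.
move=> mA; apply: L2fun_cindic.
  by apply: measurableI => //; exact: measurable_cube.
apply: le_lt_trans (cube_lty r); apply: (@le_measure _ _ _ mu); rewrite ?inE.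
- by apply: measurableI => //; exact: measurable_cube.
- exact: measurable_cube.
- exact: subIsetr.
Qed.

(** The sets whose trace on a fixed cube can be approximated form a Dynkin system that contains
    [cyl]. Intersecting with the cube keeps all measures finite under complements and supplies the
    dominating function for countable unions. *)
Lemma step_approx_cindic A r : measurable A -> step_approx (cindic (A `&` cube r)).
Proof.
move=> mA; have : <<s cyl >> A by rewrite -sigma_cyl.
move: A mA => A0 _; move: A0.
apply: (@dynkin_induction _ V cyl
  (fun A => step_approx (cindic (A `&` cube r))) sigma_cyl cylI).
- by rewrite setTI; apply: step_approx_step; exact: step_fun_box.
- move=> _ [I [hI ->]]; apply: step_approx_step.
  have oI i : ocitv (I i `&` `](- r), r]%classic).
    by have [oI|->] := hI i; [apply: ocitvI => //; exact: is_ocitv|rewrite setTI; exact: is_ocitv].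
  have ab i : exists p : R * R, I i `&` `](- r), r]%classic = `]p.1, p.2]%classic.
    by have [a [b _ ->]] := ocitv_le (oI i); exists (a, b).
  pose a : V := \row_i (sval (cid (ab i))).1.
  pose b : V := \row_i (sval (cid (ab i))).2.
  have e i : `]a ord0 i, b ord0 i]%classic = I i `&` `](- r), r]%classic.
    by rewrite !mxE [RHS](svalP (cid (ab i))).
  rewrite (_ : _ `&` _ = box a b); first exact: step_fun_box.
  apply/seteqP; split=> x.
    move=> [h h'] i; rewrite e; split; first exact: h.
    by move: (h' i); rewrite !mxE.
  move=> h; split=> i; move: (h i); rewrite e => -[//].
  by rewrite !mxE.
- move=> A mA aA.
  have -> : cindic (~` A `&` cube r) =
      (fun x => cindic (cube r) x + (-1) * cindic (A `&` cube r) x).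
    apply/funext => x; rewrite /cindic !indicE !in_setI in_setC.
    by case: (x \in A); case: (x \in cube r); rewrite /= ?mulN1r ?subrr ?subr0 ?addr0//;
      apply/eqP; rewrite eq_complex /= ?oppr0 ?addr0 ?subrr ?eqxx.
  have jc := L2fun_cindic_cube r mA.
  apply: step_approxD; [|exact: L2funZ| |exact: step_approxZ].
    by rewrite -[cube r]setTI; exact: L2fun_cindic_cube.
  by apply: step_approx_step; exact: step_fun_box.
- move=> F mF tF aF.
  pose G n := cindic (\bigcup_(k < n) F k `&` cube r).
  have mG n : measurable (\bigcup_(k < n) F k) by exact: bigcup_measurable.
  have mU : measurable (\bigcup_k F k) by exact: bigcupT_measurable.
  have GS n : G n.+1 = fun x => G n x + cindic (F n `&` cube r) x.
    apply/funext => x; rewrite /G /cindic !indicE !in_setI bigcup_mkord big_ord_recr /=.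
    rewrite -bigcup_mkord in_setU.
    have [xn|xn] := boolP (x \in F n); last by rewrite orbF addr0.
    suff -> : (x \in \bigcup_(k < n) F k) = false by rewrite /= add0r.
    apply/negbTE/negP; rewrite inE => -[k /= kn xk].
    move/trivIsetP : tF => /(_ k n I I); rewrite neq_ltn kn => /(_ isT).
    by apply/eqP/set0P; exists x; split=> //; rewrite inE in xn.
  have jG n : L2fun mu (G n) by exact: L2fun_cindic_cube.
  have aG n : step_approx (G n).
    elim: n => [|n IH].
      rewrite (_ : G 0%N = fun=> 0); first exact/step_approx_step/step_fun0.
      apply/funext => x; rewrite /G /cindic indicE memNset//.
      by move=> [[k]].
    rewrite GS; apply: step_approxD => //; exact: L2fun_cindic_cube.
  apply: (@step_approx_seq _ G 1 (cindic (cube r))) => //.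
  + exact: L2fun_cindic_cube.
  + by rewrite -[cube r]setTI; exact: L2fun_cindic_cube.
  + move=> n x; rewrite mul1r sqn_cindic /G /cindic !indicE !in_setI.
    have [xc|xc] := boolP (x \in cube r); last by rewrite !andbF subrr sqn0.
    rewrite !andbT.
    have [xn|xn] := boolP (x \in \bigcup_(k < n) F k).
      suff -> : (x \in \bigcup_k F k) by rewrite subrr sqn0.
      by move: xn; rewrite !inE => -[k _ ?]; exists k.
    by rewrite subr0 sqnR; case: (_ \in _); rewrite ?expr1n// expr0n.
  + move=> x e e0; have [|xU] := boolP (x \in \bigcup_k F k); last first.
      near=> n; rewrite /G /cindic !indicE !in_setI (negbTE xU).
      suff -> : (x \in \bigcup_(k < n) F k) = false by rewrite subrr sqn0.
      apply/negbTE; apply: contra xU; rewrite !inE => -[k _ ?]; by exists k.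
    rewrite inE => -[k _ xk]; near=> n; rewrite /G /cindic !indicE !in_setI.
    have -> : x \in \bigcup_k F k by rewrite inE; exists k.
    have -> : x \in \bigcup_(k < n) F k.
      by rewrite inE; exists k => //=; near: n; exact: nbhs_infty_gt.
    by rewrite subrr sqn0.
Unshelve. all: by end_near. Qed.

End step_density.

(** * Continuity of the Fourier transform *)

Section fourier_continuity.
Variables (R : realType) (d : nat).
Local Notation V := 'rV[R]_d.
Local Notation mu := (@lebesgue_rV R d).
Implicit Types (f g h : V -> R[i]) (a b x y z xi : V) (c : R[i]) (r : R) (A : set V).

(** The norm dual to the sup norm, hence the natural bound for [dotp] against vectors of a cube. *)
Definition norm1 z : R := \sum_i `|z ord0 i|.

Lemma norm1_ge0 z : 0 <= norm1 z.
Proof. exact: sumr_ge0. Qed.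

Lemma norm1_cvg (x : V) : (fun y : V => norm1 (x - y)) @ nbhs x --> (0 : R).
Proof.
have h (s : seq 'I_d) :
    (fun y : V => \sum_(i <- s) `|(x - y) ord0 i|) @ nbhs x --> (0 : R).
  elim: s => [|i s IH].
    rewrite (_ : (fun y : V => _) = cst 0); first exact: cvg_cst.
    by apply/funext => y; rewrite big_nil.
  rewrite (_ : (fun y : V => _) =
    (fun y : V => `|(x - y) ord0 i| + \sum_(j <- s) `|(x - y) ord0 j|)); last first.
    by apply/funext => y; rewrite big_cons.
  rewrite -[X in _ --> X](addr0 0).
  apply: cvgD IH; rewrite -[X in _ --> X](@normr0 _ R); apply: cvg_norm.
  have -> : (fun y : V => (x - y) ord0 i) = (fun y => x ord0 i - y ord0 i).
    by apply/funext => y; rewrite !mxE.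
  rewrite -[X in _ --> X](subrr (x ord0 i)); apply: cvgB; first exact: cvg_cst.
  exact: coord_continuous.
exact: h.
Qed.

Lemma dotp_cube_le z x r : cube r x -> `|dotp z x| <= norm1 z * r.
Proof.
move=> xr; rewrite /dotp (le_trans (ler_norm_sum _ _ _))// /norm1 mulr_suml.
apply: ler_sum => i _; rewrite normrM ler_wpM2l// ler_norml.
by have := xr i; rewrite /= in_itv/= !mxE => /andP[/ltW -> ->].
Qed.

Lemma sqn_modulateB f x y r t : cube r t ->
  sqn (modulate x f t - modulate y f t) <= (2 * pi * r * norm1 (x - y)) ^+ 2 * sqn (f t).
Proof.
move=> tr; rewrite /modulate -mulrBr sqnM mulrC ler_wpM2r ?sqn_ge0//.
apply: le_trans (sqn_cisB _ _) _.
rewrite (_ : _ - _ = - (2 * pi * dotp (x - y) t)); last by rewrite dotpDl dotpNl; ring.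
rewrite sqrrN -[leLHS]real_normK ?num_real// normrM (@ger0_norm _ (2 * pi)); last first.
  by rewrite mulr_ge0 ?pi_ge0.
have h := dotp_cube_le (x - y) tr.
rewrite lerXn2r ?nnegrE//.
- by rewrite mulr_ge0// mulr_ge0 ?pi_ge0.
- by rewrite -mulrA (mulrC r) mulr_ge0 ?(le_trans _ h)// mulr_ge0 ?pi_ge0.
- by rewrite -[leRHS]mulrA (mulrC r) ler_wpM2l// mulr_ge0 ?pi_ge0.
Qed.

(** Cauchy-Schwarz against the indicator of the cube. The bound is uniform in [xi], so L^2
    approximation inside a fixed cube gives uniform approximation of transforms. *)
Lemma sqn_fourier_le f r xi : L2c f -> (forall x, f x = f x * cindic (cube r) x) ->
  sqn (fourier f xi) <= fine (mu (cube r)) * nrm2 mu f.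
Proof.
move=> jf fr; rewrite fourierE.
have jc : L2fun mu (cindic (cube r)) := L2c_L2fun (L2c_cindic_box _ _).
have jm := L2fun_modulate xi (L2c_L2fun jf).
rewrite (_ : cint _ _ = inner mu (modulate xi f) (cindic (cube r))); last first.
  congr cint; apply/funext => x; rewrite /modulate {1}fr -!mulrA; congr (_ * _).
  by rewrite mulrC /cindic conjc_real.
apply: le_trans (sqn_inner_le jm jc) _.
rewrite nrm2_modulate mulrC (nrm2_cindic (measurable_box _ _)); exact: lexx.
Qed.

Lemma sqn_fourierB_le f : L2c f -> exists C : R, forall x y,
  sqn (fourier f x - fourier f y) <= C * norm1 (x - y) ^+ 2.
Proof.
move=> jf; have [r r0 fr] := L2c_cube jf.
exists (fine (mu (cube r)) * nrm2 mu f * (2 * pi * r) ^+ 2) => x y.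
have jx := L2c_modulate x jf; have jy := L2c_modulate y jf.
rewrite !fourierE -cintB; [|exact: cintegrable_L2c|exact: cintegrable_L2c].
pose g t := modulate x f t - modulate y f t.
have jg : L2c g by exact: L2cB.
have gr t : g t = g t * cindic (cube r) t.
  by rewrite /g /modulate -mulrBr {1}fr mulrAC.
have := sqn_fourier_le 0 jg gr; rewrite fourierE modulate0 => /le_trans; apply.
rewrite -mulrA -mulrA ler_wpM2l ?fine_ge0//.
rewrite (mulrC (nrm2 mu f)) -exprMn.
apply: le_nrm2; [exact: L2c_L2fun|exact: L2c_L2fun|move=> t].
have [tr|tr] := pselect (cube r t); first exact: sqn_modulateB.
suff -> : g t = 0 by rewrite sqn0 mulr_ge0 ?sqr_ge0 ?sqn_ge0.
by rewrite gr /cindic indicE memNset// mulr0.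
Qed.

Lemma cvg_fourier f x e : L2c f -> 0 < e ->
  \forall y \near x, sqn (fourier f x - fourier f y) < e.
Proof.
move=> jf e0; have [C hC] := sqn_fourierB_le jf.
have C1 : 0 < `|C| + 1 by rewrite ltr_wpDl.
have := @norm1_cvg x; move=> /cvgrPdist_lt.
(* Below 1 the square of [norm1] is at most [norm1] itself, so the quadratic bound may be replaced
   by a linear one. *)
move=> /(_ (Num.min 1 (e / (`|C| + 1)))).
rewrite lt_min ltr01 divr_gt0// => /(_ isT); apply: filterS => y.
rewrite sub0r normrN ger0_norm ?norm1_ge0// lt_min => /andP[h1 h2].
apply: le_lt_trans (hC x y) _.
move: h2; rewrite ltr_pdivlMr// mulrC => h2; apply: le_lt_trans h2.
apply: (@le_trans _ _ ((`|C| + 1) * norm1 (x - y) ^+ 2)).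
  by rewrite ler_wpM2r ?sqr_ge0// (le_trans (ler_norm _))// lerDl.
by rewrite ler_wpM2l ?(ltW C1)// expr2 ler_piMr ?norm1_ge0// ltW.
Qed.

Lemma near_continuous_rV (u : V -> R) :
  (forall x e, 0 < e -> \forall y \near x, `|u x - u y| < e) -> continuous u.
Proof.
move=> h x; have k := @cvgrPdist_lt R R _ (nbhs x) _ u (u x).
by apply/k => e e0; exact: h.
Qed.

Lemma continuous_fourier f : L2c f ->
  continuous (fun x : V => complex.Re (fourier f x)) /\
  continuous (fun x : V => complex.Im (fourier f x)).
Proof.
move=> jf; split; apply: near_continuous_rV => x e e0;
  have hx := cvg_fourier x jf (exprn_gt0 2 e0); apply: filterS hx => y h;
  rewrite -(@ltr_pXn2r _ 2)// ?nnegrE ?(ltW e0)//; apply: le_lt_trans h;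
  rewrite real_normK ?num_real// /sqn; move: (fourier f x) (fourier f y) => [? ?] [? ?] /=.
  by rewrite lerDl sqr_ge0.
by rewrite lerDr sqr_ge0.
Qed.

Lemma continuous_measurable_rV (u : V -> R) : continuous u -> measurable_fun setT u.
Proof.
move=> cu.
apply: (measurability _ (RGenOpens.measurableE R)).
move=> _ [_ [a [b ->] <-]]; rewrite setTI.
apply: open_measurable_rV; apply: open_comp; last exact: interval_open.
by move=> x _; exact: cu.
Qed.

Lemma cmeasurable_fourier f : L2c f -> cmeasurable (fourier f).
Proof.
by move=> jf; have [cr ci] := continuous_fourier jf; split;
  exact: continuous_measurable_rV.
Qed.

End fourier_continuity.

Import HBNNSimple.

(** * Density of step functions among square-integrable functions of bounded support *)

Section step_density_L2.
Variables (R : realType) (d : nat).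
Local Notation V := 'rV[R]_d.
Local Notation mu := (@lebesgue_rV R d).
Implicit Types (f g h : V -> R[i]) (a b x y z xi : V) (c : R[i]) (r : R) (A : set V).

Lemma step_approx_sum (I : Type) (s : seq I) (F : I -> V -> R[i]) :
  (forall i, L2fun mu (F i)) -> (forall i, step_approx (F i)) ->
  step_approx (fun x => \sum_(i <- s) F i x).
Proof.
move=> jF aF; elim: s => [|i s IH].
  rewrite (_ : (fun x => _) = fun=> 0); first exact/step_approx_step/step_fun0.
  by apply/funext => x; rewrite big_nil.
rewrite (_ : (fun x => _) = fun x => F i x + \sum_(j <- s) F j x); last first.
  by apply/funext => x; rewrite big_cons.
by apply: step_approxD => //; exact: L2fun_sum.
Qed.

Lemma step_approx_ge0 (u : V -> R) r : measurable_fun setT u ->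
  (forall x, 0 <= u x) -> (forall x, ~ cube r x -> u x = 0) ->
  L2fun mu (fun x => ((u x)%:C)%C) -> step_approx (fun x => ((u x)%:C)%C).
Proof.
move=> mu_ u0 ur ju.
have mEu : measurable_fun setT (EFin \o u) by exact/measurable_EFinP.
pose un n : {nnsfun V >-> R} := nnsfun_approx (measurableT : measurable [set: V]) mEu n.
have cx x : (fun n => (un n x)%:E) @ \oo --> (u x)%:E.
  exact: (@cvg_nnsfun_approx _ _ _ _ measurableT _ mEu (fun x _ => u0 x) x I).
have un_le n x : un n x <= u x.
  have nd : nondecreasing_seq (fun n => (un n x)%:E).
    move=> m k mk; rewrite lee_fin.
    by have /lefP := nd_nnsfun_approx (measurableT : measurable [set: V]) mEu mk; apply.
  have e : (u x)%:E = ereal_sup (range (fun n => (un n x)%:E)).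
    exact: (cvg_unique _ (cx x) (ereal_nondecreasing_cvgn nd)).
  by rewrite -lee_fin e; apply: ereal_sup_ubound; exists n.
have un0 n x : 0 <= un n x by [].
(* Since [0 <= un n <= u], the simple functions vanish outside the cube too, so their level sets may
   be cut down to it. *)
have unE n : exists s : seq R, (fun x => ((un n x)%:C)%C) = fun x =>
    \sum_(k <- s) (k%:C)%C * cindic ((un n @^-1` [set k]) `&` cube r) x.
  have [s hs] : exists s : seq R, forall x, un n x =
      \sum_(k <- s) k * \1_(un n @^-1` [set k]) x.
    by eexists => x; rewrite [LHS]fimfunE fsbig_finite.
  exists s; apply/funext => x.
  have [xr|xr] := pselect (cube r x).
    rewrite hs rmorph_sum; apply: eq_bigr => k _.
    rewrite rmorphM; congr (_ * _); rewrite /cindic !indicE in_setI.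
    by rewrite (mem_set xr) andbT.
  rewrite (_ : un n x = 0); last by apply/eqP; rewrite eq_le un0 andbT -(ur x xr).
  by rewrite big1// => k _; rewrite /cindic indicE memNset ?mulr0// => -[].
have mS n s : measurable (un n @^-1` [set s]) by [].
have jS n k : L2fun mu (fun x => (k%:C)%C * cindic ((un n @^-1` [set k]) `&` cube r) x).
  by apply/L2funZ/L2fun_cindic_cube.
apply: (@step_approx_seq _ _ _ (fun n x => ((un n x)%:C)%C) 1 (fun x => ((u x)%:C)%C)) => //.
- by move=> n; have [s ->] := unE n; exact: L2fun_sum.
- move=> n; have [s ->] := unE n; apply: step_approx_sum => // k.
  apply: step_approxZ; first exact: L2fun_cindic_cube.
  exact: step_approx_cindic.
- move=> n x; rewrite mul1r -rmorphB !sqnR lerXn2r ?nnegrE ?subr_ge0//.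
  by rewrite gerBl.
- move=> x e e0; have /fine_cvgP[_ /cvgrPdist_lt] := cx x.
  have se : 0 < Num.sqrt e by rewrite sqrtr_gt0.
  move=> /(_ _ se); apply: filterS => n /= h.
  rewrite -rmorphB sqnR -[e]sqr_sqrtr ?(ltW e0)// -[ltLHS]real_normK ?num_real//.
  by rewrite ltrXn2r ?nnegrE.
Qed.

Lemma step_approx_real (u : V -> R) r : measurable_fun setT u ->
  (forall x, ~ cube r x -> u x = 0) ->
  L2fun mu (fun x => ((u x)%:C)%C) -> step_approx (fun x => ((u x)%:C)%C).
Proof.
move=> mu_ ur ju.
pose p x := (`|u x| + u x) / 2; pose q x := (`|u x| - u x) / 2.
have mn : measurable_fun setT (fun x => `|u x|) by apply: measurableT_comp => //; exact: normr_measurable.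
have p0 x : 0 <= p x by rewrite /p divr_ge0// -lerBlDr sub0r -normrN ler_norm.
have q0 x : 0 <= q x by rewrite /q divr_ge0// subr_ge0 ler_norm.
have mp : measurable_fun setT p by apply: measurable_funM => //; exact: measurable_funD.
have mq : measurable_fun setT q by apply: measurable_funM => //; exact: measurable_funB.
have pq x : p x ^+ 2 + q x ^+ 2 = u x ^+ 2.
  rewrite /p /q; have := @real_normK _ (u x) (num_real _).
  move: (`|u x|) => s; move: (u x) => t st.
  by transitivity ((s ^+ 2 + t ^+ 2) / 2); [field|rewrite st; field].
have jp : L2fun mu (fun x => ((p x)%:C)%C).
  apply: (@le_L2fun _ _ _ _ _ (fun x => sqn ((u x)%:C)%C)); [by split|by case: ju|].
  by move=> x; rewrite !sqnR -pq lerDl sqr_ge0.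
have jq : L2fun mu (fun x => ((q x)%:C)%C).
  apply: (@le_L2fun _ _ _ _ _ (fun x => sqn ((u x)%:C)%C)); [by split|by case: ju|].
  by move=> x; rewrite !sqnR -pq lerDr sqr_ge0.
rewrite (_ : (fun x => _) = fun x => ((p x)%:C)%C + (-1) * ((q x)%:C)%C); last first.
  apply/funext => x; rewrite mulN1r -rmorphB; congr (real_complex _ _).
  by rewrite /p /q; field.
apply: step_approxD => //; first exact: L2funZ.
  by apply: (@step_approx_ge0 _ r) => // x /ur u0; rewrite /p u0 normr0 addr0 mul0r.
apply: step_approxZ => //.
by apply: (@step_approx_ge0 _ r) => // x /ur u0; rewrite /q u0 normr0 subr0 mul0r.
Qed.

Lemma step_approx_L2c f : L2c f -> step_approx f.
Proof.
move=> [[[mr mi] jf] [r fr]].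
have jr : L2fun mu (fun x => ((complex.Re (f x))%:C)%C).
  apply: (@le_L2fun _ _ _ _ _ (fun x => sqn (f x))) => //.
  by move=> x; rewrite sqnR lerDl sqr_ge0.
have ji : L2fun mu (fun x => ((complex.Im (f x))%:C)%C).
  apply: (@le_L2fun _ _ _ _ _ (fun x => sqn (f x))) => //.
  by move=> x; rewrite sqnR lerDr sqr_ge0.
rewrite (_ : f = fun x => ((complex.Re (f x))%:C)%C + Complex 0 1 * ((complex.Im (f x))%:C)%C); last first.
  by apply/funext => x; rewrite -complexE.
apply: step_approxD => //; first exact: L2funZ.
  by apply: (@step_approx_real _ r) => // x /fr ->.
apply: step_approxZ => //.
by apply: (@step_approx_real _ r) => // x /fr ->.
Qed.

End step_density_L2.

Section exhaustion.
Context dd (T : measurableType dd) (R : realType).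
Variable mu : {measure set T -> \bar R}.

Lemma integral_le_exhaust (A : nat -> set T) (u : T -> R) (M : \bar R) :
  measurable_fun setT u -> (forall x, 0 <= u x) ->
  (forall n, measurable (A n)) -> (forall m n, (m <= n)%N -> A m `<=` A n) ->
  (forall x, exists n, A n x) ->
  (forall n, \int[mu]_x (u x * \1_(A n) x)%:E <= M)%E ->
  (\int[mu]_x (u x)%:E <= M)%E.
Proof.
move=> mu_ u0 mA ndA exA hM.
pose g n x := (u x * \1_(A n) x)%:E.
have nd x : nondecreasing_seq (fun n => g n x).
  move=> m n mn; rewrite lee_fin ler_wpM2l// !indicE.
  have [xm|_] := boolP (x \in A m); last by [].
  by rewrite (_ : x \in A n)// inE; apply: (ndA _ _ mn); rewrite inE in xm.
have -> : (\int[mu]_x (u x)%:E = \int[mu]_x limn (g^~ x))%E.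
  apply: eq_integral => x _; apply/esym/cvg_lim => //.
  have [n An] := exA x; apply: cvg_near_cst; near=> k.
  rewrite /g indicE mem_set ?mulr1//; apply: (ndA n) An.
  by near: k; exact: nbhs_infty_ge.
have hc : (fun n => \int[mu]_x g n x)%E @ \oo --> (\int[mu]_x limn (g^~ x))%E.
  apply: cvg_monotone_convergence => //.
    by move=> n; apply/measurable_EFinP/measurable_funM.
  by move=> n x _; rewrite lee_fin mulr_ge0.
by apply: cvge_to_le hc _; apply: nearW => n; exact: hM.
Unshelve. all: by end_near. Qed.

End exhaustion.

(** * Plancherel for square-integrable functions of bounded support *)

Section plancherel.
Variables (R : realType) (d : nat).
Local Notation V := 'rV[R]_d.
Local Notation mu := (@lebesgue_rV R d).
Implicit Types (f g h : V -> R[i]) (a b x y z xi : V) (c : R[i]) (r : R) (A : set V).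

Lemma cindic_sqr A x : cindic A x * cindic A x = cindic A x :> R[i].
Proof.
by rewrite -{2}[cindic A x]conjc_real cindicI setIid.
Qed.

Lemma step_fun_cube f r : step_fun f -> step_fun (fun x => f x * cindic (cube r) x).
Proof.
move: f; apply: step_fun_ind => [|c a b f sf IH].
  rewrite (_ : (fun x => _) = fun=> 0); first exact: step_fun0.
  by apply/funext => x; rewrite mul0r.
pose a' : V := \row_i Num.max (a ord0 i) ((const_mx (- r) : V) ord0 i).
pose b' : V := \row_i Num.min (b ord0 i) ((const_mx r : V) ord0 i).
rewrite (_ : (fun x => _) = fun x => c * cindic (box a' b') x + f x * cindic (cube r) x).
  by apply: step_funD => //; apply: step_funZ; exact: step_fun_box.
apply/funext => x; rewrite mulrDl; congr (_ + _); rewrite -mulrA; congr (_ * _).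
by rewrite -boxI -cindicI {2}/cindic conjc_real.
Qed.

Lemma step_approx_cube f r : L2c f -> (forall x, f x = f x * cindic (cube r) x) ->
  forall e : R, 0 < e -> exists g, [/\ step_fun g,
    forall x, g x = g x * cindic (cube r) x & nrm2 mu (fun x => f x - g x) < e].
Proof.
move=> jf fr e e0; have [g sg hg] := step_approx_L2c jf e0.
exists (fun x => g x * cindic (cube r) x); split.
- exact: step_fun_cube.
- by move=> x; rewrite -mulrA cindic_sqr.
apply: le_lt_trans hg; rewrite -[leRHS]mul1r; apply: le_nrm2.
- apply/L2c_L2fun/L2cB => //; exact/step_fun_L2c/step_fun_cube.
- by apply/L2c_L2fun/L2cB => //; exact/step_fun_L2c.
move=> x; rewrite mul1r {1}fr -mulrBl sqnM sqn_cindic.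
by rewrite ler_piMr ?sqn_ge0.
Qed.

(** Square integrability of [fourier f] is not yet known. On a bounded cube, however, [fourier f] is
    uniformly close to the transform of a step function supported in [cube r], whose norm is known.
    The bound obtained does not depend on [L], so the cube can be exhausted. *)
Lemma fourier_cube_le f r L : 0 < r -> L2c f -> (forall x, f x = f x * cindic (cube r) x) ->
  (\int[mu]_x (sqn (fourier f x) * \1_(cube L) x)%:E <= (4 * nrm2 mu f + 1)%:E)%E.
Proof.
move=> r0 jf fr.
pose M := fine (mu (cube r)); pose N := fine (mu (cube L)).
have M0 : 0 <= M by rewrite fine_ge0.
have N0 : 0 <= N by rewrite fine_ge0.
(* The error is [2 * M * N * e] from the uniform approximation on the cube plus [4 * e] from
   replacing the norm of [g] by that of [f]; [e] makes the sum equal to 1. *)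
have K0 : 0 < 2 * (M * N) + 4 by rewrite ltr_wpDl// mulr_ge0// mulr_ge0.
have e0 : 0 < (2 * (M * N) + 4)^-1 by rewrite invr_gt0.
set e := (2 * (M * N) + 4)^-1 in e0.
have [g [sg gr hg]] := step_approx_cube jf fr e0.
have jg := step_fun_L2c sg; have jFg := L2fun_fourier_step sg.
have jfg := L2cB jf jg.
have fgr x : f x - g x = (f x - g x) * cindic (cube r) x by rewrite mulrBl -fr -gr.
have iL : mu.-integrable setT (EFin \o (\1_(cube L) : V -> R)).
  have [_] := L2fun_cindic (@measurable_cube R d L) (@cube_lty R d L).
  by apply: eq_integrable => // x _; rewrite /comp sqn_cindic.
pose w x := 2 * (M * e) * \1_(cube L) x + 2 * sqn (fourier g x).
have jw : mu.-integrable setT (EFin \o w).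
  by apply: rintegrableD; [exact: rintegrableZ|apply: rintegrableZ; case: jFg].
have mF := cmeasurable_fourier jf.
have mw : measurable_fun setT (fun x => sqn (fourier f x) * \1_(cube L) x).
  by apply: measurable_funM; [exact: measurable_sqn|apply: measurable_indic; exact: measurable_cube].
have fw x : sqn (fourier f x) * \1_(cube L) x <= w x.
  rewrite /w indicE; case: (x \in cube L) => /=; last first.
    by rewrite !mulr0 add0r mulr_ge0 ?sqn_ge0.
  rewrite !mulr1 (_ : fourier f x = (fourier f x - fourier g x) + fourier g x); last by ring.
  apply: le_trans (sqnD_le _ _) _; rewrite lerD2r ler_wpM2l//.
  have := sqn_fourier_le x jfg fgr; rewrite (fourierB jf jg) => /le_trans; apply.
  by rewrite ler_wpM2l// ltW.
apply: (@le_trans _ _ (\int[mu]_x (w x)%:E)%E).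
  apply: ge0_le_integral => //.
  - by move=> x _; rewrite lee_fin mulr_ge0 ?sqn_ge0.
  - exact/measurable_EFinP.
  - by case/integrableP : jw.
  - by move=> x _; rewrite lee_fin.
have : \int[mu]_x w x = 2 * (M * e) * N + 2 * nrm2 mu (fourier g).
  rewrite RintegralD//; [|exact: rintegrableZ|by apply: rintegrableZ; case: jFg].
  rewrite RintegralZl// RintegralZl//; last by case: jFg.
  by rewrite /Rintegral integral_indic ?setIT//; exact: measurable_cube.
rewrite /Rintegral => ew.
rewrite -(fineK (integrable_fin_num measurableT jw)) ew lee_fin.
rewrite (nrm2_fourier_step sg).
have : nrm2 mu g <= 2 * nrm2 mu f + 2 * e.
  rewrite (_ : g = fun x => f x + (-1) * (f x - g x)); last first.
    by apply/funext => x; ring.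
  apply: le_trans (nrm2D_le (L2c_L2fun jf) (L2funZ _ (L2c_L2fun jfg))) _.
  rewrite nrm2Z; last exact: L2c_L2fun.
  by rewrite sqnN (_ : sqn 1 = 1) ?mul1r ?lerD2l ?ler_pM2l ?(ltW hg)//
    /sqn /= expr1n expr0n addr0.
have : (2 * (M * N) + 4) * e = 1 by rewrite /e divff// lt0r_neq0.
by move: (nrm2 mu g) (nrm2 mu f) => u v; nra.
Qed.

Lemma cube_nat_exhaust (x : V) : exists n : nat, cube n%:R x.
Proof.
exists (Num.truncn (norm1 x)).+1 => i; rewrite /= in_itv/= !mxE.
have h : `|x ord0 i| < (Num.truncn (norm1 x)).+1%:R.
  apply: le_lt_trans (truncnS_gt (norm1 x)).
  by rewrite /norm1 (bigD1 i)//= lerDl sumr_ge0.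
by rewrite ltr_norml in h; case/andP: h => -> /ltW ->.
Qed.

(** The additive 1 disappears afterwards by homogeneity: it becomes negligible when [f] is
    multiplied by a large constant. *)
Lemma integral_fourier_le f : L2c f ->
  (\int[mu]_x (sqn (fourier f x))%:E <= (4 * nrm2 mu f + 1)%:E)%E.
Proof.
move=> jf; have [r r0 fr] := L2c_cube jf.
apply: (@integral_le_exhaust _ _ _ _ (fun n => cube n%:R)).
- by apply: measurable_sqn; exact: cmeasurable_fourier.
- by move=> x; exact: sqn_ge0.
- by move=> n; exact: measurable_cube.
- by move=> m n mn; apply: cubeS; rewrite ler_nat.
- exact: cube_nat_exhaust.
- by move=> n; exact: (fourier_cube_le _ r0).
Qed.

Lemma L2fun_fourier f : L2c f -> L2fun mu (fourier f).
Proof.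
move=> jf; split; first exact: cmeasurable_fourier.
apply/integrableP; split.
  by apply/measurable_EFinP/measurable_sqn; exact: cmeasurable_fourier.
rewrite (_ : (\int[mu]_x _)%E = (\int[mu]_x (sqn (fourier f x))%:E)%E); last first.
  by apply: eq_integral => x _; rewrite /= ger0_norm ?sqn_ge0.
by apply: le_lt_trans (integral_fourier_le jf) _; rewrite ltry.
Qed.

(* The constant 4 only reflects the use of [sqnD_le]; [plancherel] improves it
   to 1 by density of the step functions. *)
Lemma nrm2_fourier_le f : L2c f -> nrm2 mu (fourier f) <= 4 * nrm2 mu f.
Proof.
have h g : L2c g -> nrm2 mu (fourier g) <= 4 * nrm2 mu g + 1.
  move=> jg; have := integral_fourier_le jg; have [_ ji] := L2fun_fourier jg.
  by rewrite -(fineK (integrable_fin_num measurableT ji)) lee_fin.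
move=> jf; apply/ler_addgt0Pr => e e0.
have s0 : 0 < Num.sqrt e^-1 by rewrite sqrtr_gt0 invr_gt0.
have := h _ (L2cZ ((Num.sqrt e^-1)%:C)%C jf).
rewrite (fourierZ _ jf) (nrm2Z _ (L2fun_fourier jf)) (nrm2Z _ (L2c_L2fun jf)).
rewrite sqnR sqr_sqrtr ?invr_ge0 ?(ltW e0)//.
move=> H; have se : e * e^-1 = 1 by rewrite divff ?gt_eqF.
apply: (@le_trans _ _ (e * (4 * (e^-1 * nrm2 mu f) + 1))).
  rewrite (_ : nrm2 mu (fourier f) = e * (e^-1 * nrm2 mu (fourier f))) ?ler_pM2l//.
  by rewrite mulrA se mul1r.
rewrite (_ : e * _ = 4 * nrm2 mu f * (e * e^-1) + e); last by ring.
by rewrite se mulr1.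
Qed.

(** The constant is [34 = 2 * 4 ^ 2 + 2]: a factor 4 for each transform, then [sqnD_le]. *)
Lemma sqn_inner_fourier_le f g : L2c f -> L2c g ->
  sqn (inner mu (fourier f) (fourier g) - inner mu f g) <= 34 * (nrm2 mu f * nrm2 mu g).
Proof.
move=> jf jg; apply: le_trans (sqnD_le _ _) _; rewrite sqnN.
have h1 := sqn_inner_le (L2fun_fourier jf) (L2fun_fourier jg).
have h2 := sqn_inner_le (L2c_L2fun jf) (L2c_L2fun jg).
have h3 : nrm2 mu (fourier f) * nrm2 mu (fourier g) <= (4 * nrm2 mu f) * (4 * nrm2 mu g).
  by apply: ler_pM; rewrite ?nrm2_ge0 ?nrm2_fourier_le.
rewrite (_ : 34 * (nrm2 mu f * nrm2 mu g) =
  2 * (4 * nrm2 mu f * (4 * nrm2 mu g)) + 2 * (nrm2 mu f * nrm2 mu g)); last by ring.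
by rewrite lerD// ler_pM2l// (le_trans h1).
Qed.

(** The difference of the two sides is a bounded sesquilinear form that vanishes on step functions,
    so density concludes. *)
Theorem plancherel f g : L2c f -> L2c g ->
  inner mu (fourier f) (fourier g) = inner mu f g.
Proof.
move=> jf jg; apply/eqP; rewrite -subr_eq0; apply/eqP/sqn_eq0/eqP.
rewrite eq_le sqn_ge0 andbT; apply/ler_addgt0Pr => t t0; rewrite add0r.
pose M := nrm2 mu f + nrm2 mu g + 1.
have F0 := nrm2_ge0 mu f; have G0 := nrm2_ge0 mu g.
have M1 : 1 <= M by rewrite /M lerDr addr_ge0.
have M0 : 0 < M by rewrite (lt_le_trans _ M1).
have gM : nrm2 mu g <= M by rewrite /M addrAC lerDr addr_ge0.
(* The two error terms contribute at most [2 * 34 * M * e] and [2 * 34 * 2 * M * e], in total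
   [204 * M * e]; 340 leaves room. *)
pose e := Num.min 1 (t / (340 * M)).
have K0 : 0 < 340 * M by apply: mulr_gt0 M0; rewrite ltr0n.
have e0 : 0 < e by rewrite lt_min ltr01 /=; exact: divr_gt0 t0 K0.
have e1 : e <= 1 by rewrite ge_min lexx.
have et : 340 * M * e <= t.
  by rewrite mulrC -(ler_pdivlMr _ _ K0) ge_min lexx orbT.
have [u su hu] := step_approx_L2c jf e0; have [v sv hv] := step_approx_L2c jg e0.
have ju := step_fun_L2c su; have jv := step_fun_L2c sv.
have jfu := L2cB jf ju; have jgv := L2cB jg jv.
have kf := L2c_L2fun jf; have kg := L2c_L2fun jg.
have ku := L2c_L2fun ju; have kv := L2c_L2fun jv.
have kfu := L2c_L2fun jfu; have kgv := L2c_L2fun jgv.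
have b1 := sqn_inner_fourier_le jfu jg; have b2 := sqn_inner_fourier_le ju jgv.
have uM : 2 * nrm2 mu f + 2 * e <= 2 * M.
  by rewrite -mulrDr ler_pM2l// /M -addrA lerD2l (le_trans e1)// lerDr.
have nu : nrm2 mu u <= 2 * nrm2 mu f + 2 * e.
  rewrite {1}(_ : u = fun x => f x + (-1) * (f x - u x)); last first.
    by apply/funext => x; ring.
  apply: le_trans (nrm2D_le kf (L2funZ _ kfu)) _.
  rewrite nrm2Z// sqnN (_ : sqn 1 = 1) ?mul1r ?lerD2l ?ler_pM2l ?(ltW hu)//.
  by rewrite /sqn /= expr1n expr0n addr0.
have -> : inner mu (fourier f) (fourier g) - inner mu f g =
    (inner mu (fourier (fun x => f x - u x)) (fourier g) - inner mu (fun x => f x - u x) g) +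
    (inner mu (fourier u) (fourier (fun x => g x - v x)) - inner mu u (fun x => g x - v x)).
  have Fu := L2fun_fourier ju; have Fv := L2fun_fourier jv.
  have Ff := L2fun_fourier jf; have Fg := L2fun_fourier jg.
  rewrite (fourierB jf ju) (fourierB jg jv) (innerBl Ff Fu Fg) (innerBl kf ku kg).
  rewrite (innerBr Fg Fv Fu) (innerBr kg kv ku) (inner_fourier_step su sv).
  move: (inner mu (fourier f) (fourier g)) (inner mu (fourier u) (fourier g)).
  by move: (inner mu f g) (inner mu u g) (inner mu u v) => *; ring.
apply: le_trans (sqnD_le _ _) _.
have p1 : nrm2 mu (fun x => f x - u x) * nrm2 mu g <= e * M.
  by apply: ler_pM; rewrite ?nrm2_ge0 ?(ltW hu)//; exact: gM.
have p2 : nrm2 mu u * nrm2 mu (fun x => g x - v x) <= (2 * M) * e.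
  by apply: ler_pM; rewrite ?nrm2_ge0 ?(ltW hv)//; exact: le_trans nu uM.
apply: le_trans et.
have -> : 340 * M * e = 340 * (M * e) by ring.
have Me : 0 <= M * e by rewrite mulr_ge0// ltW.
move: b1 b2 p1 p2 Me; rewrite (mulrC e) -(mulrA 2).
move: (M * e) (sqn (_ - _)) (sqn (_ - _)) (nrm2 _ _ * nrm2 _ _) (nrm2 _ _ * nrm2 _ _) => p1' p2' p3' p4' p5'.
by clear => *; lra.
Qed.

Corollary nrm2_fourier f : L2c f -> nrm2 mu (fourier f) = nrm2 mu f.
Proof. by move=> jf; apply: complexI; rewrite -!inner_nrm2 plancherel. Qed.

End plancherel.

(** * Translates of D *)

Section packing.
Variables (R : realType) (d : nat).
Local Notation V := 'rV[R]_d.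
Local Notation mu := (@lebesgue_rV R d).
Implicit Types (f g h F : V -> R[i]) (a b x y z xi l m : V) (D Lambda : set V).

Definition is_packing D Lambda := forall l m x, Lambda l -> Lambda m ->
  D (x - l) -> D (x - m) -> l = m.

Definition covered D Lambda : set V := [set x | exists2 l, Lambda l & D (x - l)].

Lemma box_measure_gt0 a b : (forall i, a ord0 i < b ord0 i) -> (0 < mu (box a b))%E.
Proof.
move=> ab; rewrite boxE lte_fin; apply: prodr_gt0 => i _.
by rewrite lt_max subr_gt0 ab orbT.
Qed.

Lemma open_box D x : open D -> D x -> exists2 e : R, 0 < e &
  forall y, (forall i, `|x ord0 i - y ord0 i| < e) -> D y.
Proof.
move=> oD Dx; have /nbhs_ballP[e /= e0 xeD] : nbhs x D by exact: open_nbhs_nbhs.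
exists e => // y h; apply: xeD; split=> // i j; rewrite (ord1 i); exact: h.
Qed.

Lemma open_measure_gt0 D x : open D -> D x -> (0 < mu D)%E.
Proof.
move=> oD Dx; have [e e0 h] := open_box oD Dx.
pose c : V := const_mx (e / 2).
have cE i : c ord0 i = e / 2 by rewrite mxE.
apply: (@lt_le_trans _ _ (mu (box (x - c) (x + c)))).
  by apply: box_measure_gt0 => i; rewrite !mxE ltrD2l; lra.
apply: le_measure; rewrite ?inE; [exact: measurable_box|exact: open_measurable_rV|].
move=> y yb; apply: h => i; have := yb i; rewrite /= in_itv/= !mxE => /andP[h1 h2].
by rewrite ltr_norml; apply/andP; split; lra.
Qed.

Lemma open_shift D l : open D -> open [set x | D (x - l)].
Proof.
move=> oD; rewrite openE => x /= Dx; have [e e0 h] := open_box oD Dx.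
apply/nbhs_ballP; exists e => //= y [_ xy]; apply: h => i; rewrite !mxE.
by have := xy ord0 i; rewrite /ball/= opprB addrA subrK.
Qed.

(** Every translate of the open set contains a rational point, and disjoint translates contain
    different ones. *)
Lemma is_packing_countable D Lambda x0 : open D -> D x0 -> is_packing D Lambda ->
  countable Lambda.
Proof.
move=> oD D0 pD; have [e e0 h] := open_box oD D0.
have qex (l : V) i : exists q : rat, `|x0 ord0 i - (ratr q - l ord0 i)| < e.
  have : x0 ord0 i + l ord0 i < x0 ord0 i + l ord0 i + e by rewrite ltrDl.
  move=> /rat_in_itvoo[q]; rewrite in_itv/= => /andP[q1 q2]; exists q.
  by rewrite ltr_norml; apply/andP; split; lra.
pose q (l : V) : 'rV[rat]_d := \row_i sval (cid (qex l i)).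
apply/countable_injP.
exists (fun l => pickle (q l)) => l m; rewrite !inE => Ll Lm e0'.
have e1 : q l = q m by exact: (pcan_inj pickleK e0').
have Dq (k : V) : D (map_mx (@ratr R) (q k) - k).
  by apply: h => i; rewrite !mxE; case: (cid (qex k i)).
by apply: (pD l m (map_mx (@ratr R) (q l))) => //; rewrite e1.
Qed.

(** Sums over [Lambda] are treated as limits along such increasing finite lists. *)
Lemma countable_enum Lambda : countable Lambda -> exists s : nat -> seq V,
  [/\ forall n, uniq (s n), forall n l, l \in s n -> Lambda l,
      forall i j : nat, (i <= j)%N -> {subset s i <= s j} &
      forall l, Lambda l -> exists n, l \in s n].
Proof.
move=> /countable_injP[f injf].
pose e n : option V := if pselect (exists2 l, Lambda l & f l = n) is left h
  then Some (sval (cid2 h)) else None.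
have eP n l : e n = Some l -> Lambda l /\ f l = n.
  by rewrite /e; case: pselect => // h [<-]; case: (cid2 h).
have eL l : Lambda l -> e (f l) = Some l.
  move=> Ll; rewrite /e; case: pselect => [h|]; last by case; exists l.
  congr Some; case: (cid2 h) => k /= Lk fk.
  by apply: injf; rewrite ?inE.
exists (fun n => undup (pmap e (iota 0 n))); split.
- by move=> n; exact: undup_uniq.
- by move=> n l; rewrite mem_undup mem_pmap => /mapP[k _ /esym/eP[]].
- move=> m n mn l; rewrite !mem_undup !mem_pmap => /mapP[k km kl].
  by apply/mapP; exists k => //; move: km; rewrite !mem_iota !add0n => /leq_trans; apply.
- move=> l Ll; exists (f l).+1; rewrite mem_undup mem_pmap.
  by apply/mapP; exists (f l); rewrite ?mem_iota ?add0n ?ltnS ?leqnn// eL.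
Qed.

Definition overlap D (s : seq V) : V -> R[i] := fun x => \sum_(l <- s) cindic D (x - l).

Lemma overlap1 D Lambda (s : seq V) x l : is_packing D Lambda -> uniq s ->
  (forall k, k \in s -> Lambda k) -> l \in s -> D (x - l) -> overlap D s x = 1.
Proof.
move=> pD us sL ls Dl; rewrite /overlap (bigD1_seq l)//= big1_seq ?addr0.
  by rewrite /cindic indicE mem_set.
move=> k /andP[kl ks]; rewrite /cindic indicE memNset// => Dk.
by move/eqP: kl; apply; apply: (pD _ _ x) => //; exact: sL.
Qed.

Lemma overlap0 D (s : seq V) x : (forall l, l \in s -> ~ D (x - l)) -> overlap D s x = 0.
Proof.
move=> h; rewrite /overlap big1_seq// => l /andP[_ ls].
by rewrite /cindic indicE memNset//; exact: h.
Qed.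

Lemma cintegrable_shift F l : cintegrable mu F -> cintegrable mu (fun x => F (x + l)).
Proof.
move=> jF; have [mr mi] := cintegrable_measurable jF.
have mF : cmeasurable (fun x => F (x + l)).
  by split; [exact: (measurableT_comp mr (measurable_shift_rV l))|
    exact: (measurableT_comp mi (measurable_shift_rV l))].
apply: (cintegrable_image (measurable_shift_rV (- l)) (fun A => @lebesgue_rV_shift R d (- l) A)) => //.
by rewrite (_ : _ \o _ = F)//; apply/funext => x /=; rewrite subrK.
Qed.

Lemma cint_shift F l : cintegrable mu F -> cint mu (fun x => F (x + l)) = cint mu F.
Proof.
move=> jF; apply/esym.
apply: (cint_image (measurable_shift_rV l) (fun A => @lebesgue_rV_shift R d l A)).
  exact: (cintegrable_measurable jF).
exact: cintegrable_shift.
Qed.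

Lemma cintegrableM_cindic F A : measurable A -> cintegrable mu F ->
  cintegrable mu (fun x => cindic A x * F x).
Proof.
move=> mA jF; have [jr ji] := jF.
have [mr mi] : cmeasurable (fun x => cindic A x * F x).
  by apply: cmeasurableM; [exact: cmeasurable_cindic|exact: (cintegrable_measurable jF)].
have le (u v : R) x : `|(\1_A x : R) * u - 0 * v| <= `|u|.
  by rewrite mul0r subr0 normrM ger0_norm// ler_piMl.
have le' (u v : R) x : `|(\1_A x : R) * u + 0 * v| <= `|u|.
  by rewrite mul0r addr0 normrM ger0_norm// ler_piMl.
split.
  apply: le_rintegrable (integrable_norm jr) _ => // x; rewrite /cindic /=.
  by case: (F x) => u v; exact: le.
apply: le_rintegrable (integrable_norm ji) _ => // x; rewrite /cindic /=.
by case: (F x) => u v; exact: le'.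
Qed.

(** Unfolding: translating the term of index [l] by [l] moves the sum from [F] to the indicators of
    the translates of [D]. Both directions of the theorem average over [D] through this identity. *)
Lemma cint_overlap D (s : seq V) F : measurable D -> cintegrable mu F ->
  cint mu (fun y => cindic D y * \sum_(l <- s) F (y + l)) =
  cint mu (fun z => overlap D s z * F z).
Proof.
move=> mD jF.
have mDl l : measurable [set x | D (x - l)].
  rewrite -[X in measurable X]setTI.
  exact: (measurable_shift_rV (- l) measurableT mD).
have e l x : cindic D (x - l) = cindic [set x | D (x - l)] x.
  by rewrite /cindic !indicE; congr (_ %:C)%C; congr (_ %:R); apply/idP/idP; rewrite !inE.
have jl l : cintegrable mu (fun z => cindic D (z - l) * F z).
  rewrite (_ : (fun z => _) = fun z => cindic [set x | D (x - l)] z * F z).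
    exact: cintegrableM_cindic.
  by apply/funext => z; rewrite e.
rewrite (_ : (fun y => _) = fun y => \sum_(l <- s) cindic D y * F (y + l)); last first.
  by apply/funext => y; rewrite mulr_sumr.
have -> : (fun z => overlap D s z * F z) = fun z => \sum_(l <- s) cindic D (z - l) * F z.
  by apply/funext => z; rewrite /overlap mulr_suml.
rewrite !cint_sum//; last first.
  by move=> l; apply: cintegrableM_cindic => //; exact: cintegrable_shift.
apply: eq_bigr => l _; rewrite -(cint_shift l (jl l)).
by congr cint; apply/funext => y; rewrite addrK.
Qed.

End packing.

(** * Tilings by an open set *)

Section tiling_packing.
Variables (R : realType) (d : nat).
Local Notation V := 'rV[R]_d.
Local Notation mu := (@lebesgue_rV R d).
Implicit Types (x y z l m : V) (D Lambda : set V).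

Lemma esum_extract (T : choiceType) (A : set T) (a : T -> \bar R) i : A i ->
  (forall j, (0 <= a j)%E) ->
  (\esum_(j in A) a j = a i + \esum_(j in A `\` [set i]) a j)%E.
Proof.
move=> Ai a0; rewrite (esumID [set i])//; congr (_ + _)%E.
by rewrite setIC setIidl ?esum_set1//= => j ->.
Qed.

(** Openness turns an almost everywhere statement into one that holds everywhere: two translates
    that meet do so in a nonempty open set, which has positive measure, and there the sum is at
    least 2. *)
Lemma tiling_packing D Lambda : open D -> tiling D Lambda -> is_packing D Lambda.
Proof.
move=> oD [N [mN N0 PN]] l m x Ll Lm Dl Dm; apply/eqP; apply/negP => /negP lm.
pose U := [set x | D (x - l)] `&` [set x | D (x - m)].
have oU : open U by apply: openI; exact: open_shift.
have := @open_measure_gt0 R d U x oU (conj Dl Dm); rewrite ltNge => /negP; apply.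
rewrite -N0; apply: (@le_measure _ _ _ mu); rewrite ?inE//.
  exact: open_measurable_rV.
move=> y [/= yl ym]; apply: PN => /=.
rewrite (@esum_extract _ _ _ l)//.
rewrite (@esum_extract _ (Lambda `\` [set l]) _ m)//; last first.
  by split => //= ml; rewrite ml eqxx in lm.
rewrite !indicE !mem_set// => h.
have : (0 <= \esum_(j in (Lambda `\` [set l]) `\` [set m]) (\1_D (y - j) : R)%:E)%E.
  by apply: esum_ge0 => j _; rewrite lee_fin.
move: h; set e := esum _ _; case: e => [r| |] //= [h1].
by rewrite lee_fin => h2; clear - h1 h2; have := congr1 (fun t : R => t - 1) h1; lra.
Qed.

Lemma esum_covered D Lambda x : is_packing D Lambda -> covered D Lambda x ->
  (\esum_(l in Lambda) (\1_D (x - l) : R)%:E = 1)%E.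
Proof.
move=> pD [l Ll Dl]; rewrite (@esum_extract _ _ _ l)//.
rewrite indicE mem_set//= esum1 ?adde0// => m [Lm /= ml].
by rewrite indicE memNset// => Dm; apply: ml; apply: (pD _ _ x).
Qed.

Lemma esum_uncovered D Lambda x : ~ covered D Lambda x ->
  (\esum_(l in Lambda) (\1_D (x - l) : R)%:E = 0)%E.
Proof.
move=> nc; apply: esum1 => m Lm; rewrite indicE memNset// => Dm.
by apply: nc; exists m.
Qed.

Lemma tilingP D Lambda : is_packing D Lambda ->
  tiling D Lambda <-> mu.-negligible (~` covered D Lambda).
Proof.
move=> pD; suff -> : tiling D Lambda = mu.-negligible (~` covered D Lambda) by [].
rewrite /tiling; congr negligible; apply/seteqP; split=> x /= h c; apply: h.
  exact: esum_covered.
apply: contrapT => /esum_uncovered e; move: c; rewrite e => /eqP.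
by rewrite eqe eq_sym oner_eq0.
Qed.

Lemma measurable_covered D Lambda : open D -> measurable (covered D Lambda).
Proof.
move=> oD; apply: open_measurable_rV.
rewrite (_ : covered D Lambda = \bigcup_(l in Lambda) [set x | D (x - l)]).
  by apply: bigcup_open => l _; exact: open_shift.
by apply/seteqP; split=> x [l Ll Dl]; exists l.
Qed.

End tiling_packing.

(** * Extension by zero and the spaces L^2(Omega) *)

Section restriction.
Variables (R : realType) (d : nat).
Local Notation V := 'rV[R]_d.
Local Notation mu := (@lebesgue_rV R d).
Implicit Types (f g h : V -> R[i]) (x y z l m : V) (A Omega D Lambda : set V).

(** Extending by 0 turns inner products on [A] into integrals over R^d, where transforms and
    Plancherel's identity apply. *)
Definition restr A f : V -> R[i] := fun x => cindic A x * f x.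

Lemma cindicT A x : A x -> cindic A x = 1.
Proof. by move=> Ax; rewrite /cindic indicE mem_set. Qed.

Lemma cindicF A x : ~ A x -> cindic A x = 0.
Proof. by move=> Ax; rewrite /cindic indicE memNset. Qed.

Lemma cindicP A x : A x /\ cindic A x = 1 \/ ~ A x /\ cindic A x = 0.
Proof.
by have [h|h] := pselect (A x); [left|right]; split=> //;
  [exact: cindicT|exact: cindicF].
Qed.

Lemma bounded_cube A : bounded_set A -> exists2 r : R, 0 < r & A `<=` cube r.
Proof.
move=> [M [_ hM]]; pose r := `|M| + 2.
have r0 : 0 < r by rewrite /r; have := normr_ge0 M; lra.
exists r => // x Ax i; rewrite /= !mxE in_itv/=.
have Mr : M < `|M| + 1 by have := ler_norm M; lra.
have := hM _ Mr x Ax => /= xM.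
have [_ /(_ ord0 i)] : ball (0 : V) r x.
  rewrite -ball_normE /ball_ /= sub0r normrN; apply: (le_lt_trans xM); rewrite /r; lra.
rewrite /ball/= !mxE sub0r normrN => h.
move: h; rewrite ltr_norml => /andP[h1 h2]; lra.
Qed.

Lemma restr_patch Omega f : (fun x => complex.Re (restr Omega f x)) =
    (fun x => complex.Re (f x)) \_ Omega /\
  (fun x => complex.Im (restr Omega f x)) = (fun x => complex.Im (f x)) \_ Omega.
Proof.
split; apply/funext => x; rewrite /restr patchE; have [[Ax ->]|[Ax ->]] := cindicP Omega x;
  by [rewrite mem_set// mul1r|rewrite memNset// mul0r].
Qed.

Lemma L2norm_sqr Omega f :
  (L2norm Omega f `^ 2 = \int[mu]_x (sqn (restr Omega f x))%:E)%E.
Proof.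
rewrite /L2norm poweR_Lnorm//; apply: eq_integral => x _; rewrite patchE /restr.
have [[Ax ->]|[Ax ->]] := cindicP Omega x.
  rewrite mem_set// mul1r sqn_normc abse_EFin poweR_EFin powR_mulrn//.
  by rewrite ger0_norm//; case: (f x) => u v /=; exact: sqrtr_ge0.
by rewrite memNset// mul0r sqn0 abse0 poweR0r.
Qed.

Lemma L2_restr Omega f : measurable Omega -> L2 Omega f <-> L2fun mu (restr Omega f).
Proof.
move=> mO; have [re im] := restr_patch Omega f.
have mm : measurable_fun Omega (fun x => complex.Re (f x)) /\
    measurable_fun Omega (fun x => complex.Im (f x)) <->
    cmeasurable (restr Omega f).
  by rewrite /cmeasurable re im; split=> -[? ?]; split; apply/(measurable_restrictT _ mO).
have fin : cmeasurable (restr Omega f) ->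
    (L2norm Omega f < +oo)%E <-> mu.-integrable setT (EFin \o (fun x => sqn (restr Omega f x))).
  move=> mf; have e : (\int[mu]_x `|(EFin \o (fun x => sqn (restr Omega f x))) x| =
      L2norm Omega f `^ 2)%E.
    by rewrite L2norm_sqr; apply: eq_integral => x _ /=; rewrite ger0_norm// sqn_ge0.
  split=> [h|/integrableP[_]].
    apply/integrableP; split; first exact/measurable_EFinP/measurable_sqn.
    by rewrite e; exact: poweR_lty.
  by rewrite e => /lty_poweRy; apply.
split=> [[mr mi f2]|[mf jf]].
  by have mf := mm.1 (conj mr mi); split=> //; exact/(fin mf).
by have [? ?] := mm.2 mf; split=> //; exact/(fin mf).
Qed.

Lemma L2norm_lt Omega f (e : R) : L2fun mu (restr Omega f) -> 0 < e ->
  (L2norm Omega f < e%:E)%E = (nrm2 mu (restr Omega f) < e ^+ 2).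
Proof.
move=> [mf jf] e0; have := L2norm_sqr Omega f.
have -> : (\int[mu]_x (sqn (restr Omega f x))%:E = (nrm2 mu (restr Omega f))%:E)%E.
  rewrite /nrm2 /Rintegral fineK//; exact: integrable_fin_num.
have : (0 <= L2norm Omega f)%E by exact: Lnorm_ge0.
case: (L2norm Omega f) => [r| |]//; last by rewrite poweRyr.
rewrite lee_fin => r0; rewrite poweR_EFin powR_mulrn// => -[<-].
by rewrite lte_fin ltr_pXn2r// nnegrE ltW.
Qed.

End restriction.

(** * Finite orthonormal families *)

Section orthonormal.
Context dd (T : measurableType dd) (R : realType).
Variable mu : {measure set T -> \bar R}.
Implicit Types (f g h : T -> R[i]) (a b : T -> R) (c : R[i]).
Local Notation rintegrable a := (mu.-integrable [set: T] (EFin \o a)).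

Lemma Rintegral_dominated0 (a_ : nat -> T -> R) b :
  (forall n, measurable_fun setT (a_ n)) -> rintegrable b ->
  {ae mu, forall x, forall e, 0 < e -> \forall n \near \oo, `|a_ n x| < e} ->
  (forall n x, `|a_ n x| <= b x) ->
  forall e, 0 < e -> \forall n \near \oo, `|\int[mu]_x a_ n x| < e.
Proof.
move=> ma jb a0 ab.
have [||||_ _ h] := @dominated_convergence _ T R mu setT measurableT
  (fun n x => (a_ n x)%:E) (fun=> 0%E) (fun x => (b x)%:E) _ _ _ jb _.
- by move=> n; apply/measurable_EFinP.
- exact: measurable_cst.
- apply: filterS a0 => x ax _; apply: cvg_EFin; first by near=> n.
  apply/cvgrPdist_lt => e e0; near=> n.
  rewrite /= sub0r normrN.
  by near: n; exact: ax.
- by apply: aeW => x n _ /=; rewrite lee_fin.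
rewrite integral0 in h => e e0.
move/fine_cvg: h => /cvgrPdist_lt/(_ e e0).
by apply: filterS => n /=; rewrite sub0r normrN.
Unshelve. all: by end_near. Qed.

Lemma nrm2B f g : L2fun mu f -> L2fun mu g ->
  nrm2 mu (fun x => f x - g x) =
  nrm2 mu f - 2 * complex.Re (inner mu f g) + nrm2 mu g.
Proof.
move=> jf jg; have jB := L2funB jf jg.
have := inner_nrm2 mu (fun x => f x - g x).
rewrite innerBl// !innerBr// (innerC jf jg) !inner_nrm2.
case: (inner mu f g) => u v /(congr1 (@complex.Re R)) /= <-; ring.
Qed.

(** Completing the square. The coefficients are left arbitrary: the choice [c i = inner mu f (E i)]
    gives Bessel's inequality, while an arbitrary good approximant gives a lower bound for the sum
    of squared coefficients. *)
Lemma nrm2_orthonormal (I : eqType) (E : I -> T -> R[i]) (s : seq I) f (c : I -> R[i]) :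
  uniq s -> (forall i, L2fun mu (E i)) -> L2fun mu f ->
  {in s &, forall i j, inner mu (E i) (E j) = (i == j)%:R} ->
  nrm2 mu (fun x => f x - \sum_(i <- s) c i * E i x) =
  nrm2 mu f - \sum_(i <- s) sqn (inner mu f (E i)) +
  \sum_(i <- s) sqn (c i - inner mu f (E i)).
Proof.
move=> + jE jf; elim: s => [_ _|k s IH /= /andP[ks us] oE].
  rewrite !big_nil subr0 addr0; congr nrm2; apply/funext => x.
  by rewrite big_nil subr0.
have jS i : L2fun mu (fun x => c i * E i x) by exact: L2funZ.
have jg : L2fun mu (fun x => f x - \sum_(i <- s) c i * E i x).
  by apply: L2funB => //; exact: L2fun_sum.
have {}IH : nrm2 mu (fun x => f x - \sum_(i <- s) c i * E i x) =
    nrm2 mu f - \sum_(i <- s) sqn (inner mu f (E i)) +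
    \sum_(i <- s) sqn (c i - inner mu f (E i)).
  by apply: IH => // i j si sj; apply: oE; rewrite inE ?si ?sj orbT.
rewrite (_ : (fun x => _) = fun x => (f x - \sum_(i <- s) c i * E i x) - c k * E k x); last first.
  by apply/funext => x; rewrite big_cons; ring.
rewrite nrm2B// IH !big_cons nrm2Z// innerZr// innerBl//; last exact: L2fun_sum.
have -> : inner mu (fun x => \sum_(i <- s) c i * E i x) (E k) = 0.
  rewrite /inner (_ : (fun x => _) = fun x => \sum_(i <- s) c i * (E i x * conjc (E k x))).
    rewrite cint_sum; last by move=> i; apply/cintegrableZ/cintegrable_inner.
    rewrite big1_seq// => i /andP[_ si]; rewrite cintZ; last exact: cintegrable_inner.
    rewrite [cint _ _]oE ?inE ?eqxx ?si ?orbT//.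
    by case: eqP => [ik|_]; [rewrite ik (negPf ks) in si|rewrite mulr0].
  by apply/funext => x; rewrite mulr_suml; apply: eq_bigr => i _; rewrite mulrA.
have nE : nrm2 mu (E k) = 1.
  have := inner_nrm2 mu (E k); rewrite oE ?inE ?eqxx//.
  by move/(congr1 (@complex.Re R)).
rewrite nE subr0 mulr1.
have -> (z w : R[i]) : complex.Re (conjc z * w) = (sqn z + sqn w - sqn (z - w)) / 2.
  by case: z w => ? ? [? ?]; rewrite /sqn /=; field.
move: (nrm2 mu f) (sqn (c k)) (sqn (inner _ _ _)) (sqn (c k - _)) => A B C D'.
move: (\sum_(_ <- _) _) (\sum_(_ <- _) _) => S1 S2.
by field.
Qed.

Lemma bessel (I : eqType) (E : I -> T -> R[i]) (s : seq I) f :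
  uniq s -> (forall i, L2fun mu (E i)) -> L2fun mu f ->
  {in s &, forall i j, inner mu (E i) (E j) = (i == j)%:R} ->
  \sum_(i <- s) sqn (inner mu f (E i)) <= nrm2 mu f.
Proof.
move=> us jE jf oE; rewrite -subr_ge0.
have := nrm2_orthonormal (fun i => inner mu f (E i)) us jE jf oE.
rewrite [X in _ + X]big1 ?addr0 => [<-|i _]; first exact: nrm2_ge0.
by rewrite subrr sqn0.
Qed.

End orthonormal.

(** * Exponentials on Omega *)

Section exponentials.
Variables (R : realType) (d : nat).
Local Notation V := 'rV[R]_d.
Local Notation mu := (@lebesgue_rV R d).
Implicit Types (f g h : V -> R[i]) (x y z l m : V) (A Omega D Lambda : set V).

Definition unit_region A :=
  [/\ measurable A, exists r, A `<=` cube r & mu A = 1%E].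

Definition expo Omega l := restr Omega (cexp l).

Lemma expoE Omega l : expo Omega l = modulate (- l) (cindic Omega).
Proof.
by apply/funext => x; rewrite /expo /restr /modulate /cexp dotpNl mulrN opprK.
Qed.

Lemma restrB_sum Omega (t : seq V) (c : V -> R[i]) f :
  restr Omega (fun x => f x - \sum_(l <- t) c l * cexp l x) =
  fun x => restr Omega f x - \sum_(l <- t) c l * expo Omega l x.
Proof.
apply/funext => x; rewrite /restr mulrBr mulr_sumr; congr (_ - _).
by apply: eq_bigr => l _; rewrite mulrCA.
Qed.

Lemma L2c_restr A f : unit_region A -> L2fun mu (restr A f) -> L2c (restr A f).
Proof.
move=> [mA [r Ar] _] jf; split=> //; exists r => x xr; rewrite /restr cindicF ?mul0r//.
by move=> /Ar.
Qed.

Lemma L2c_cindic A : unit_region A -> L2c (cindic A).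
Proof.
move=> [mA [r Ar] A1]; split; first by apply: L2fun_cindic => //; rewrite A1 ltry.
by exists r => x xr; rewrite cindicF// => /Ar.
Qed.

Lemma L2c_expo A l : unit_region A -> L2c (expo A l).
Proof. by move=> uA; rewrite expoE; apply: L2c_modulate; exact: L2c_cindic. Qed.

Lemma nrm2_unit A : unit_region A -> nrm2 mu (cindic A) = 1.
Proof. by move=> [mA _ A1]; rewrite nrm2_cindic// A1. Qed.

Lemma fourier_cindic0 A : unit_region A -> fourier (cindic A) 0 = 1.
Proof.
move=> uA; rewrite fourierE modulate0 cint_cindic; case: uA => // mA _ A1.
by rewrite A1.
Qed.

Lemma cindicJ A x : conjc (cindic A x) = cindic A x.
Proof. by rewrite /cindic conjc_real. Qed.

Lemma conjcM (z w : R[i]) : conjc (z * w) = conjc z * conjc w.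
Proof. exact: rmorphM. Qed.

Lemma inner_expo A f l : inner mu (restr A f) (expo A l) = fourier (restr A f) l.
Proof.
rewrite fourierE; congr cint; apply/funext => x.
rewrite /expo /modulate [restr A (cexp l) x]/restr conjcM cindicJ /cexp cisN mulrA.
by congr (_ * _); rewrite /restr mulrAC cindic_sqr.
Qed.

Lemma inner_expo2 A l m : inner mu (expo A l) (expo A m) = fourier (cindic A) (m - l).
Proof. by rewrite inner_expo -/(expo A l) expoE fourier_modulate. Qed.

Lemma cintegral_restr A f : measurable A -> cintegral A f = cint mu (restr A f).
Proof.
move=> mA; have [re im] := restr_patch A f.
by rewrite /cintegral Rintegral_mkcond -re [X in Complex _ X]Rintegral_mkcond -im.
Qed.

Lemma L2inner_expo A l m : measurable A ->
  L2inner A (cexp l) (cexp m) = inner mu (expo A l) (expo A m).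
Proof.
move=> mA; rewrite /L2inner cintegral_restr//; congr cint; apply/funext => x.
rewrite /expo /restr conjcM cindicJ mulrACA cindic_sqr.
by [].
Qed.

Lemma indic_cindic A : (\1_A : V -> R[i]) = cindic A.
Proof. by apply/funext => x; rewrite /cindic !indicE; case: (x \in A). Qed.

(** A common point [x] of [D + l] and [D + m] gives [m - l = (x - l) - (x - m)] in [D - D], whereas
    orthogonality puts [m - l] in the zero set of the transform of the indicator of [Omega]. *)
Lemma orthogonal_packing Omega D Lambda : unit_region Omega ->
  orthogonal_packing_region Omega D ->
  {in Lambda &, forall l m, inner mu (expo Omega l) (expo Omega m) = (l == m)%:R} ->
  is_packing D Lambda.
Proof.
move=> uO [_ _ _ D0] oL l m x Ll Lm Dl Dm; apply/eqP; apply/negPn/negP => lm.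
suff : (diff_set D `&` zero_set (fourier \1_Omega)) (m - l) by rewrite D0.
split; last first.
  by rewrite /zero_set/= indic_cindic -inner_expo2 oL ?inE// (negPf lm).
by exists (x - l) => //; exists (x - m) => //; rewrite opprB addrC addrA subrK.
Qed.

End exponentials.

(** * From spectra to tilings *)

Section spectrum_tiling.
Variables (R : realType) (d : nat).
Local Notation V := 'rV[R]_d.
Local Notation mu := (@lebesgue_rV R d).
Implicit Types (f g h : V -> R[i]) (x y z l m : V) (A Omega D Lambda : set V).

Definition exhausts Lambda (s : nat -> seq V) :=
  [/\ forall n, uniq (s n), forall n l, l \in s n -> Lambda l,
      forall i j : nat, (i <= j)%N -> {subset s i <= s j} &
      forall l, Lambda l -> exists n, l \in s n].

Lemma exhausts_near Lambda s (t : seq V) : exhausts Lambda s ->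
  (forall l, l \in t -> Lambda l) -> \forall n \near \oo, {subset t <= s n}.
Proof.
move=> [_ _ ms exs]; elim: t => [|l t IH] tL; first by near=> n.
have [|N _ hN] := IH; first by move=> k kt; apply: tL; rewrite inE kt orbT.
have [N' lN'] := exs l (tL l (mem_head l t)).
exists (maxn N N') => // n /=; rewrite geq_max => /andP[Nn N'n] k.
rewrite inE => /orP[/eqP ->|]; first exact: ms lN'.
exact: hN.
Unshelve. all: by end_near. Qed.

Lemma ler_sum_subset (s t : seq V) (F : V -> R) : uniq s -> uniq t ->
  {subset t <= s} -> (forall l, 0 <= F l) -> \sum_(l <- t) F l <= \sum_(l <- s) F l.
Proof.
move=> us ut ts F0; rewrite [leRHS](bigID (mem t))/=.
have -> : \sum_(l <- s | l \in t) F l = \sum_(l <- t) F l.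
  rewrite -big_filter; apply: perm_big; apply: uniq_perm => //; first exact: filter_uniq.
  by move=> l; rewrite mem_filter; case: (boolP (l \in t)) => //= /ts ->.
by rewrite lerDl sumr_ge0.
Qed.

Definition energy (s : seq V) f : R := \sum_(l <- s) sqn (fourier f l).

Lemma energy_ge0 s f : 0 <= energy s f.
Proof. by apply: sumr_ge0 => l _; exact: sqn_ge0. Qed.

Lemma energy_bessel Omega (s : seq V) f : unit_region Omega -> uniq s ->
  L2fun mu (restr Omega f) ->
  {in s &, forall l m, inner mu (expo Omega l) (expo Omega m) = (l == m)%:R} ->
  energy s (restr Omega f) <= nrm2 mu (restr Omega f).
Proof.
move=> uO us jf os; have jE l := L2c_L2fun (L2c_expo l uO).
have := bessel us jE jf os; congr (_ <= _).
by apply: eq_bigr => l _; rewrite inner_expo.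
Qed.

Lemma spectrum_orthonormal Omega Lambda : unit_region Omega -> spectrum Omega Lambda ->
  {in Lambda &, forall l m, inner mu (expo Omega l) (expo Omega m) = (l == m)%:R}.
Proof.
move=> [mO _ _] [oL _] l m; rewrite !inE => Ll Lm.
by rewrite -L2inner_expo// oL.
Qed.

(** The approximant provided by [spectrum] may list a frequency several times, while orthonormal
    expansions need distinct ones. *)
Lemma sum_undup (t : seq V) (c : V -> R[i]) (E : V -> R[i]) :
  \sum_(l <- t) c l * E l = \sum_(l <- undup t) (c l *+ count_mem l t) * E l.
Proof.
rewrite -big_undup_iterop_count/=; apply: eq_bigr => l _.
by rewrite mulrnAl.
Qed.

(** The nontrivial half of Parseval. A combination at squared distance less than [e] from [f]
    forces, by [nrm2_orthonormal], energy above [nrm2 - e] on its own frequencies, and passing to a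
    longer list only adds nonnegative terms. *)
Lemma spectrum_energy Omega Lambda s f e : unit_region Omega ->
  spectrum Omega Lambda -> exhausts Lambda s -> L2fun mu (restr Omega f) -> 0 < e ->
  \forall n \near \oo, nrm2 mu (restr Omega f) - e < energy (s n) (restr Omega f).
Proof.
move=> uO sL es jf e0; have oL := spectrum_orthonormal uO sL.
have [mO _ _] := uO; have [us sLs _ _] := es.
have jE l := L2c_L2fun (L2c_expo l uO).
have /sL.2/(_ (Num.sqrt e)) : L2 Omega f by apply/L2_restr.
rewrite sqrtr_gt0 => /(_ e0) [t [c [tL]]].
have rE : restr Omega (fun x => f x - \sum_(l <- t) c l * cexp l x) =
    fun x => restr Omega f x - \sum_(l <- undup t) (c l *+ count_mem l t) * expo Omega l x.
  rewrite restrB_sum; apply/funext => x; congr (_ - _).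
  exact: (sum_undup t c (expo Omega ^~ x)).
rewrite L2norm_lt ?sqrtr_gt0//; last first.
  by rewrite rE; apply: L2funB => //; apply: L2fun_sum => l; exact: L2funZ.
rewrite sqr_sqrtr ?(ltW e0)// rE nrm2_orthonormal ?undup_uniq//; last first.
  by move=> l m; rewrite !mem_undup => lt mt; apply: oL; rewrite inE; exact: tL.
set A := \sum_(l <- _) _; set B := \sum_(l <- _) _ => h.
have B0 : 0 <= B by apply: sumr_ge0 => l _; exact: sqn_ge0.
have : \forall n \near \oo, {subset undup t <= s n}.
  by apply: (exhausts_near es) => l; rewrite mem_undup; exact: tL.
apply: filterS => n ts.
have : A <= energy (s n) (restr Omega f).
  rewrite /A; under eq_bigr do rewrite inner_expo.
  by apply: ler_sum_subset => //; [exact: undup_uniq|move=> l; exact: sqn_ge0].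
move: h B0; clear; move: (nrm2 _ _) (energy _ _) A B => p q r u; lra.
Qed.

Lemma Re_realM (r : R) (z : R[i]) : complex.Re (r%:C%C * z) = r * complex.Re z.
Proof. by case: z => u v /=; rewrite mul0r subr0. Qed.

Lemma rintegrable_shift (a : V -> R) l : mu.-integrable setT (EFin \o a) ->
  mu.-integrable setT (EFin \o (fun x => a (x + l))).
Proof.
move=> ja; have ca : cintegrable mu (fun x => (a x)%:C%C).
  by split=> //; exact: integrable0.
by have [] := cintegrable_shift l ca.
Qed.

Lemma Rintegral_overlap D (s : seq V) (a : V -> R) : measurable D ->
  mu.-integrable setT (EFin \o a) ->
  \int[mu]_y (\1_D y * \sum_(l <- s) a (y + l)) =
  \int[mu]_z (complex.Re (overlap D s z) * a z).
Proof.
move=> mD ja; have ca : cintegrable mu (fun x => (a x)%:C%C).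
  by split=> //; exact: integrable0.
have /(congr1 (@complex.Re R)) := cint_overlap s mD ca.
rewrite /cint => e; apply: etrans (etrans _ e) _; apply: eq_Rintegral => x _.
  by rewrite Re_realM -rmorph_sum.
by rewrite mulrC Re_realM mulrC.
Qed.

Lemma Rintegral_eq0 (a : V -> R) : mu.-integrable setT (EFin \o a) ->
  (forall x, 0 <= a x) -> \int[mu]_x a x <= 0 -> mu.-negligible [set x | a x != 0].
Proof.
move=> ja a0 h; have /integrableP[ma _] := ja.
have : (\int[mu]_x `|(EFin \o a) x| = 0)%E.
  apply/eqP; rewrite eq_le integral_ge0 ?andbT//.
  under eq_integral do rewrite /= ger0_norm//.
  rewrite -[X in (X <= _)%E]fineK ?lee_fin//.
  exact: integrable_fin_num.
move/(ae_eq_integral_abs mu measurableT ma) => [N [mN N0 hN]].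
exists N; split=> // x /= ax; apply: hN => /= /(_ I) [] /eqP.
exact/negP.
Qed.

Lemma energy_modulate (s : seq V) h y :
  energy s (modulate y h) = \sum_(l <- s) sqn (fourier h (y + l)).
Proof. by apply: eq_bigr => l _; rewrite fourier_modulate addrC. Qed.

Lemma rintegrable_indicM A (a : V -> R) : measurable A ->
  mu.-integrable setT (EFin \o a) -> mu.-integrable setT (EFin \o (fun x => \1_A x * a x)).
Proof.
move=> mA ja; have /integrableP[/measurable_EFinP ma _] := ja.
apply: (le_rintegrable _ (integrable_norm ja)) => [|x /=].
  by apply: measurable_funM => //; exact: measurable_indic.
by rewrite normrM ger0_norm// ler_piMl.
Qed.

Lemma rintegrable_indic A : unit_region A -> mu.-integrable setT (EFin \o (\1_A : V -> R)).
Proof.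
move=> uA; have [_ jA] := L2c_L2fun (L2c_cindic uA).
by apply: eq_integrable jA => // x _ /=; rewrite sqn_cindic.
Qed.

Lemma Rintegral_indic1 A : unit_region A -> \int[mu]_x (\1_A x : R) = 1.
Proof.
move=> uA; rewrite -(nrm2_unit uA); apply: eq_Rintegral => x _.
by rewrite sqn_cindic.
Qed.

Lemma overlapE D Lambda (t : seq V) : is_packing D Lambda -> uniq t ->
  [set` t] `<=` Lambda -> overlap D t = cindic (covered D [set` t]).
Proof.
move=> pD ut tL; apply/funext => x.
have [[c ->]|[c ->]] := cindicP (covered D [set` t]) x.
  by have [l lt Dl] := c; rewrite (overlap1 pD ut tL lt Dl).
by rewrite overlap0// => l lt Dl; apply: c; exists l.
Qed.

Lemma measurable_energy_modulate (s : seq V) h : L2c h ->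
  measurable_fun setT (fun y => energy s (modulate y h)).
Proof.
move=> jh; rewrite (_ : (fun y => _) = fun y => \sum_(l <- s) sqn (fourier h (y + l))).
  apply: measurable_sum => l.
  exact: (measurableT_comp (measurable_sqn (cmeasurable_fourier jh)) (measurable_shift_rV l)).
by apply/funext => y; rewrite energy_modulate.
Qed.

(* The average over [y] in [D] of the energy of [modulate y h] is the mass of
   [|fourier h|^2] on [D + s n]. *)
Lemma spectrum_uncovered Omega D Lambda s x : unit_region Omega -> unit_region D ->
  open D ->
  is_packing D Lambda -> spectrum Omega Lambda -> exhausts Lambda s ->
  mu.-negligible [set z | ~ covered D Lambda z /\ fourier (cindic Omega) (z + x) != 0].
Proof.
move=> uO uD oD pD sL es; have mC := measurable_covered Lambda oD; have oL := spectrum_orthonormal uO sL.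
have [us sLs _ _] := es; have [mD _ _] := uD.
pose h := modulate x (cindic Omega).
have jh : L2c h by apply/L2c_modulate/L2c_cindic.
have hy y : modulate y h = restr Omega (modulate y h).
  by apply/funext => z; rewrite /h modulateD /restr /modulate mulrA cindic_sqr.
have jhy y : L2fun mu (restr Omega (modulate y h)).
  by rewrite -hy; apply/L2c_L2fun/L2c_modulate.
have nhy y : nrm2 mu (restr Omega (modulate y h)) = 1.
  by rewrite -hy !nrm2_modulate nrm2_unit.
have [_ jF] := L2fun_fourier jh.
have F1 : \int[mu]_z sqn (fourier h z) = 1.
  by rewrite -[LHS]/(nrm2 mu (fourier h)) nrm2_fourier// nrm2_modulate nrm2_unit.
have jC := rintegrable_indicM mC jF.
have en_le1 n y : energy (s n) (modulate y h) <= 1.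
  rewrite hy -(nhy y); apply: energy_bessel => // l m ln mn.
  by apply: oL; rewrite inE; exact: sLs (ln) || exact: sLs mn.
have J1 : 1 <= \int[mu]_z (\1_(covered D Lambda) z * sqn (fourier h z)).
  apply/ler_addgt0Pr => e e0.
  pose a_ n y := \1_D y * (1 - energy (s n) (modulate y h)).
  have [||||N _ /(_ N (leqnn N))] := @Rintegral_dominated0 _ _ R mu a_ (\1_D) _ _ _ _ e e0.
  - move=> n; apply: measurable_funM; first exact: measurable_indic.
    by apply: measurable_funB => //; exact: measurable_energy_modulate.
  - exact: rintegrable_indic.
  - apply: aeW => y e1 e10; have := spectrum_energy uO sL es (jhy y) e10.
    apply: filterS => n; rewrite nhy -hy => en.
    rewrite /a_ normrM ger0_norm//; apply: (@le_lt_trans _ _ `|1 - energy (s n) (modulate y h)|).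
      by rewrite ler_piMl.
    by rewrite ger0_norm ?subr_ge0//; lra.
  - move=> n y; rewrite /a_ normrM ger0_norm// ler_piMr//.
    by rewrite ger0_norm ?subr_ge0// gerBl energy_ge0.
  move=> /=; have je : mu.-integrable setT (EFin \o (fun y => \1_D y * energy (s N) (modulate y h))).
    apply: (le_rintegrable _ (rintegrable_indic uD)) => [|y].
      apply: measurable_funM; first exact: measurable_indic.
      exact: measurable_energy_modulate.
    by rewrite normrM ger0_norm// ler_piMr// ger0_norm ?energy_ge0.
  have -> : \int[mu]_y a_ N y = 1 - \int[mu]_y (\1_D y * energy (s N) (modulate y h)).
    rewrite -(Rintegral_indic1 uD) -RintegralB//; last exact: rintegrable_indic.
    by apply: eq_Rintegral => y _; rewrite /a_ mulrBr mulr1.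
  under eq_Rintegral do rewrite energy_modulate.
  rewrite (Rintegral_overlap (s N) mD jF) => /ltr_normlW.
  have : \int[mu]_z (complex.Re (overlap D (s N) z) * sqn (fourier h z)) <=
      \int[mu]_z (\1_(covered D Lambda) z * sqn (fourier h z)).
    rewrite (overlapE pD (us N) (sLs N)); apply: le_Rintegral => //.
      exact: (rintegrable_indicM (measurable_covered _ oD) jF).
    move=> z _; apply: ler_wpM2r; first exact: sqn_ge0.
    change ((\1_(covered D [set` s N]) z : R) <= \1_(covered D Lambda) z).
    rewrite !indicE ler_nat; case: (boolP (z \in covered D [set` s N])) => //.
    by rewrite inE => -[l ln Dl]; rewrite mem_set//; exists l => //; exact: (sLs N).
  move: (\int[mu]_z _) (\int[mu]_z _) => p q; lra.
have j1C : mu.-integrable setT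
    (EFin \o (fun z => sqn (fourier h z) - \1_(covered D Lambda) z * sqn (fourier h z))).
  by have := integrableB measurableT jF jC; apply: eq_integrable.
have : mu.-negligible [set z | sqn (fourier h z) -
    \1_(covered D Lambda) z * sqn (fourier h z) != 0].
  apply: (Rintegral_eq0 j1C).
    by move=> z; rewrite subr_ge0 ler_piMl ?sqn_ge0.
  by rewrite RintegralB// F1 subr_le0.
apply: negligibleS => z [nz hz] /=.
rewrite indicE memNset// mul0r subr0 fourier_modulate.
by apply: contra_neq hz => /sqn_eq0.
Qed.

Lemma unit_region_nonempty D : unit_region D -> exists x, D x.
Proof.
move=> [_ _ D1]; apply: contrapT => h; move: D1.
rewrite (_ : D = set0) ?measure0; first by move=> /eqP; rewrite eq_sym onee_eq0.
by apply/seteqP; split=> // x Dx; apply: h; exists x.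
Qed.

Lemma exhausts_ex Lambda D : unit_region D -> open D -> is_packing D Lambda ->
  exists s, exhausts Lambda s.
Proof.
move=> uD oD pD; have [x0 Dx0] := unit_region_nonempty uD.
exact: countable_enum (is_packing_countable oD Dx0 pD).
Qed.

(** Each uncovered [z] has a rational vector close to [- z], for which the translated transform at
    [z] is close to its value 1 at the origin. Rational vectors are countable, so the uncovered set
    lies in a countable union of null sets. *)
Lemma spectrum_tiling Omega D Lambda : unit_region Omega -> unit_region D -> open D ->
  orthogonal_packing_region Omega D -> spectrum Omega Lambda -> tiling D Lambda.
Proof.
move=> uO uD oD OD sL.
have pD := orthogonal_packing uO OD (spectrum_orthonormal uO sL).
have [s es] := exhausts_ex uD oD pD; apply/(tilingP pD).
pose q k : V := oapp (map_mx (@ratr R)) 0 (unpickle k : option 'rV[rat]_d).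
apply: (@negligibleS _ _ _ _ (\bigcup_k
    [set z | ~ covered D Lambda z /\ fourier (cindic Omega) (z + q k) != 0])); last first.
  by apply: negligible_bigcup => k; exact: spectrum_uncovered es.
move=> z nz.
(* A squared distance below 1 from the value 1 at the origin is exactly what excludes the value
   0. *)
have /nbhs_ballP[e /= e0 he] := cvg_fourier 0 (L2c_cindic uO) (@ltr01 R).
have pex i : exists p : rat, `|z ord0 i + ratr p| < e.
  have : - z ord0 i < - z ord0 i + e by rewrite ltrDl.
  move=> /rat_in_itvoo[p]; rewrite in_itv/= => /andP[p1 p2]; exists p.
  by rewrite ltr_norml; apply/andP; split; lra.
pose p : 'rV[rat]_d := \row_i sval (cid (pex i)).
exists (pickle p) => //; split=> //; rewrite /q pickleK /=; apply/eqP => F0.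
suff /he : ball 0 e (z + map_mx (@ratr R) p).
  rewrite /= F0 subr0 fourier_cindic0//.
  by rewrite /sqn /= expr1n expr0n addr0 ltxx.
split=> // i j; rewrite (ord1 i) /ball /= !mxE sub0r normrN.
by case: (cid (pex j)).
Qed.

End spectrum_tiling.

(** * From tilings to spectra *)

Section defect.
Variables (R : realType) (d : nat).
Local Notation V := 'rV[R]_d.
Local Notation mu := (@lebesgue_rV R d).
Implicit Types (f g h : V -> R[i]) (x y z l m : V) (A Omega D Lambda : set V).
Implicit Types t : seq V.

(** A sesquilinear form and not only its diagonal, because cutting a function into pieces produces
    mixed terms. *)
Definition defect t f g : R[i] :=
  \sum_(l <- t) fourier f l * conjc (fourier g l) - inner mu f g.

Lemma inner_modulate y f g : inner mu (modulate y f) (modulate y g) = inner mu f g.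
Proof.
rewrite /inner; congr cint; apply/funext => x.
by rewrite /modulate conjcM mulrACA cis_conjc mulr1.
Qed.

Lemma defect_modulate t f g y : defect t (modulate y f) (modulate y g) =
  \sum_(l <- t) fourier f (y + l) * conjc (fourier g (y + l)) - inner mu f g.
Proof.
rewrite /defect inner_modulate; congr (_ - _); apply: eq_bigr => l _.
by rewrite !fourier_modulate (addrC l).
Qed.

Lemma defectDl t f1 f2 g : L2c f1 -> L2c f2 -> L2c g ->
  defect t (fun x => f1 x + f2 x) g = defect t f1 g + defect t f2 g.
Proof.
move=> j1 j2 jg; rewrite /defect innerDl; try exact: L2c_L2fun.
rewrite fourierD// opprD addrACA -big_split/=; congr (_ + _).
by apply: eq_bigr => l _; rewrite mulrDl.
Qed.

Lemma defectZl t c f g : L2c f -> L2c g ->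
  defect t (fun x => c * f x) g = c * defect t f g.
Proof.
move=> jf jg; rewrite /defect innerZl; try exact: L2c_L2fun.
rewrite fourierZ// mulrBr mulr_sumr; congr (_ - _).
by apply: eq_bigr => l _; rewrite mulrA.
Qed.

Lemma defectJ t f g : L2c f -> L2c g -> defect t g f = conjc (defect t f g).
Proof.
move=> jf jg; rewrite /defect (innerC (L2c_L2fun jf) (L2c_L2fun jg)).
rewrite [RHS]rmorphB rmorph_sum; congr (_ - _); apply: eq_bigr => l _.
by rewrite [RHS]rmorphM [X in _ = _ * X]conjcK mulrC.
Qed.

Lemma defectZr t c f g : L2c f -> L2c g ->
  defect t f (fun x => c * g x) = conjc c * defect t f g.
Proof.
by move=> jf jg; rewrite defectJ ?defectZl//; [rewrite conjcM -defectJ|exact: L2cZ].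
Qed.

Lemma defectBl t f1 f2 g : L2c f1 -> L2c f2 -> L2c g ->
  defect t (fun x => f1 x - f2 x) g = defect t f1 g - defect t f2 g.
Proof.
move=> j1 j2 jg; rewrite (_ : (fun x => _) = fun x => f1 x + (-1) * f2 x).
  by rewrite defectDl ?defectZl ?mulN1r//; exact: L2cZ.
by apply/funext => x; rewrite mulN1r.
Qed.

Lemma defectBr t f g1 g2 : L2c f -> L2c g1 -> L2c g2 ->
  defect t f (fun x => g1 x - g2 x) = defect t f g1 - defect t f g2.
Proof.
move=> jf j1 j2; rewrite defectJ ?defectBl//; last exact: L2cB.
by rewrite [LHS]rmorphB; congr (_ - _); apply/esym; exact: defectJ.
Qed.

Lemma defect_ff t f : defect t f f = (energy t f - nrm2 mu f)%:C%C.
Proof.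
rewrite /defect inner_nrm2 rmorphB/= rmorph_sum/=; congr (_ - _).
by apply: eq_bigr => l _; rewrite mul_conjc.
Qed.

(** Cauchy-Schwarz by induction on the list; in [key] the cross term is controlled by the inequality
    between the arithmetic and geometric means of [P * B] and [A * Q]. *)
Lemma sqn_sumM_le (I : Type) (r : seq I) (a b : I -> R[i]) :
  sqn (\sum_(i <- r) a i * conjc (b i)) <=
  (\sum_(i <- r) sqn (a i)) * (\sum_(i <- r) sqn (b i)).
Proof.
have key (c x y : R[i]) (A B : R) : 0 <= A -> 0 <= B -> sqn c <= A * B ->
    sqn (x * conjc y + c) <= (sqn x + A) * (sqn y + B).
  move=> A0 B0; have P0 := sqn_ge0 x; have Q0 := sqn_ge0 y; have S0 := sqn_ge0 c.
  have -> : sqn (x * conjc y + c) = sqn x * sqn y + sqn c +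
      2 * complex.Re (x * conjc y * conjc c).
    by move: x y c {P0 Q0 S0} => [? ?] [? ?] [? ?]; rewrite /sqn /=; ring.
  have : complex.Re (x * conjc y * conjc c) ^+ 2 <= sqn x * sqn y * sqn c.
    rewrite -[sqn y]sqnJ -[sqn c]sqnJ -!sqnM /sqn lerDl; exact: sqr_ge0.
  move: (complex.Re _) (sqn x) (sqn y) (sqn c) P0 Q0 S0 => v P Q S P0 Q0 S0 vS SAB.
  have PQ0 : 0 <= P * Q by exact: mulr_ge0.
  have vY : (2 * v) ^+ 2 <= (P * B + A * Q) ^+ 2.
    have h1 : P * Q * S <= P * Q * (A * B) by exact: ler_wpM2l.
    have := sqr_ge0 (P * B - A * Q); have := le_trans vS h1.
    by clear; nra.
  have : 2 * v <= P * B + A * Q.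
    apply: le_trans (ler_norm _) _; rewrite -(@ger0_norm _ (P * B + A * Q)); last first.
      by rewrite addr_ge0// mulr_ge0.
    by rewrite -ler_sqr ?nnegrE// !real_normK ?num_real.
  move: SAB {vS vY}; clear; nra.
elim: r => [|i r IH]; first by rewrite !big_nil sqn0 mul0r.
rewrite !big_cons; apply: key => //; apply: sumr_ge0 => j _; exact: sqn_ge0.
Qed.

Lemma sqn_defect_le t f g (C : R) : L2c f -> L2c g -> 0 <= C ->
  energy t f <= C * nrm2 mu f -> energy t g <= C * nrm2 mu g ->
  sqn (defect t f g) <= (2 * C ^+ 2 + 2) * (nrm2 mu f * nrm2 mu g).
Proof.
move=> jf jg C0 ef eg; apply: le_trans (sqnD_le _ _) _; rewrite sqnN [leRHS]mulrDl.
apply: lerD; last by rewrite ler_pM2l//; apply: sqn_inner_le; exact: L2c_L2fun.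
rewrite -mulrA ler_pM2l//; apply: le_trans (sqn_sumM_le _ _ _) _.
rewrite expr2 mulrACA; apply: ler_pM => //; exact: energy_ge0.
Qed.

End defect.

(** * Averages of the defect over D *)

Section averaging.
Variables (R : realType) (d : nat).
Local Notation V := 'rV[R]_d.
Local Notation mu := (@lebesgue_rV R d).
Implicit Types (f g h : V -> R[i]) (x y z l m : V) (A Omega D P Q Lambda : set V).
Implicit Types t : seq V.

(** Unfolding turns the sum over [t] into the weight [overlap D t]. Since [D] has measure 1, the
    subtracted [inner mu f g] keeps its value on average, and Plancherel writes it as the same
    integral with weight 1. *)
Lemma cint_restr_defect D Lambda t f g : unit_region D -> open D ->
  is_packing D Lambda -> uniq t -> [set` t] `<=` Lambda -> L2c f -> L2c g ->
  cint mu (restr D (fun y => defect t (modulate y f) (modulate y g))) =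
  inner mu (fun z => (overlap D t z - 1) * fourier f z) (fourier g).
Proof.
move=> uD oD pD ut tL jf jg; have [mD _ D1] := uD.
pose Phi z := fourier f z * conjc (fourier g z).
have jPhi : cintegrable mu Phi by apply: cintegrable_inner; exact: L2fun_fourier.
have jD : cintegrable mu (cindic D) by apply/cintegrable_L2c/L2c_cindic.
have jo : cintegrable mu (fun z => overlap D t z * Phi z).
  by rewrite (overlapE pD ut tL); apply: cintegrableM_cindic => //; exact: measurable_covered.
have -> : restr D (fun y => defect t (modulate y f) (modulate y g)) =
    fun y => cindic D y * (\sum_(l <- t) Phi (y + l)) - inner mu f g * cindic D y.
  by apply/funext => y; rewrite /restr defect_modulate mulrBr [_ * inner _ _ _]mulrC.
rewrite cintB; last first.
- exact: cintegrableZ.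
- apply: cintegrableM_cindic => //; apply: cintegrable_sum => l.
  exact: cintegrable_shift.
rewrite cint_overlap// cintZ// cint_cindic// D1 mulr1.
rewrite -(plancherel jf jg) /inner -cintB//; congr cint; apply/funext => z.
by rewrite -!mulrA mulrBl mul1r.
Qed.

Lemma near_overlap D Lambda s x : is_packing D Lambda -> exhausts Lambda s ->
  covered D Lambda x -> \forall n \near \oo, overlap D (s n) x = 1.
Proof.
move=> pD [us sL ms exs] [l Ll Dl]; have [N lN] := exs l Ll; exists N => // n /= Nn.
by apply: (overlap1 pD (us n) (sL n) _ Dl); exact: ms lN.
Qed.

(** The weight [overlap - 1] tends to 0 at every covered point, hence almost everywhere, and has
    modulus at most 1; dominated convergence and Cauchy-Schwarz conclude. *)
Lemma near_cint_restr_defect D Lambda s f g : unit_region D -> open D ->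
  is_packing D Lambda -> exhausts Lambda s -> mu.-negligible (~` covered D Lambda) ->
  L2c f -> L2c g -> forall e, 0 < e -> \forall n \near \oo,
  sqn (cint mu (restr D (fun y => defect (s n) (modulate y f) (modulate y g)))) < e.
Proof.
move=> uD oD pD es cD jf jg e e0; have [us sL _ _] := es.
have jFf := L2fun_fourier jf; have jFg := L2fun_fourier jg.
have oE n := overlapE pD (us n) (sL n).
have le1 n z : sqn ((overlap D (s n) z - 1) * fourier f z) <= sqn (fourier f z).
  rewrite sqnM ler_piMl ?sqn_ge0// oE.
  by have [[_ ->]|[_ ->]] := cindicP (covered D [set` s n]) z;
    rewrite ?subrr ?sub0r ?sqnN ?sqn0// sqnR expr1n.
have mo n : cmeasurable (fun z => (overlap D (s n) z - 1) * fourier f z).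
  apply: cmeasurableM; last exact: jFf.1.
  apply: cmeasurableB; last exact: cmeasurable_cst.
  by rewrite oE; apply: cmeasurable_cindic; exact: measurable_covered.
have jo n : L2fun mu (fun z => (overlap D (s n) z - 1) * fourier f z).
  exact: le_L2fun (mo n) jFf.2 (le1 n).
have c0 : 0 < nrm2 mu g + 1 by rewrite ltr_wpDl ?nrm2_ge0.
have [||||N _ hN] := @Rintegral_dominated0 _ _ R mu
    (fun n z => sqn ((overlap D (s n) z - 1) * fourier f z))
    (fun z => sqn (fourier f z)) _ jFf.2 _ _ (e / (nrm2 mu g + 1)).
- by move=> n; exact: measurable_sqn.
- apply: negligibleS cD => z /= nz c; apply: nz => e' e'0.
  apply: filterS (near_overlap pD es c) => n ->.
  by rewrite subrr mul0r sqn0 normr0.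
- by move=> n z; rewrite ger0_norm ?sqn_ge0.
- exact: divr_gt0.
exists N => // n /hN /=.
rewrite -[\int[mu]_x _]/(nrm2 mu _) ger0_norm ?nrm2_ge0// ltr_pdivlMr// => h.
rewrite (cint_restr_defect uD oD pD (us n) (sL n) jf jg).
apply: le_lt_trans (sqn_inner_le (jo n) jFg) _; rewrite nrm2_fourier//.
by apply: le_lt_trans h; rewrite ler_wpM2l ?nrm2_ge0// lerDl.
Qed.

End averaging.

(** * Functions concentrated on small pieces *)

Section pieces.
Variables (R : realType) (d : nat).
Local Notation V := 'rV[R]_d.
Local Notation mu := (@lebesgue_rV R d).
Implicit Types (f g h : V -> R[i]) (c x y z l m : V) (A Omega D P Q Lambda : set V).
Implicit Types (t : seq V) (e : R).

Lemma le_halving (a b M : R) : (forall k, a <= b + M / 2 ^+ k) -> a <= b.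
Proof.
move=> h; apply/ler_addgt0Pr => e e0.
pose k := Num.bound (M / e).
have := upper_nthrootP (leqnn k); rewrite ltr_pdivrMr// => Mk.
apply: le_trans (h k) _; rewrite lerD2l ler_pdivrMr ?exprn_gt0// mulrC.
exact: ltW.
Qed.

Definition concentrated P f := forall x, ~ P x -> f x = 0.

(* [P] is so small around [c] that the characters with frequency in [D] are
   almost constant on it. *)
Definition flat D P c e := forall y x, D y -> P x ->
  sqn (1 - cis (- (2 * pi * dotp y (x - c)))) <= e.

(** On a small piece around [c], modulation by [y] is nearly multiplication by a constant phase; the
    factor in front undoes this phase, so that the result is close to [f]. *)
Definition centered c y f : V -> R[i] :=
  fun x => cis (2 * pi * dotp y c) * modulate y f x.

Lemma centered_close D P c e f y x : flat D P c e -> D y -> concentrated P f ->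
  sqn (f x - centered c y f x) <= e * sqn (f x).
Proof.
move=> fP Dy cf; rewrite /centered.
have -> : f x - cis (2 * pi * dotp y c) * modulate y f x =
    f x * (1 - cis (- (2 * pi * dotp y (x - c)))).
  rewrite /modulate mulrCA -cisD mulrBr mulr1; congr (_ - _ * cis _).
  by rewrite dotpDr dotpNr; ring.
have [Px|/cf ->] := pselect (P x); last by rewrite mul0r sqn0 mulr0.
by rewrite sqnM mulrC ler_wpM2r ?sqn_ge0//; exact: fP.
Qed.

Lemma L2c_centered c y f : L2c f -> L2c (centered c y f).
Proof. by move=> jf; apply: L2cZ; exact: L2c_modulate. Qed.

Lemma concentrated_centered P c y f : concentrated P f -> concentrated P (centered c y f).
Proof. by move=> cf x nx; rewrite /centered /modulate cf// mul0r mulr0. Qed.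

Lemma concentratedB P f g : concentrated P f -> concentrated P g ->
  concentrated P (fun x => f x - g x).
Proof. by move=> cf cg x nx; rewrite cf// cg// subr0. Qed.

Lemma nrm2_centered c y f : L2c f -> nrm2 mu (centered c y f) = nrm2 mu f.
Proof.
move=> jf; rewrite nrm2Z ?sqn_cis ?mul1r ?nrm2_modulate//.
exact/L2c_L2fun/L2c_modulate.
Qed.

Lemma nrm2_centeredB D P c e f y : flat D P c e -> D y -> concentrated P f -> L2c f ->
  nrm2 mu (fun x => f x - centered c y f x) <= e * nrm2 mu f.
Proof.
move=> fP Dy cf jf; apply: le_nrm2 => [||x].
- by apply/L2c_L2fun/L2cB => //; exact: L2c_centered.
- exact: L2c_L2fun.
- exact: centered_close fP Dy cf.
Qed.

Lemma energyZ t (a : R[i]) f : L2c f -> energy t (fun x => a * f x) = sqn a * energy t f.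
Proof.
move=> jf; rewrite /energy fourierZ// mulr_sumr; apply: eq_bigr => l _.
by rewrite sqnM.
Qed.

Lemma energyB_le t f g : L2c f -> L2c g ->
  energy t f <= 2 * energy t g + 2 * energy t (fun x => f x - g x).
Proof.
move=> jf jg; rewrite /energy !mulr_sumr -big_split/=; apply: ler_sum => l _.
rewrite fourierB//; have := sqnD_le (fourier g l) (fourier f l - fourier g l).
by rewrite [fourier g l + _]addrC subrK.
Qed.

Lemma energy_centered t c y f : L2c f ->
  energy t (centered c y f) = energy t (modulate y f).
Proof.
by move=> jf; rewrite energyZ ?sqn_cis ?mul1r//; exact: L2c_modulate.
Qed.

(** Cauchy-Schwarz for each frequency separately: a bound that grows with [t], but suffices to start
    the iteration in [piece_bessel]. *)
Lemma energy_size t f Omega : unit_region Omega -> concentrated Omega f -> L2c f ->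
  energy t f <= (size t)%:R * nrm2 mu f.
Proof.
move=> uO cf jf; have fE : f = restr Omega f.
  apply/funext => x; have [[_ e]|[nx e]] := cindicP Omega x; rewrite /restr e ?mul1r//.
  by rewrite mul0r cf.
have -> : (size t)%:R * nrm2 mu f = \sum_(l <- t) nrm2 mu f.
  by rewrite big_const_seq count_predT iter_addr_0 mulr_natl.
apply: ler_sum => l _.
rewrite fE -inner_expo -fE -[leRHS]mulr1.
have -> : 1 = nrm2 mu (expo Omega l) by rewrite expoE nrm2_modulate nrm2_unit.
by apply: sqn_inner_le; [exact: L2c_L2fun|exact/L2c_L2fun/L2c_expo].
Qed.

(** Bessel's inequality on average over [D]. It rests on the disjointness of the translates, which
    bounds the weight [overlap] by 1, and not on orthogonality of exponentials. *)
Lemma Rintegral_energy_modulate D Lambda t f : unit_region D -> open D ->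
  is_packing D Lambda -> uniq t -> [set` t] `<=` Lambda -> L2c f ->
  mu.-integrable setT (EFin \o (fun y => \1_D y * energy t (modulate y f))) /\
  \int[mu]_y (\1_D y * energy t (modulate y f)) <= nrm2 mu f.
Proof.
move=> uD oD pD ut tL jf; have [mD _ _] := uD; have [_ jF] := L2fun_fourier jf.
have mC := measurable_covered [set` t] oD.
split; last first.
  under eq_Rintegral do rewrite energy_modulate.
  rewrite (Rintegral_overlap t mD jF) (overlapE pD ut tL) -(nrm2_fourier jf).
  apply: le_Rintegral => //; first exact: (rintegrable_indicM mC jF).
  by move=> z _; rewrite ler_piMl ?sqn_ge0//=.
have [_ jf2] := L2c_L2fun jf.
rewrite (_ : (fun y => _) = fun y => \sum_(l <- t) \1_D y * sqn (fourier f (y + l))).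
  have jl l : mu.-integrable setT (EFin \o (fun y => \1_D y * sqn (fourier f (y + l)))).
    exact: (rintegrable_indicM mD (rintegrable_shift l jF)).
  elim: t {ut tL mC} => [|l t IH].
    by under eq_fun do rewrite big_nil; exact: integrable0.
  by under eq_fun do rewrite big_cons; exact: rintegrableD.
by apply/funext => y; rewrite energy_modulate mulr_sumr.
Qed.

(* The fixed point of [C |-> 2 + C / 2] is the constant 4 of [piece_bessel]. *)
Lemma piece_bessel_step D Lambda P c e t (C : R) : unit_region D -> open D ->
  is_packing D Lambda -> uniq t -> [set` t] `<=` Lambda ->
  flat D P c e -> e <= 4^-1 -> 0 <= C ->
  (forall f, L2c f -> concentrated P f -> energy t f <= C * nrm2 mu f) ->
  (forall f, L2c f -> concentrated P f -> energy t f <= (2 + C / 2) * nrm2 mu f).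
Proof.
move=> uD oD pD ut tL fP e4 C0 hC f jf cf.
have [je le] := Rintegral_energy_modulate uD oD pD ut tL jf.
have key y : D y -> energy t f <= 2 * energy t (modulate y f) + C / 2 * nrm2 mu f.
  move=> Dy; apply: le_trans (energyB_le t jf (L2c_centered c y jf)) _.
  rewrite energy_centered// lerD2l.
  have := hC _ (L2cB jf (L2c_centered c y jf)) (concentratedB cf (concentrated_centered c y cf)).
  have := nrm2_centeredB fP Dy cf jf; have := nrm2_ge0 mu f.
  move: (nrm2 _ _) (nrm2 _ _) (energy _ _) => q p r p0 h1 h2.
  have : C * q <= C * (4^-1 * p) by rewrite ler_wpM2l// (le_trans h1)// ler_wpM2r.
  by move: h2; clear; nra.
have jD := rintegrable_indic uD.
have j1 := rintegrableZ (energy t f) jD.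
have j2 := rintegrableD (rintegrableZ 2 je) (rintegrableZ (C / 2 * nrm2 mu f) jD).
have := @le_Rintegral _ _ _ mu setT _ _ measurableT j1 j2.
rewrite RintegralD//; last 2 first.
- exact: rintegrableZ.
- exact: rintegrableZ.
rewrite !RintegralZl// Rintegral_indic1// !mulr1 => H.
apply: le_trans (H _) _.
  move=> y _; rewrite /= indicE; have [|_] := boolP (y \in D).
    by rewrite inE => Dy; rewrite !mulr1 mul1r; exact: key.
  by rewrite !mulr0 mul0r mulr0 addr0.
by rewrite [leRHS]mulrDl lerD2r ler_pM2l.
Qed.

(** Each pass of [piece_bessel_step] halves the excess of the constant over 4. In the limit the
    initial [size t] disappears, and the bound is uniform over finite parts of [Lambda]. *)
Lemma piece_bessel Omega D Lambda P c e t f : unit_region Omega -> P `<=` Omega ->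
  unit_region D -> open D -> is_packing D Lambda -> uniq t -> [set` t] `<=` Lambda ->
  flat D P c e -> e <= 4^-1 -> L2c f -> concentrated P f ->
  energy t f <= 4 * nrm2 mu f.
Proof.
move=> uO PO uD oD pD ut tL fP e4 jf cf.
have st := piece_bessel_step uD oD pD ut tL fP e4.
have H k : forall f, L2c f -> concentrated P f ->
    energy t f <= (4 + (size t)%:R / 2 ^+ k) * nrm2 mu f.
  elim: k => [|k IH] h jh ch.
    apply: le_trans (energy_size t uO _ jh) _ => [x nx|].
      by apply: ch => /PO.
    by rewrite expr0 divr1 ler_wpM2r ?nrm2_ge0// lerDr.
  have := st (4 + (size t)%:R / 2 ^+ k) _ IH h jh ch.
  rewrite addr_ge0 ?divr_ge0 ?exprn_ge0// => /(_ isT).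
  congr (_ <= _ * _); rewrite exprS invfM; field.
  by rewrite expf_neq0.
apply: (@le_halving _ _ ((size t)%:R * nrm2 mu f)) => k.
by apply: le_trans (H k f jf cf) _; rewrite [leLHS]mulrDl lerD2l mulrAC.
Qed.

End pieces.

(** * Contraction of the defect between two pieces *)

Section defect_pieces.
Variables (R : realType) (d : nat).
Local Notation V := 'rV[R]_d.
Local Notation mu := (@lebesgue_rV R d).
Implicit Types (f g h : V -> R[i]) (c x y z l m : V) (A Omega D P Q Lambda : set V).
Implicit Types (t : seq V) (e : R).

Lemma dotpC x y : dotp x y = dotp y x :> R.
Proof. by apply: eq_bigr => i _; rewrite mulrC. Qed.

Lemma cmeasurable_defect t f g : L2c f -> L2c g ->
  cmeasurable (fun y => defect t (modulate y f) (modulate y g)).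
Proof.
move=> jf jg; have mF h l : L2c h -> cmeasurable (fun y => fourier h (y + l)).
  move=> jh; have [mr mi] := cmeasurable_fourier jh.
  by split; [exact: (measurableT_comp mr (measurable_shift_rV l))|
    exact: (measurableT_comp mi (measurable_shift_rV l))].
under eq_fun do rewrite defect_modulate.
apply: cmeasurableB; last exact: cmeasurable_cst.
elim: t => [|l t IH]; first by under eq_fun do rewrite big_nil; exact: cmeasurable_cst.
under eq_fun do rewrite big_cons; apply: cmeasurableD => //.
by apply: cmeasurableM; [|apply: cmeasurableJ]; exact: mF.
Qed.

Lemma sqn_cint_restr D f : unit_region D -> L2fun mu (restr D f) ->
  sqn (cint mu (restr D f)) <= nrm2 mu (restr D f).
Proof.
move=> uD jf; rewrite -[leRHS]mulr1 -(nrm2_unit uD).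
have -> : cint mu (restr D f) = inner mu (restr D f) (cindic D).
  by congr cint; apply/funext => x; rewrite /restr cindicJ mulrAC cindic_sqr.
by apply: sqn_inner_le => //; exact/L2c_L2fun/L2c_cindic.
Qed.

(** Sesquilinearity leaves only the relative phase of the two centres, whose average over [y] in [D]
    is a value of the transform of the indicator of [D]. *)
Lemma defect_centered t c c' y f g : L2c f -> L2c g ->
  defect t (centered c y f) (centered c' y g) =
  cis (2 * pi * dotp (c - c') y) * defect t (modulate y f) (modulate y g).
Proof.
move=> jf jg; have jMf := L2c_modulate y jf; have jMg := L2c_modulate y jg.
rewrite /centered defectZl//; last exact: L2cZ.
rewrite defectZr// mulrA; congr (_ * _); rewrite -cisN -cisD; congr cis.
by rewrite dotpDl dotpNl !(dotpC y); ring.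
Qed.

Lemma sqn_defectB t c c' y f g : L2c f -> L2c g ->
  sqn (cis (- (2 * pi * dotp (c - c') y)) * defect t f g -
       defect t (modulate y f) (modulate y g)) <=
  2 * sqn (defect t (fun x => f x - centered c y f x) g) +
  2 * sqn (defect t (centered c y f) (fun x => g x - centered c' y g x)).
Proof.
move=> jf jg; have jcf := L2c_centered c y jf; have jcg := L2c_centered c' y jg.
have e1 := cis_conjc (2 * pi * dotp (c - c') y); rewrite -cisN in e1.
have e2 (z : R[i]) : sqn z = sqn (cis (2 * pi * dotp (c - c') y) * z) by rewrite sqnM sqn_cis mul1r.
rewrite [leLHS]e2 mulrBr mulrA e1 mul1r.
rewrite -defect_centered//.
have -> : defect t f g - defect t (centered c y f) (centered c' y g) =
    defect t (fun x => f x - centered c y f x) g +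
    defect t (centered c y f) (fun x => g x - centered c' y g x).
  by rewrite defectBl// defectBr// addrA subrK.
exact: sqnD_le.
Qed.

(* [fourier (cindic D) (c - c') * defect f g] is, up to a vanishing term, the
   average of [G n y] over [y] in [D]; there [G n y] only involves the defects
   of [f - centered c y f] and [g - centered c' y g], which are small multiples
   of [f] and [g] in norm. *)
Lemma defect_halving_step Omega D Lambda s P Q c c' e2 r2 K : unit_region Omega ->
  unit_region D -> open D -> is_packing D Lambda -> exhausts Lambda s ->
  mu.-negligible (~` covered D Lambda) ->
  P `<=` Omega -> Q `<=` Omega -> flat D P c e2 -> flat D Q c' e2 ->
  0 <= e2 -> e2 <= 4^-1 -> 0 < r2 -> 16 * e2 <= r2 ->
  r2 <= sqn (fourier (cindic D) (c - c')) -> 0 <= K ->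
  (forall f g, L2c f -> L2c g -> concentrated P f -> concentrated Q g ->
    forall e, 0 < e -> \forall n \near \oo,
      sqn (defect (s n) f g) <= K * (nrm2 mu f * nrm2 mu g) + e) ->
  (forall f g, L2c f -> L2c g -> concentrated P f -> concentrated Q g ->
    forall e, 0 < e -> \forall n \near \oo,
      sqn (defect (s n) f g) <= K / 2 * (nrm2 mu f * nrm2 mu g) + e).
Proof.
move=> uO uD oD pD es cD PO QO fP fQ e20 e24 r20 e2r r2F K0 hK f g jf jg cf cg e e0.
have [us sL _ _] := es; have [mD _ _] := uD.
set N := nrm2 mu f * nrm2 mu g.
have N0 : 0 <= N by rewrite mulr_ge0 ?nrm2_ge0.
(* By [sqn_defectB] and [hK], each of the two error defects contributes [2 * K * e2 * N] in the
   limit; [b] is their sum. *)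
pose b := 4 * e2 * K * N.
have b0 : 0 <= b by do 3![apply: mulr_ge0 => //].
pose G n y := cis (- (2 * pi * dotp (c - c') y)) * defect (s n) f g -
  defect (s n) (modulate y f) (modulate y g).
have mG n : cmeasurable (G n).
  apply: cmeasurableB; last exact: cmeasurable_defect.
  by apply: cmeasurableM; [exact: cmeasurable_char|exact: cmeasurable_cst].
have B34 n f' g' : L2c f' -> L2c g' -> concentrated P f' -> concentrated Q g' ->
    sqn (defect (s n) f' g') <= 34 * (nrm2 mu f' * nrm2 mu g').
  move=> jf' jg' cf' cg'.
  have := @sqn_defect_le R d (s n) f' g' 4 jf' jg' (ler0n _ _)
    (piece_bessel uO PO uD oD pD (us n) (sL n) fP e24 jf' cf')
    (piece_bessel uO QO uD oD pD (us n) (sL n) fQ e24 jg' cg').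
  by congr (_ <= _ * _); ring.
have conM A h y : concentrated A h -> concentrated A (modulate y h).
  by move=> ch x nx; rewrite /modulate ch// mul0r.
(* [136 = 2 * 34 + 2 * 34]; this bound, uniform in [n] and [y], is the dominating function below. *)
have Gle n y : sqn (G n y) <= 136 * N.
  rewrite /G; apply: le_trans (sqnD_le _ _) _; rewrite sqnN sqnM sqn_cis mul1r.
  have h1 := B34 n f g jf jg cf cg.
  have := B34 n _ _ (L2c_modulate y jf) (L2c_modulate y jg) (conM _ _ y cf) (conM _ _ y cg).
  rewrite !nrm2_modulate -/N; move: h1; rewrite -/N.
  by move: (sqn _) (sqn _) (N) => p q r; clear; lra.
have Gnear y e' : D y -> 0 < e' -> \forall n \near \oo, sqn (G n y) - b < e'.
  move=> Dy e'0; have jcf := L2c_centered c y jf; have jcg := L2c_centered c' y jg.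
  have e80 : 0 < e' / 8 by rewrite divr_gt0.
  have ccf := concentrated_centered c y cf; have ccg := concentrated_centered c' y cg.
  have h1 := hK _ _ (L2cB jf jcf) jg (concentratedB cf ccf) cg _ e80.
  have h2 := hK _ _ jcf (L2cB jg jcg) ccf (concentratedB cg ccg) _ e80.
  have n1 := nrm2_centeredB fP Dy cf jf; have n2 := nrm2_centeredB fQ Dy cg jg.
  near=> n; have := sqn_defectB (s n) c c' y jf jg; rewrite -/(G n y).
  have : sqn (defect (s n) (fun x => f x - centered c y f x) g) <= K * e2 * N + e' / 8.
    apply: le_trans (near h1 n _) _; first by [].
    by rewrite lerD2r -mulrA ler_wpM2l// /N mulrA ler_wpM2r ?nrm2_ge0.
  have : sqn (defect (s n) (centered c y f) (fun x => g x - centered c' y g x)) <=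
      K * e2 * N + e' / 8.
    apply: le_trans (near h2 n _) _; first by [].
    rewrite lerD2r -mulrA ler_wpM2l// /N nrm2_centered// mulrCA ler_wpM2l ?nrm2_ge0//.
  rewrite /b -!mulrA; move: (sqn _) (sqn _) (sqn _) => p q r.
  rewrite (mulrCA e2 K); move: (K * (e2 * N)) => u; move: e'0; clear; lra.
(* Only the excess of [sqn (G n y)] over [b] tends to 0, at a rate that may depend on [y]; dominated
   convergence is applied to its positive part. *)
pose a_ n y := \1_D y * Num.max 0 (sqn (G n y) - b).
have jD := rintegrable_indic uD.
(* The final estimate bounds [sqn (defect (s n) f g) * r2] by [2 * (b + dl) + 2 * dl]. Here
   [4 * dl = e * r2], and [16 * e2 <= r2] gives [2 * b <= r2 * (K / 2 * N)], which is the announced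
   halving. *)
pose dl := e * r2 / 4.
have dl0 : 0 < dl by rewrite /dl !mulr_gt0// invr_gt0.
have ma n : measurable_fun setT (a_ n).
  apply: measurable_funM; first exact: measurable_indic.
  apply: measurable_maxr => //; apply: measurable_funB => //.
  exact: measurable_sqn.
have ale n y : `|a_ n y| <= 136 * N * \1_D y.
  rewrite /a_ normrM ger0_norm// mulrC ler_wpM2r// ger0_norm ?le_max ?lexx//.
  rewrite ge_max mulr_ge0//=; apply: le_trans (Gle n y); rewrite gerBl//.
have near_a : \forall n \near \oo, `|\int[mu]_y a_ n y| < dl.
  apply: (@Rintegral_dominated0 _ _ R mu a_ (fun y => 136 * N * \1_D y)) => //.
    exact: rintegrableZ.
  apply: aeW => y e' e'0; have [Dy|nD] := pselect (D y); last first.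
    by near=> n; rewrite /a_ indicE memNset// mul0r normr0.
  apply: filterS (Gnear y e' Dy e'0) => n Gn.
  by rewrite /a_ indicE mem_set// mul1r ger0_norm ?le_max ?lexx// gt_max e'0.
have near_r := near_cint_restr_defect uD oD pD es cD jf jg dl0.
have jG n : L2fun mu (restr D (G n)).
  apply: (@le_L2fun _ _ _ _ _ (fun y => 136 * N * \1_D y)).
  - by apply: cmeasurableM => //; exact: cmeasurable_cindic.
  - exact: rintegrableZ.
  - by move=> y; rewrite /restr sqnM sqn_cindic mulrC ler_wpM2r.
apply: filterS2 near_a near_r => n an rn.
have nG : nrm2 mu (restr D (G n)) <= b + dl.
  have ja : mu.-integrable setT (EFin \o a_ n).
    apply: (@le_rintegrable _ _ _ mu (a_ n) (fun y => 136 * N * \1_D y)) => //.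
    exact: rintegrableZ.
  have jb := rintegrableZ b jD.
  have := @le_Rintegral _ _ _ mu setT _ _ measurableT (jG n).2 (rintegrableD ja jb).
  rewrite RintegralD// RintegralZl// Rintegral_indic1// mulr1 => H.
  apply: le_trans (H _) _ => [y _|]; last first.
    rewrite addrC lerD2l; apply: le_trans (ler_norm _) _.
    exact: ltW an.
  rewrite /restr sqnM sqn_cindic /a_ (mulrC b) -mulrDr ler_wpM2l//.
  by rewrite -lerBlDr le_max lexx orbT.
have cG : cint mu (restr D (fun y => defect (s n) (modulate y f) (modulate y g))) =
    defect (s n) f g * fourier (cindic D) (c - c') - cint mu (restr D (G n)).
  have jA : L2c (fun y => defect (s n) f g * modulate (c - c') (cindic D) y).
    exact: (L2cZ _ (L2c_modulate _ (L2c_cindic uD))).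
  have -> : defect (s n) f g * fourier (cindic D) (c - c') =
      cint mu (fun y => defect (s n) f g * modulate (c - c') (cindic D) y).
    rewrite fourierE cintZ//.
    exact: cintegrable_L2c (L2c_modulate _ (L2c_cindic uD)).
  rewrite -(cintB (cintegrable_L2c jA) (cintegrable_L2c (L2c_restr uD (jG n)))).
  congr cint; apply/funext => y.
  rewrite /restr /G [modulate (c - c') _ y]/modulate.
  move: (defect _ _ _) (defect _ _ _) (cindic _ _) (cis _) => *; ring.
have FB : defect (s n) f g * fourier (cindic D) (c - c') = cint mu (restr D (G n)) +
    cint mu (restr D (fun y => defect (s n) (modulate y f) (modulate y g))).
  by rewrite cG [RHS]addrC subrK.
have := sqnD_le (cint mu (restr D (G n)))
  (cint mu (restr D (fun y => defect (s n) (modulate y f) (modulate y g)))).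
rewrite -FB sqnM; have := sqn_cint_restr uD (jG n).
have : sqn (defect (s n) f g) * r2 <=
    sqn (defect (s n) f g) * sqn (fourier (cindic D) (c - c')).
  by rewrite ler_wpM2l ?sqn_ge0.
have : 16 * b <= r2 * (4 * (K * N)).
  rewrite (_ : 16 * b = 16 * e2 * (4 * (K * N))); last by rewrite /b; ring.
  by apply: ler_wpM2r => //; apply: mulr_ge0 => //; exact: mulr_ge0.
move=> h1 h2 h3 h4; rewrite -(ler_pM2r r20).
rewrite [leRHS](_ : _ = r2 * (4 * (K * N)) / 8 + dl * 4); last first.
  by rewrite /dl; field.
move: rn nG h1 h2 h3 h4.
move: (_ * r2) (sqn (defect _ _ _) * sqn _) (nrm2 _ _) (sqn (cint _ _)) (sqn (cint _ _)).
by move: (r2 * _) (b) (dl); clear => *; lra.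
Unshelve. all: by end_near. Qed.

End defect_pieces.

(** * Vanishing of the defect on compact subsets of Omega *)

Section compact_support.
Variables (R : realType) (d : nat).
Local Notation V := 'rV[R]_d.
Local Notation mu := (@lebesgue_rV R d).
Implicit Types (f g h : V -> R[i]) (c x y z l m : V) (A K Omega D P Q Lambda : set V).
Implicit Types (t : seq V) (e : R) (s : nat -> seq V).

Definition tiling_data Omega D Lambda s := [/\ unit_region Omega,
  unit_region D /\ open D, is_packing D Lambda, exhausts Lambda s &
  mu.-negligible (~` covered D Lambda)].

Definition vanishing s f g := forall e, 0 < e ->
  \forall n \near \oo, sqn (defect (s n) f g) < e.

Lemma vanishingC s f g : L2c f -> L2c g -> vanishing s f g -> vanishing s g f.
Proof.
move=> jf jg v e e0; apply: filterS (v e e0) => n.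
by rewrite (defectJ _ jg jf) sqnJ.
Qed.

Lemma vanishingDl s f1 f2 g : L2c f1 -> L2c f2 -> L2c g ->
  vanishing s f1 g -> vanishing s f2 g -> vanishing s (fun x => f1 x + f2 x) g.
Proof.
move=> j1 j2 jg v1 v2 e e0; have e4 : 0 < e / 4 by rewrite divr_gt0.
apply: filterS2 (v1 _ e4) (v2 _ e4) => n h1 h2; rewrite defectDl//.
by apply: le_lt_trans (sqnD_le _ _) _; lra.
Qed.

Lemma vanishing0l s g : L2c g -> vanishing s (fun=> 0) g.
Proof.
move=> jg e e0; near=> n.
rewrite (_ : (fun=> 0) = fun x => 0 * g x); last by apply/funext => x; rewrite mul0r.
by rewrite defectZl// mul0r sqn0.
Unshelve. all: by end_near. Qed.

(** The iteration starts at [34 = 2 * 4 ^ 2 + 2], from the constant 4 of [piece_bessel]. Each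
    halving holds only for large [n], so the number [k] of halvings is fixed before [n] grows. *)
Lemma vanishing_pieces Omega D Lambda s P Q c c' (e2 r2 : R) :
  tiling_data Omega D Lambda s ->
  P `<=` Omega -> Q `<=` Omega -> flat D P c e2 -> flat D Q c' e2 ->
  0 <= e2 -> e2 <= 4^-1 -> 0 < r2 -> 16 * e2 <= r2 ->
  r2 <= sqn (fourier (cindic D) (c - c')) ->
  forall f g, L2c f -> L2c g -> concentrated P f -> concentrated Q g ->
  vanishing s f g.
Proof.
move=> [uO [uD oD] pD es cD] PO QO fP fQ e20 e24 r20 e2r r2F f g jf jg cf cg.
have [us sL _ _] := es.
have H k : forall f g, L2c f -> L2c g -> concentrated P f -> concentrated Q g ->
    forall e, 0 < e -> \forall n \near \oo,
      sqn (defect (s n) f g) <= 34 / 2 ^+ k * (nrm2 mu f * nrm2 mu g) + e.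
  elim: k => [|k IH] f' g' jf' jg' cf' cg' e e0.
    near=> n.
    have := @sqn_defect_le R d (s n) f' g' 4 jf' jg' (ler0n _ _)
      (piece_bessel uO PO uD oD pD (us n) (sL n) fP e24 jf' cf')
      (piece_bessel uO QO uD oD pD (us n) (sL n) fQ e24 jg' cg').
    rewrite expr0 divr1 (_ : 2 * 4 ^+ 2 + 2 = 34); last by ring.
    by move=> h; apply: le_trans h _; rewrite lerDl ltW.
  have K0 : 0 <= 34 / 2 ^+ k :> R by rewrite divr_ge0// exprn_ge0.
  have -> : 34 / 2 ^+ k.+1 = 34 / 2 ^+ k / 2 :> R by rewrite exprSr invfM mulrA.
  exact: (defect_halving_step uO uD oD pD es cD PO QO fP fQ e20 e24 r20 e2r r2F K0 IH).
move=> e e0; have e20' : 0 < e / 2 by rewrite divr_gt0.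
pose M := 34 * (nrm2 mu f * nrm2 mu g) / (e / 2).
have := upper_nthrootP (leqnn (Num.bound M)); set k := Num.bound M.
rewrite /M ltr_pdivrMr// => hk.
apply: filterS (H k f g jf jg cf cg _ e20') => n hn; apply: le_lt_trans hn _.
rewrite [ltRHS](splitr e) ltrD2r mulrAC ltr_pdivrMr ?exprn_gt0// mulrC.
by rewrite mulrC (mulrC (e / 2)).
Unshelve. all: by end_near. Qed.

(** One ball is removed at a time: the part of [f] inside it is a piece, and the part outside is
    concentrated on the remaining balls, however much the balls overlap. *)
Lemma concentrated_ind K (e : R) (cs : seq V) (T : (V -> R[i]) -> Prop) :
  T (fun=> 0) ->
  (forall f g, L2c f -> L2c g -> T f -> T g -> T (fun x => f x + g x)) ->
  (forall c f, c \in cs -> L2c f -> concentrated (K `&` ball c e) f -> T f) ->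
  forall f, L2c f -> concentrated (K `&` [set x | exists2 c, c \in cs & ball c e x]) f -> T f.
Proof.
move=> T0 TD; elim: cs => [_ f jf cf|c cs IH Tc f jf cf].
  suff -> : f = fun=> 0 by [].
  by apply/funext => x; apply: cf => -[_ []].
have mB : measurable (ball c e : set V) by apply: open_measurable_rV; exact: ball_open.
pose f1 x := f x * cindic (ball c e) x; pose f2 x := f x * cindic (~` ball c e) x.
have fE : f = fun x => f1 x + f2 x.
  apply/funext => x; rewrite /f1 /f2 -mulrDr.
  have [[Bx ->]|[Bx ->]] := cindicP (ball c e : set V) x.
    by rewrite cindicF ?addr0 ?mulr1// => /(_ Bx).
  by rewrite cindicT ?add0r ?mulr1.
have j1 : L2c f1 by exact: L2c_restrict.
have j2 : L2c f2 by apply: L2c_restrict => //; exact: measurableC.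
rewrite fE; apply: TD => //.
  apply: (Tc c) => //; first exact: mem_head.
  move=> x nx; rewrite /f1; have [[Bx ->]|[Bx ->]] := cindicP (ball c e : set V) x.
    by rewrite mulr1; apply: cf => -[Kx _]; exact: nx.
  by rewrite mulr0.
apply: IH => // [c' h c's|x nx].
  by apply: Tc; rewrite inE c's orbT.
rewrite /f2; have [[Bx ->]|[Bx ->]] := cindicP (~` ball c e : set V) x; last by rewrite mulr0.
rewrite mulr1; apply: cf => -[Kx [c']]; rewrite inE => /orP[/eqP ->//|c's B'].
by apply: nx; split=> //; exists c'.
Qed.

Lemma continuous_sqn_fourier f : L2c f -> continuous (fun x : V => sqn (fourier f x)).
Proof.
move=> jf; have [cr ci] := continuous_fourier jf => x.
pose u y := complex.Re (fourier f y); pose v y := complex.Im (fourier f y).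
have cuu := @continuousM R V u u x (cr x) (cr x).
have cvv := @continuousM R V v v x (ci x) (ci x).
have := @continuousD R R V (u \* u) (v \* v) x cuu cvv.
rewrite (_ : (u \* u) + (v \* v) = fun y => sqn (fourier f y))//.
Qed.

(** The continuous function attains its minimum on [K * K], and a zero there would lie in
    [Omega - Omega]; this is where the packing condition on [Omega] with respect to [D] enters. *)
Lemma fourier_lower_bound Omega D K : unit_region D -> K `<=` Omega -> compact K ->
  orthogonal_packing_region D Omega ->
  exists2 r2 : R, 0 < r2 & forall x y, K x -> K y ->
    r2 <= sqn (fourier (cindic D) (x - y)).
Proof.
move=> uD KO cK [_ _ _ DO].
have [[x0 Kx0]|nK] := pselect (K !=set0); last first.
  by exists 1 => // x y Kx; exfalso; apply: nK; exists x.
have cS : continuous (fun p : V * V => p.1 - p.2).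
  by move=> p; apply: (@cvgB R V _ (nbhs p)); [exact: cvg_fst|exact: cvg_snd].
have cu : continuous (fun p : V * V => sqn (fourier (cindic D) (p.1 - p.2))).
  move=> p; apply: (@continuous_comp _ _ _ (fun p : V * V => p.1 - p.2)
    (fun x => sqn (fourier (cindic D) x))); first exact: cS.
  by apply: continuous_sqn_fourier; exact: L2c_cindic.
have [|[a b]] := compact_EVT_min _ (compact_setX cK cK) (continuous_subspaceT cu).
  by exists (x0, x0).
rewrite inE => -[/= Ka Kb] h.
exists (sqn (fourier (cindic D) (a - b))); last first.
  by move=> x y Kx Ky; have := h (x, y); apply; rewrite inE.
rewrite lt_neqAle sqn_ge0 andbT eq_sym; apply/eqP => /sqn_eq0 F0.
suff : (diff_set Omega `&` zero_set (fourier \1_D)) (a - b) by rewrite DO.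
split; first by exists a; [exact: KO|exists b; [exact: KO|]].
by rewrite /zero_set /= indic_cindic.
Qed.

Lemma flat_ball D e : unit_region D -> 0 < e ->
  exists2 r : R, 0 < r & forall c, flat D (ball c r) c e.
Proof.
move=> [_ [r0 Dr0] _] e0; pose b := Num.max r0 1.
have b0 : 0 < b by rewrite lt_max ltr01 orbT.
have Db : D `<=` cube b by apply: subset_trans Dr0 _; apply: cubeS; rewrite le_max lexx.
(* [d.+1] in place of [d] keeps [C] positive in dimension 0. *)
pose C := 2 * pi * (d.+1%:R * b).
have C0 : 0 < C by rewrite /C !mulr_gt0// pi_gt0.
(* The minimum with 1 ensures [e1 ^+ 2 <= e], as the phase is estimated before squaring. *)
pose e1 := Num.min 1 e; have e10 : 0 < e1 by rewrite lt_min ltr01.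
exists (e1 / C); first exact: divr_gt0.
move=> c y x Dy [_ Bx]; rewrite -[1]cis0; apply: le_trans (sqn_cisB _ _) _.
rewrite sub0r opprK dotpC -[leLHS]ger0_norm ?sqr_ge0//.
have -> : `|(2 * pi * dotp (x - c) y) ^+ 2| = (2 * pi * `|dotp (x - c) y|) ^+ 2.
  by rewrite normrX !normrM (@ger0_norm _ 2)// (@ger0_norm _ pi)// pi_ge0.
have h1 : `|dotp (x - c) y| <= d.+1%:R * (e1 / C) * b.
  apply: le_trans (dotp_cube_le _ (Db _ Dy)) _; rewrite ler_wpM2r ?(ltW b0)//.
  apply: (@le_trans _ _ (\sum_(i < d) (e1 / C))).
    apply: ler_sum => i _; rewrite !mxE distrC; apply: ltW.
    exact: (Bx ord0 i).
  by rewrite sumr_const card_ord -[leLHS]mulr_natl ler_wpM2r ?ler_nat// ltW// divr_gt0.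
have h2 : 2 * pi * `|dotp (x - c) y| <= e1.
  apply: le_trans (_ : 2 * pi * (d.+1%:R * (e1 / C) * b) <= _).
    by rewrite ler_pM2l// mulr_gt0// pi_gt0.
  rewrite (_ : 2 * pi * (d.+1%:R * (e1 / C) * b) = C * (e1 / C)); last first.
    by rewrite /C; ring.
  by rewrite mulrCA divff ?mulr1// gt_eqF.
apply: (@le_trans _ _ (e1 ^+ 2)).
  by rewrite lerXn2r// nnegrE ?(ltW e10)// mulr_ge0// mulr_ge0// pi_ge0.
rewrite expr2; apply: (@le_trans _ _ (1 * e1)).
  by rewrite ler_wpM2r ?(ltW e10)// ge_min lexx.
by rewrite mul1r ge_min lexx orbT.
Qed.

(** The order of choices matters: [K] determines the lower bound [r2], this the tolerance [e2], and
    this the radius of the balls; only then is the finite cover chosen, and all pairs of its pieces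
    satisfy the same hypotheses. *)
Lemma vanishing_compact Omega D Lambda s K f g : tiling_data Omega D Lambda s ->
  orthogonal_packing_region D Omega -> compact K -> K `<=` Omega ->
  L2c f -> L2c g -> concentrated K f -> concentrated K g -> vanishing s f g.
Proof.
move=> td OD cK KO jf jg cf cg; have [_ [uD _] _ _ _] := td.
have [r2 r20 hr2] := fourier_lower_bound uD KO cK OD.
(* [4^-1] serves the uniform bound on pieces, [r2 / 16] the halving of the defect. *)
pose e2 : R := Num.min 4^-1 (r2 / 16).
have e20 : 0 < e2 by rewrite lt_min invr_gt0 divr_gt0// andbT ltr0n.
have e24 : e2 <= 4^-1 by rewrite ge_min lexx.
have e2r : 16 * e2 <= r2 by rewrite mulrC -ler_pdivlMr// ge_min lexx orbT.
have [r r0 fl] := flat_ball uD e20.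
have [cs csK Kcs] : exists2 cs : seq V, (forall c, c \in cs -> K c) &
    K `<=` [set x | exists2 c, c \in cs & ball c r x].
  have := cK; rewrite compact_cover => /(_ V K (fun c => ball c r)) [||cs csK Kcs].
  - by move=> c _; exact: ball_open.
  - by move=> x Kx; exists x => //; exact: ballxx.
  exists (finmap.enum_fset cs) => [c /csK|x /Kcs[c cc Bx]]; first by rewrite inE.
  by exists c.
have flK c : flat D (K `&` ball c r) c e2 by move=> y x Dy [_ Bx]; exact: fl.
have sO c : K `&` ball c r `<=` Omega by move=> x [Kx _]; exact: KO.
have cKcs h : concentrated K h ->
    concentrated (K `&` [set x | exists2 c, c \in cs & ball c r x]) h.
  by move=> ch x nx; apply: ch => Kx; apply: nx; split=> //; exact: Kcs.
(* This cuts the first argument; conjugate symmetry then lets it be used again for the second. *)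
have cut h : L2c h -> (forall c f', c \in cs -> L2c f' ->
    concentrated (K `&` ball c r) f' -> vanishing s f' h) ->
    forall f', L2c f' -> concentrated K f' -> vanishing s f' h.
  move=> jh H f' jf' cf'.
  apply: (@concentrated_ind K r cs (fun f => vanishing s f h)) => //.
  - exact: vanishing0l.
  - by move=> f1 f2 j1 j2; exact: vanishingDl.
  - exact: cKcs.
apply: (cut g jg) jf cf => c f' cc jf' cf'.
apply: (vanishingC jg jf'); apply: (cut f' jf') jg cg => c' g' cc' jg' cg'.
apply: (vanishing_pieces td (sO c') (sO c) (flK c') (flK c) (ltW e20) e24 r20 e2r _
  jg' jf' cg' cf').
by apply: hr2; exact: csK.
Qed.

(** The points at distance at least [e] from the complement of [Omega], written so that closedness
    is immediate; they exhaust an open [Omega] as [e] decreases to 0. *)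
Definition core Omega (e : R) : set V := ~` \bigcup_(y in ~` Omega) ball y e.

Lemma core_sub Omega e : 0 < e -> core Omega e `<=` Omega.
Proof.
move=> e0 x cx; apply: contrapT => nx; apply: cx; exists x => //.
exact: ballxx.
Qed.

Lemma compact_core Omega e : bounded_set Omega -> 0 < e -> compact (core Omega e).
Proof.
move=> bO e0; apply: bounded_closed_compact.
  by apply: sub_boundedr bO => /= A; apply: subset_trans; exact: core_sub.
by apply: open_closedC; apply: bigcup_open => y _; exact: ball_open.
Qed.

Lemma measurable_core Omega e : measurable (core Omega e).
Proof.
apply: measurableC; apply: open_measurable_rV.
by apply: bigcup_open => y _; exact: ball_open.
Qed.

Lemma near_core Omega x : open Omega -> Omega x ->
  \forall n \near \oo, core Omega n.+1%:R^-1 x.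
Proof.
move=> oO Ox; have /nbhs_ballP[e /= e0 he] : nbhs x Omega by exact: open_nbhs_nbhs.
near=> n => -[y ny /ball_sym yx]; apply: ny; apply: he; apply: le_ball yx.
apply: ltW; near: n; exact: near_infty_natSinv_lt (PosNum e0).
Unshelve. all: by end_near. Qed.

End compact_support.

(** * Orthonormality and completeness of the exponentials of a tiling *)

Section tiling_spectrum.
Variables (R : realType) (d : nat).
Local Notation V := 'rV[R]_d.
Local Notation mu := (@lebesgue_rV R d).
Implicit Types (f g h : V -> R[i]) (c x y z l m : V) (A K Omega D P Q Lambda : set V).
Implicit Types (t : seq V) (e : R) (s : nat -> seq V).

Definition truncate Omega n f : V -> R[i] := fun x => f x * cindic (core Omega n.+1%:R^-1) x.

Lemma L2c_truncate Omega n f : L2c f -> L2c (truncate Omega n f).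
Proof. by move=> jf; apply: L2c_restrict => //; exact: measurable_core. Qed.

Lemma concentrated_truncate Omega n f :
  concentrated (core Omega n.+1%:R^-1) (truncate Omega n f).
Proof. by move=> x nx; rewrite /truncate cindicF// mulr0. Qed.

Lemma near_truncate Omega f e : open Omega -> L2c f -> concentrated Omega f -> 0 < e ->
  \forall n \near \oo, nrm2 mu (fun x => f x - truncate Omega n f x) < e.
Proof.
move=> oO jf cf e0; have kf := L2c_L2fun jf.
have := @nrm2_dominated_cvg _ _ R mu (fun n x => f x - truncate Omega n f x) f 1 _ kf _ _.
move=> /(_ _ _ _)/cvgrPdist_lt h.
have [||| N _ hN] := h _ _ _ e e0.
- by move=> n; apply: L2funB => //; exact/L2c_L2fun/L2c_truncate.
- move=> x e' e'0; have [Ox|/cf fx] := pselect (Omega x); last first.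
    by near=> n; rewrite /truncate fx mul0r subr0 sqn0.
  apply: filterS (near_core oO Ox) => n cx.
  by rewrite /truncate cindicT// mulr1 subrr sqn0.
- move=> n x; rewrite mul1r /truncate.
  by have [[_ ->]|[_ ->]] := cindicP (core Omega n.+1%:R^-1) x;
    rewrite ?mulr1 ?subrr ?mulr0 ?subr0 ?sqn0 ?sqn_ge0.
exists N => // n /hN /=; rewrite sub0r normrN ger0_norm// nrm2_ge0.
Unshelve. all: by end_near. Qed.

Lemma near_energy Omega D Lambda s n f e : bounded_set Omega ->
  tiling_data Omega D Lambda s -> orthogonal_packing_region D Omega -> L2c f -> 0 < e ->
  \forall k \near \oo,
    `|energy (s k) (truncate Omega n f) - nrm2 mu (truncate Omega n f)| < e.
Proof.
move=> bO td OD jf e0; have e2 : 0 < e ^+ 2 by rewrite exprn_gt0.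
have n0 : 0 < n.+1%:R^-1 :> R by [].
have := vanishing_compact td OD (compact_core bO n0) (core_sub n0) (L2c_truncate _ n jf)
  (L2c_truncate _ n jf) (@concentrated_truncate Omega n f) (@concentrated_truncate Omega n f) e2.
apply: filterS => k; rewrite defect_ff sqnR.
by rewrite -real_normK ?num_real// ltr_pXn2r// nnegrE// ltW.
Qed.

(** The energies along the exhausting lists converge to [nrm2], and every finite list is eventually
    contained in them, so its energy is at most the limit. *)
Lemma truncate_bessel Omega D Lambda s n t f : bounded_set Omega ->
  tiling_data Omega D Lambda s -> orthogonal_packing_region D Omega ->
  uniq t -> [set` t] `<=` Lambda -> L2c f ->
  energy t (truncate Omega n f) <= nrm2 mu (truncate Omega n f).
Proof.
move=> bO td OD ut tL jf; have [_ _ _ es _] := td; have [us _ _ _] := es.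
apply/ler_addgt0Pr => e e0.
have [N _ /(_ N (leqnn N)) [ts /ltW]] := filterI (exhausts_near es tL)
  (near_energy n bO td OD jf e0).
rewrite ler_norml lerBlDr => /andP[_ h]; rewrite addrC; apply: le_trans h.
by apply: ler_sum_subset => // l; exact: sqn_ge0.
Qed.

(* For a truncation [g] of [e_l], Bessel's inequality for the two frequencies
   [l] and [m] reads [|g|^4 + |<g, e_m>|^2 <= |g|^2], where [|g| --> 1]. *)
Lemma tiling_orthonormal Omega D Lambda s l m : open Omega -> bounded_set Omega ->
  tiling_data Omega D Lambda s -> orthogonal_packing_region D Omega ->
  Lambda l -> Lambda m -> inner mu (expo Omega l) (expo Omega m) = (l == m)%:R.
Proof.
move=> oO bO td OD Ll Lm; have [uO _ _ _ _] := td.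
have jE k := L2c_expo k uO; have kE k := L2c_L2fun (jE k).
have nE k : nrm2 mu (expo Omega k) = 1 by rewrite expoE nrm2_modulate nrm2_unit.
have [->|lm] := eqVneq l m; first by rewrite inner_nrm2 nE.
have cE : concentrated Omega (expo Omega l).
  by move=> x nx; rewrite /expo /restr cindicF// mul0r.
apply: sqn_eq0; apply/eqP; rewrite eq_le sqn_ge0 andbT.
apply/ler_addgt0Pr => e e0; rewrite add0r.
have e40 : 0 < e / 4 by rewrite divr_gt0.
have [n _ /(_ n (leqnn n)) /=] := near_truncate oO (jE l) cE e40.
set g := truncate Omega n (expo Omega l) => hn.
have jg : L2c g by exact: L2c_truncate.
have kg := L2c_L2fun jg.
have gR : g = restr Omega g.
  by apply/funext => x; rewrite /g /truncate /expo /restr [RHS]mulrA [in RHS]mulrA cindic_sqr.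
have gE : inner mu g (expo Omega l) = (nrm2 mu g)%:C%C.
  rewrite -inner_nrm2; congr cint; apply/funext => x; rewrite /g /truncate.
  by rewrite [in RHS]conjcM cindicJ [RHS]mulrACA cindic_sqr mulrAC.
have nB : nrm2 mu (fun x => expo Omega l x - g x) = 1 - nrm2 mu g.
  by rewrite nrm2B// nE (innerC kg) // gE /=; ring.
have : energy [:: l; m] g <= nrm2 mu g.
  apply: (truncate_bessel n bO td OD) => //=; first by rewrite inE lm.
  by move=> k /=; rewrite !inE => /orP[] /eqP ->.
rewrite /energy !big_cons big_nil addr0 gR -!inner_expo -gR gE sqnR.
have -> : inner mu (expo Omega l) (expo Omega m) = inner mu g (expo Omega m) +
    inner mu (fun x => expo Omega l x - g x) (expo Omega m).
  by rewrite innerBl// addrC subrK.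
move=> h1; apply: le_trans (sqnD_le _ _) _.
have := sqn_inner_le (L2funB (kE l) kg) (kE m); rewrite nE mulr1 nB => h2.
rewrite nB in hn; move: h1 h2 hn; move: (nrm2 _ _) (sqn _) (sqn _) => p q r.
by clear; nra.
Qed.

(** For completeness, [f] is replaced by a truncation [g] to a compact set. With the coefficients of
    [g], [nrm2_orthonormal] identifies the approximation error as [nrm2 mu g - energy (s k) g],
    which tends to 0. *)
Lemma tiling_spectrum Omega D Lambda s : open Omega -> bounded_set Omega ->
  tiling_data Omega D Lambda s -> orthogonal_packing_region D Omega ->
  spectrum Omega Lambda.
Proof.
move=> oO bO td OD; have [uO _ _ es _] := td; have [mO _ _] := uO.
have [us sL _ _] := es.
have ON l m := tiling_orthonormal oO bO td OD (l := l) (m := m).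
have jE k := L2c_expo k uO; have kE k := L2c_L2fun (jE k).
split=> [l m Ll Lm|f /(L2_restr f mO) kf e e0].
  by rewrite L2inner_expo// ON.
have jf := L2c_restr uO kf.
have cf : concentrated Omega (restr Omega f).
  by move=> x nx; rewrite /restr cindicF// mul0r.
(* Truncation and expansion each cost less than [e ^+ 2 / 4], which [nrm2D_le] doubles; the total
   stays below [e ^+ 2]. *)
have e40 : 0 < e ^+ 2 / 4 by rewrite divr_gt0// exprn_gt0.
have [n _ /(_ n (leqnn n)) /=] := near_truncate oO jf cf e40.
set g := truncate Omega n _ => hn.
have jg : L2c g by exact: L2c_truncate.
have kg := L2c_L2fun jg.
have gR : g = restr Omega g.
  by apply/funext => x; rewrite /g /truncate /restr [RHS]mulrA [in RHS]mulrA cindic_sqr.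
have [k _ /(_ k (leqnn k)) /=] := near_energy n bO td OD jf e40.
rewrite -/g => hk.
exists (s k), (fun l => inner mu g (expo Omega l)); split; first exact: sL.
have jS : L2fun mu (fun x => \sum_(l <- s k) inner mu g (expo Omega l) * expo Omega l x).
  by apply: L2fun_sum => l; exact: L2funZ.
rewrite L2norm_lt//; last by rewrite restrB_sum; exact: L2funB.
rewrite restrB_sum.
have := nrm2_orthonormal (fun l => inner mu g (expo Omega l)) (us k) kE kg.
rewrite [X in _ + X]big1 ?addr0; last by move=> l _; rewrite subrr sqn0.
move=> /(_ (fun l m lk mk => ON l m (sL k l lk) (sL k m mk))) => nS.
have nS' : \sum_(l <- s k) sqn (inner mu g (expo Omega l)) = energy (s k) g.
  by apply: eq_bigr => l _; rewrite [in RHS]gR -inner_expo -gR.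
rewrite (_ : (fun x => restr Omega f x - _) = fun x => (restr Omega f x - g x) +
  (g x - \sum_(l <- s k) inner mu g (expo Omega l) * expo Omega l x)); last first.
  by apply/funext => x; rewrite addrA subrK.
apply: le_lt_trans (nrm2D_le (L2funB kf kg) (L2funB kg jS)) _; rewrite nS nS'.
move: hk; rewrite distrC => /ltr_normlW hk.
move: hn hk; move: (nrm2 _ _) (nrm2 _ _) (energy _ _) (e ^+ 2) => p q r u.
by clear; lra.
Qed.

End tiling_spectrum.

Theorem theorem9 (R : realType) (d : nat) (Omega D Lambda : set 'rV[R]_d)
    (hpair : tight_spectral_pair Omega D) (hLambda : discrete_set Lambda) :
  spectrum Omega Lambda <-> tiling D Lambda.
Proof.
have [[oO bO] [oD bD] [OD D1] [DO O1]] := hpair.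
have uO : unit_region Omega.
  split=> //; first exact: open_measurable_rV.
  by have [r _ ?] := bounded_cube bO; exists r.
have uD : unit_region D.
  split=> //; first exact: open_measurable_rV.
  by have [r _ ?] := bounded_cube bD; exists r.
split=> [|tD]; first exact: spectrum_tiling.
have pD := tiling_packing oD tD.
have [s es] := exhausts_ex uD oD pD.
apply: (@tiling_spectrum _ _ _ D _ s) => //; split=> //.
exact/(tilingP pD).
Qed.
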